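(* If $A,B$ are UDAF digraphs and $\phi:\operatorname{Route}(A)\to\operatorname{Route}(B)$ is a bijection, then the following are equivalent: (1) $\phi$ is a UDAFG isomorphism (from $(\operatorname{Route}(A),A)$ to $(\operatorname{Route}(B),B)$); (2) $\phi$ is a UDAFG$'$ isomorphism (from $(\operatorname{Route}(A),A)$ to $(\operatorname{Route}(B),B)$); (3) $\phi$ is transducerable.
   Context: Maps are written on the right of their arguments and composed left to right; $p\circ q$ means first $p$, then $q$. A digraph $D=(V_D,E_D,s_D,t_D)$ consists of a vertex set, an edge set and functions $s_D,t_D:E_D\to V_D$; $e$ is an edge from $(e)s_D$ to $(e)t_D$. A digraph homomorphism $\phi:D_1\to D_2$ is a pair $(\phi_V,\phi_E)$ with $\phi_V:V_{D_1}\to V_{D_2}$, $\phi_E:E_{D_1}\to E_{D_2}$, $\phi_E s_{D_2}=s_{D_1}\phi_V$ and $\phi_E t_{D_2}=t_{D_1}\phi_V$; $\operatorname{Hom}(D_1,D_2)$ is the set of these. For $n\le m$ in $\mathbb Z\cup\{\pm\infty\}$, $\mathbb Z_{[n,m]}$ is the digraph with vertices $\{i\in\mathbb Z:n\le i\le m\}$ and one edge $(i,i+1)$ from $i$ to $i+1$ whenever $n\le i<i+1\le m$. $\operatorname{Walks}(D)$ is the category with object set $V_D$ whose morphisms are the finite walks, i.e. elements of $\bigcup_{0\le n<\infty}\operatorname{Hom}(\mathbb Z_{[0,n]},D)$ (an element $p$ of $\operatorname{Hom}(\mathbb Z_{[0,n]},D)$ has length $\|p\|=n$ and goes from $(0)p_V$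 to $(n)p_V$), composed by concatenation. It is also regarded as a digraph (objects as vertices, morphisms as edges), and $D$ is identified with the subdigraph of walks of length $1$. A homomorphism $\phi:D_1\to\operatorname{Walks}(D_2)$ extends uniquely to a functor $\widetilde\phi:\operatorname{Walks}(D_1)\to\operatorname{Walks}(D_2)$. A generalised bi-infinite walk in $D$ is a homomorphism $w:\mathbb Z_{[-\infty,\infty]}\to\operatorname{Walks}(D)$; it is degenerate if $\|(n,n+1)w_E\|=0$ for all sufficiently large $n$, or for all sufficiently small $n$. A flattening of a non-degenerate $w$ is a $w_0\in\operatorname{Hom}(\mathbb Z_{[-\infty,\infty]},D)$ for which there is $f:\mathbb Z\to\mathbb Z$ such that for all $z\in\mathbb Z$ and $0\le j<\|(z,z+1)w_E\|$: $(z+1)f=(z)f+\|(z,z+1)w_E\|$ and $((z)f+j,(z)f+j+1)(w_0)_E=(j,j+1)((z,z+1)w_E)_E$ (the first equality being required for all $z$). Two non-degenerate generalised bi-infinite walks are equivalent if they have the same set of flattenings; the classes $[w]$ are called routes and $\operatorname{Route}(D)$ is the set of routes of non-degenerate generalised bi-infinite walks in $D$. For finite $D_1,D_2$, a homomorphism $\phi:D_1\to\operatorname{Walks}(D_2)$ is degenerate if $p\circ\widetilde\phi$ is degenerate for some non-degenerate generalised bi-infinite walk $p$ in $D_1$. If $\phi$ is non-degenerate, $\phi_*:\operatorname{Route}(D_1)\to\operatorname{Route}(D_2)$ is $[p]\mapsto[p\circ\widetilde\phi]$. A UDAF digraph is a finite digraph $D$ such that for every $v\in V_D$ the number of $h\in\operatorname{Hom}(\mathbb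 Z_{[0,\infty]},D)$ with $(0)h_V=v$ is not equal to $1$, and the number of $h\in\operatorname{Hom}(\mathbb Z_{[-\infty,0]},D)$ with $(0)h_V=v$ is not equal to $1$. A UDAF folding is a (non-degenerate) homomorphism $\phi:D_1\to\operatorname{Walks}(D_2)$ such that $\phi_*$ is a bijection (homomorphisms $D_1\to D_2$ are included via $D_2\subseteq\operatorname{Walks}(D_2)$). UDAFG is the smallest category whose objects are the pairs $(\operatorname{Route}(D),D)$ with $D$ a UDAF digraph, in which every $\phi_*$ (for $\phi:D_1\to\operatorname{Walks}(D_2)$ a UDAF folding of UDAF digraphs) is a morphism $(\operatorname{Route}(D_1),D_1)\to(\operatorname{Route}(D_2),D_2)$, and which is closed under composition and inversion of bijections. A UDAF folding $f:D_1\to\operatorname{Walks}(D_2)$ between UDAF digraphs is elementary if one of the following holds. (1) $f$ is a homomorphism embedding $D_1$ into $D_2$ such that $D_2$ consists of the image of $f$ and one other vertex with no edges connected to it. (2) There are a non-loop edge $e\in E_{D_2}$ and a subdigraph $S=(V_{D_1},E_S)$ of $D_1$ such that $f\restriction_S$ is an isomorphism from $S$ to $(V_{D_2},E_{D_2}\setminus\{e\})$, and $f_E\restriction_{E_{D_1}\setminus E_S}$ is a bijection onto $\{p\in\operatorname{Hom}(\mathbb Z_{[0,2]},D_2):(0,1)p_E=e\}$. (3) The same as (2) but with the last set replaced by $\{p\in\operatorname{Hom}(\mathbb Z_{[0,2]},D_2):(1,2)p_E=e\}$. UDAFG$'$ is the subcategory of UDAFG (with the same objects) generated by the maps $\phi_*$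 and $(\phi_* )^{-1}$ for $\phi$ an elementary UDAF folding between UDAF digraphs. A bijection $\phi:\operatorname{Route}(A)\to\operatorname{Route}(B)$ is transducerable if there are a UDAF digraph $T$ and UDAF foldings $g:T\to\operatorname{Walks}(A)$, $h:T\to\operatorname{Walks}(B)$ with $(g_* )^{-1}h_*=\phi$ (first $(g_* )^{-1}$, then $h_*$). *)

(* Defs.v *)
From mathcomp Require Import all_boot all_order ssralg ssrnum ssrint interval.
From mathcomp Require Import boolp classical_sets functions.
From mathcomp Require Import zify.

Set Implicit Arguments.
Unset Strict Implicit.
Unset Printing Implicit Defensive.

Import Order.TTheory GRing.Theory Num.Theory.
Local Open Scope classical_set_scope.
Local Open Scope ring_scope.

(** Conventions: mathcomp composes right to left, so the composite written
    [p o q] (first [p], then [q]) in the literature on right actions is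
    [q \o p] here. *)

(** * Digraphs and homomorphisms *)

Record digraph := Digraph {
  vert : Type;
  edge : Type;
  src : edge -> vert;
  tgt : edge -> vert }.

Arguments src {d} _.
Arguments tgt {d} _.

Record hom (D1 D2 : digraph) := Hom {
  homV : vert D1 -> vert D2;
  homE : edge D1 -> edge D2;
  hom_src : forall e, src (homE e) = homV (src e);
  hom_tgt : forall e, tgt (homE e) = homV (tgt e) }.

Section HomComp.
Variables (D1 D2 D3 : digraph) (g : hom D2 D3) (f : hom D1 D2).

Lemma hom_comp_src e : src ((homE g \o homE f) e) = (homV g \o homV f) (src e).
Proof. by rewrite /= !hom_src. Qed.

Lemma hom_comp_tgt e : tgt ((homE g \o homE f) e) = (homV g \o homV f) (tgt e).
Proof. by rewrite /= !hom_tgt. Qed.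

Definition hom_comp : hom D1 D3 := Hom hom_comp_src hom_comp_tgt.
End HomComp.

Record finDigraph := FinDigraph {
  fvert : finType;
  fedge : finType;
  fsrc : fedge -> fvert;
  ftgt : fedge -> fvert }.

Coercion digraph_of_fin (D : finDigraph) : digraph :=
  @Digraph (fvert D) (fedge D) (@fsrc D) (@ftgt D).

(** * The digraphs Z_[n,m]

    The interval [I] plays the role of [n,m] with [n], [m] possibly infinite;
    the edge [(i, i + 1)] is represented by [i]. *)

Section Zint.
Variable I : interval int.

Definition Zvert := {i : int | i \in I}.
Definition Zedge := {i : int | (i \in I) && (i + 1 \in I)}.

Definition Zsrc (e : Zedge) : Zvert := exist _ (sval e) (andP (svalP e)).1.
Definition Ztgt (e : Zedge) : Zvert := exist _ (sval e + 1) (andP (svalP e)).2.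

Definition Zint := Digraph Zsrc Ztgt.
End Zint.

(** The vertex [z] and the edge [(z, z + 1)] of the bi-infinite line. *)
Definition line_vert (z : int) : vert (Zint `]-oo, +oo[) := exist _ z isT.
Definition line_edge (z : int) : edge (Zint `]-oo, +oo[) := exist _ z isT.

Lemma seg_vert_subproof (n : nat) (i : 'I_n.+1) : i%:Z \in `[0, n%:Z].
Proof. by rewrite in_itv /= lez_nat -ltnS ltn_ord. Qed.

Lemma seg_edge_subproof (n : nat) (i : 'I_n) :
  (i%:Z \in `[0, n%:Z]) && (i%:Z + 1 \in `[0, n%:Z]).
Proof.
by rewrite !in_itv /= -[1]/(1%:Z) -PoszD !lez_nat addn1 ltn_ord (ltnW (ltn_ord i)).
Qed.

Definition seg_vert (n : nat) (i : 'I_n.+1) : vert (Zint `[0, n%:Z]) :=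
  exist _ i%:Z (seg_vert_subproof i).
Definition seg_edge (n : nat) (i : 'I_n) : edge (Zint `[0, n%:Z]) :=
  exist _ i%:Z (seg_edge_subproof i).

(** * Finite walks *)

Definition walk (D : digraph) := {n : nat & hom (Zint `[0, n%:Z]) D}.

Section Walk.
Variable D : digraph.
Implicit Types (p : walk D) (v : vert D) (s : seq (edge D)).

Definition wlen p : nat := projT1 p.
Definition wsrc p : vert D := homV (projT2 p) (seg_vert ord0).
Definition wtgt p : vert D := homV (projT2 p) (seg_vert ord_max).
Definition wedge p (j : 'I_(wlen p)) : edge D := homE (projT2 p) (seg_edge j).
Definition wedges p : seq (edge D) := [seq wedge j | j <- enum 'I_(wlen p)].

Fixpoint chain v s : Prop :=
  if s is e :: s' then src e = v /\ chain (tgt e) s' else True.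

Lemma chain_enum n (vs : 'I_n.+1 -> vert D) (es : 'I_n -> edge D) :
    (forall i, src (es i) = vs (widen_ord (leqnSn n) i)) ->
    (forall i, tgt (es i) = vs (lift ord0 i)) ->
  chain (vs ord0) [seq es i | i <- enum 'I_n] /\
  last (vs ord0) [seq tgt (es i) | i <- enum 'I_n] = vs ord_max.
Proof.
elim: n vs es => [|n IH] vs es Hs Ht.
  by rewrite (size0nil (size_enum_ord 0)) /=; split=> //; congr vs; apply/val_inj.
rewrite enum_ordSl /= -[X in chain _ X]map_comp -[X in last _ X]map_comp.
have [||c l] := IH (vs \o lift ord0) (es \o lift ord0).
- by move=> i /=; rewrite Hs; congr vs; apply/val_inj.
- by move=> i /=; rewrite Ht.
rewrite Ht; split; first split.
- by rewrite Hs; congr vs; apply/val_inj.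
- exact: c.
by apply: etrans l _ => /=; congr vs; apply/val_inj.
Qed.

Lemma wedges_chain p :
  chain (wsrc p) (wedges p) /\ last (wsrc p) [seq tgt e | e <- wedges p] = wtgt p.
Proof.
rewrite /wedges -map_comp.
apply: (chain_enum (vs := fun i => homV (projT2 p) (seg_vert i))) => i.
  by rewrite hom_src; congr homV; apply/val_inj.
by rewrite hom_tgt; congr homV; apply/val_inj; rewrite /= /bump /= add1n -addn1.
Qed.

Lemma size_wedges p : size (wedges p) = wlen p.
Proof. by rewrite size_map size_enum_ord. Qed.

Section MkWalk.
Variables (v : vert D) (s : seq (edge D)) (sP : chain v s).

Lemma mkwalk_edge_subproof (i : edge (Zint `[0, (size s)%:Z])) :
  (`|sval i| < size s)%N.
Proof.
case: i => i /= /andP[]; rewrite !in_itv /= => /andP[i0 _] /andP[_].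
by case: i i0 => // i _; rewrite -[1]/(1%:Z) -PoszD lez_nat addn1.
Qed.

Definition mkwalkV (i : vert (Zint `[0, (size s)%:Z])) : vert D :=
  last v [seq tgt e | e <- take `|sval i| s].
Definition mkwalkE (i : edge (Zint `[0, (size s)%:Z])) : edge D :=
  tnth (in_tuple s) (Ordinal (mkwalk_edge_subproof i)).

Lemma chain_tnth (i : 'I_(size s)) :
  src (tnth (in_tuple s) i) = last v [seq tgt e | e <- take i s] /\
  tgt (tnth (in_tuple s) i) = last v [seq tgt e | e <- take i.+1 s].
Proof.
have e0 := tnth (in_tuple s) i; rewrite !(tnth_nth e0) /=; case: i => i /=.
elim: s v sP i => [|e s' IH] u //= [<- c] [|i] /=; first by rewrite take0.
by rewrite ltnS => /(IH _ c).
Qed.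

Lemma mkwalk_src i : src (mkwalkE i) = mkwalkV (src i).
Proof. by rewrite /mkwalkE (chain_tnth _).1. Qed.

Lemma mkwalk_tgt i : tgt (mkwalkE i) = mkwalkV (tgt i).
Proof.
rewrite /mkwalkE (chain_tnth _).2 /mkwalkV /=; congr (last _ (map _ (take _ _))).
case: i => i /= /andP[]; rewrite in_itv /= => /andP[i0 _] _.
by case: i i0 => // i _; rewrite -[1]/(1%:Z) -PoszD addn1.
Qed.

(** The walk starting at [v] with successive edges [s]. *)
Definition mkwalk : walk D := existT _ (size s) (Hom mkwalk_src mkwalk_tgt).

Lemma wsrc_mkwalk : wsrc mkwalk = v.
Proof. by rewrite /wsrc /= /mkwalkV /= take0. Qed.

Lemma wtgt_mkwalk : wtgt mkwalk = last v [seq tgt e | e <- s].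
Proof. by rewrite /wtgt /= /mkwalkV /= take_size. Qed.

Lemma wedges_mkwalk : wedges mkwalk = s.
Proof.
rewrite /wedges /= -[RHS](map_tnth_enum (in_tuple s)).
by apply: eq_map => j; rewrite /wedge /= /mkwalkE; congr tnth; apply/val_inj.
Qed.
End MkWalk.
End Walk.

(** [Walks D] as a digraph. *)
Definition Walks (D : digraph) : digraph := Digraph (@wsrc D) (@wtgt D).

Lemma chain1 (D : digraph) (e : edge D) : chain (src e) [:: e].
Proof. by []. Qed.

Definition walk1 (D : digraph) (e : edge D) : walk D := mkwalk (chain1 e).

(** The inclusion of [D] in [Walks D] as the walks of length 1. *)
Definition incl (D : digraph) : hom D (Walks D) :=
  @Hom D (Walks D) id (@walk1 D)
    (fun e => wsrc_mkwalk (chain1 e)) (fun e => wtgt_mkwalk (chain1 e)).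

(** * The functor Walks D1 -> Walks D2 extending phi : D1 -> Walks D2 *)

Section Extend.
Variables (D1 D2 : digraph) (phi : hom D1 (Walks D2)).

Definition ext_edges (s : seq (edge D1)) : seq (edge D2) :=
  flatten [seq wedges (homE phi e : walk D2) | e <- s].

Lemma chain_cat (D : digraph) (v : vert D) s1 s2 : chain v s1 ->
  chain (last v [seq tgt e | e <- s1]) s2 -> chain v (s1 ++ s2).
Proof. by elim: s1 v => [|e s1 IH] v //= [-> c1] c2; split=> //; apply: IH. Qed.

Lemma ext_edges_chain v s : chain v s ->
  @chain D2 (homV phi v) (ext_edges s) /\
  last (homV phi v : vert D2) [seq tgt e | e <- ext_edges s] =
  homV phi (last v [seq tgt e | e <- s]).
Proof.
elim: s v => [|e s IH] v //= [<- /IH[c l]].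
have [c1 l1] := wedges_chain (homE phi e : walk D2).
have /= es := hom_src phi e; have /= et := hom_tgt phi e.
rewrite es et in c1 l1.
by rewrite /ext_edges /= map_cat last_cat l1; split=> //; apply: chain_cat; rewrite ?l1.
Qed.

(** The composite in [Walks D2] of the images of the edges of [p]. *)
Definition ext_walk (p : walk D1) : walk D2 :=
  mkwalk (ext_edges_chain (wedges_chain p).1).1.

Lemma ext_walk_src p : wsrc (ext_walk p) = homV phi (wsrc p).
Proof. by rewrite wsrc_mkwalk. Qed.

Lemma ext_walk_tgt p : wtgt (ext_walk p) = homV phi (wtgt p).
Proof.
rewrite wtgt_mkwalk -(wedges_chain p).2.
exact: (ext_edges_chain (wedges_chain p).1).2.
Qed.

Definition extend : hom (Walks D1) (Walks D2) :=
  @Hom (Walks D1) (Walks D2) (homV phi) ext_walk ext_walk_src ext_walk_tgt.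
End Extend.

(** * Generalised bi-infinite walks and routes *)

Definition gwalk (D : digraph) := hom (Zint `]-oo, +oo[) (Walks D).

(** The finite walk (z, z + 1)w_E. *)
Definition gstep (D : digraph) (w : gwalk D) (z : int) : walk D :=
  homE w (line_edge z).

Definition gdegenerate (D : digraph) (w : gwalk D) : Prop :=
  (exists N : int, forall z, N <= z -> wlen (gstep w z) = 0%N) \/
  (exists N : int, forall z, z <= N -> wlen (gstep w z) = 0%N).

Definition flattening (D : digraph) (w : gwalk D)
    (w0 : hom (Zint `]-oo, +oo[) D) : Prop :=
  exists f : int -> int, forall z : int,
    f (z + 1) = f z + (wlen (gstep w z))%:Z /\
    forall j : 'I_(wlen (gstep w z)),
      homE w0 (line_edge (f z + j%:Z)) = wedge j.

Definition ndgwalk (D : digraph) := {w : gwalk D | ~ gdegenerate w}.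

Definition gequiv (D : digraph) (w w' : ndgwalk D) : Prop :=
  flattening (sval w) = flattening (sval w').

Definition Route (D : digraph) :=
  {R : set (ndgwalk D) | exists w, R = [set w' | gequiv w w']}.

Definition route (D : digraph) (w : ndgwalk D) : Route D :=
  exist _ [set w' | gequiv w w'] (ex_intro _ w erefl).

Definition route_repr (D : digraph) (R : Route D) : ndgwalk D :=
  sval (cid (svalP R)).

Lemma route_reprK (D : digraph) : cancel (@route_repr D) (@route D).
Proof.
case=> R RP; rewrite /route_repr /=; case: cid => w /= ew.
by subst R; rewrite /route; congr exist; apply: Prop_irrelevance.
Qed.

Lemma eq_route (D : digraph) (w w' : ndgwalk D) : gequiv w w' <-> route w = route w'.
Proof.
split=> [e|[/(congr1 (@^~ w'))]]; last by rewrite /= => ->.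
rewrite /route; apply/eq_exist; rewrite /=.
by apply/seteqP; split=> u; rewrite /gequiv /= e.
Qed.

(** * The map phi_* on routes *)

Section Pushforward.
Variables (D1 D2 : digraph) (phi : hom D1 (Walks D2)).

Definition gcomp (p : gwalk D1) : gwalk D2 := hom_comp (extend phi) p.

Definition hdegenerate : Prop :=
  exists p : gwalk D1, ~ gdegenerate p /\ gdegenerate (gcomp p).

Hypothesis nd_phi : ~ hdegenerate.

Definition ndgcomp (p : ndgwalk D1) : ndgwalk D2 :=
  exist (fun w => ~ gdegenerate w) (gcomp (sval p))
    (fun dg => nd_phi (ex_intro _ (sval p) (conj (svalP p) dg))).

(** [phi_*], computed on a representative; [pushE] below shows that the
    choice is immaterial. *)
Definition push (R : Route D1) : Route D2 := route (ndgcomp (route_repr R)).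
End Pushforward.

Lemma int_telescope (L : int -> nat) :
  exists f : int -> int, forall z, f (z + 1) = f z + (L z)%:Z.
Proof.
exists (fun z => match z with
  | Posz n => (\sum_(i < n) L i%:Z)%N%:Z
  | Negz n => - (\sum_(i < n.+1) L (Negz i))%N%:Z end).
case=> [n|[|n]].
- have -> : Posz n + 1 = Posz n.+1 by lia.
  by rewrite big_ord_recr.
- have -> : Negz 0 + 1 = Posz 0 by lia.
  by rewrite big_ord_recl !big_ord0 /=; lia.
have -> : Negz n.+1 + 1 = Negz n by lia.
by rewrite [in RHS]big_ord_recr /=; lia.
Qed.

Section IntWalk.
Variables (L : int -> nat) (f : int -> int).
Hypothesis fS : forall z, f (z + 1) = f z + (L z)%:Z.

Lemma telescope_le a b : a <= b -> f a <= f b.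
Proof.
move=> ab; have -> : b = a + `|b - a|%N%:Z by lia.
elim: `|b - a|%N => [|n IH]; first by have -> : a + 0%:Z = a by lia.
have -> : a + n.+1%:Z = (a + n%:Z) + 1 by lia.
by rewrite fS; lia.
Qed.

Lemma telescope_lt a b : f a < f b -> a < b.
Proof. by move=> ab; rewrite ltNge; apply/negP => /telescope_le; lia. Qed.

Hypothesis hiL : forall N, exists2 z, N <= z & L z <> 0%N.
Hypothesis loL : forall N, exists2 z, z <= N & L z <> 0%N.

Lemma telescope_split k : exists z (j : nat), (j < L z)%N /\ k = f z + j%:Z.
Proof.
have hi n : exists b, f 0 + n%:Z <= f b.
  elim: n => [|n [b Hb]]; first by exists 0; lia.
  have [z bz Lz] := hiL b; exists (z + 1).
  by have := telescope_le bz; rewrite fS; lia.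
have lo n : exists b, f b <= f 0 - n%:Z.
  elim: n => [|n [b Hb]]; first by exists 0; lia.
  have [z bz Lz] := loL (b - 1); exists z.
  have : z + 1 <= b by lia.
  by move/telescope_le; rewrite fS; lia.
have [b Hb] := hi `|k - f 0|.+1; have [a Ha] := lo `|k - f 0|%N.
have fa : f a <= k by lia.
have fb : k < f b by lia.
have ab : a < b by apply: telescope_lt; lia.
have : k < f (a + `|b - a|%N%:Z) by have -> : a + `|b - a|%N%:Z = b by lia.
elim: `|b - a|%N => [|n IH].
  by rewrite (_ : a + 0%:Z = a); lia.
case: (ltP k (f (a + n%:Z))) => [/IH //|le1].
have -> : a + n.+1%:Z = (a + n%:Z) + 1 by lia.
rewrite fS => lt2; exists (a + n%:Z), `|k - f (a + n%:Z)|%N; lia.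
Qed.

Lemma telescope_uniq z z' (j j' : nat) : (j < L z)%N -> (j' < L z')%N ->
  f z + j%:Z = f z' + j'%:Z -> z = z' /\ j = j'.
Proof.
move=> jL jL' e; suff ezz : z = z' by subst z'; split=> //; lia.
case: (ltgtP z z') => // lt.
  have : z + 1 <= z' by lia.
  by move/telescope_le; rewrite fS; lia.
have : z' + 1 <= z by lia.
by move/telescope_le; rewrite fS; lia.
Qed.
End IntWalk.

Section Reads.
Variable E : Type.

Definition reads (y : int -> E) (a : int) (s : seq E) : Prop :=
  s = mkseq (fun j => y (a + j%:Z)) (size s).

Definition flattens (ws : int -> seq E) (y : int -> E) : Prop :=
  exists f : int -> int,
    forall z, f (z + 1) = f z + (size (ws z))%:Z /\ reads y (f z) (ws z).

Lemma reads_cat y a s1 s2 :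
  reads y a (s1 ++ s2) <-> reads y a s1 /\ reads y (a + (size s1)%:Z) s2.
Proof.
have e : mkseq (fun j => y (a + j%:Z)) (size s1 + size s2) =
    mkseq (fun j => y (a + j%:Z)) (size s1) ++
    mkseq (fun j => y (a + (size s1)%:Z + j%:Z)) (size s2).
  rewrite /mkseq iotaD map_cat add0n -[in X in _ ++ X](addn0 (size s1)) iotaDl.
  rewrite -map_comp; congr (_ ++ _); apply: eq_map => j /=; congr y; lia.
rewrite /reads size_cat e; split; last by case=> <- <-.
move=> eqs; split.
  move: (congr1 (take (size s1)) eqs).
  by rewrite !take_cat ltnn subnn take0 cats0 size_mkseq ltnn subnn take0 cats0.
move: (congr1 (drop (size s1)) eqs).
by rewrite !drop_cat ltnn subnn drop0 size_mkseq ltnn subnn drop0.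
Qed.
End Reads.

Section FlattensMap.
Variables (E1 E2 : Type) (psi : E1 -> seq E2).
Variables (ws : int -> seq E1) (x : int -> E1).

Lemma flattens_map (y : int -> E2) :
    (forall N, exists2 z, N <= z & size (ws z) <> 0%N) ->
    (forall N, exists2 z, z <= N & size (ws z) <> 0%N) ->
    flattens ws x ->
  flattens (fun z => flatten (map psi (ws z))) y <-> flattens (psi \o x) y.
Proof.
move=> hi lo [f fP]; have fS z := (fP z).1; have fr z := (fP z).2.
pose blk k n := flatten [seq psi (x (k + i%:Z)) | i <- iota 0 n].
have blkS k n : blk k n.+1 = blk k n ++ psi (x (k + n%:Z)).
  by rewrite /blk -addn1 iotaD map_cat flatten_cat /= cats0 add0n.
have wsE z : flatten (map psi (ws z)) = blk (f z) (size (ws z)).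
  by rewrite {1}(fr z) /mkseq -map_comp.
have hblk h k n : (forall k, h (k + 1) = h k + (size (psi (x k)))%:Z) ->
    h (k + n%:Z) = h k + (size (blk k n))%:Z.
  move=> hS; elim: n => [|n IH].
    by rewrite (_ : k + 0%:Z = k) /=; lia.
  by rewrite blkS size_cat (_ : k + n.+1%:Z = k + n%:Z + 1) ?hS ?IH; lia.
have rblk h k n : (forall k, h (k + 1) = h k + (size (psi (x k)))%:Z) ->
    reads y (h k) (blk k n) <->
    forall j : nat, (j < n)%N -> reads y (h (k + j%:Z)) (psi (x (k + j%:Z))).
  move=> hS; elim: n => [|n IH]; first by split.
  rewrite blkS reads_cat IH -hblk //; split=> [[r1 r2] j|r].
    by rewrite ltnS leq_eqVlt => /orP[/eqP-> //|/r1].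
  by split=> [j jn|]; apply: r; rewrite // ltnS ltnW.
split=> [[g gP]|[h hP]]; last first.
  have hS k := (hP k).1.
  exists (h \o f) => z /=; rewrite fS hblk // wsE; split=> //.
  by apply/rblk => // j _; exact: (hP _).2.
have [h0 h0S] := int_telescope (fun k => size (psi (x k))).
pose h k := h0 k + (g 0 - h0 (f 0)).
have hS k : h (k + 1) = h k + (size (psi (x k)))%:Z by rewrite /h h0S; lia.
have gS z : g (z + 1) - h (f (z + 1)) = g z - h (f z).
  by rewrite (gP z).1 fS hblk // wsE; lia.
have gE z : g z = h (f z).
  suff : g z - h (f z) = g 0 - h (f 0) by rewrite /h; lia.
  case: z => n.
    elim: n => // n IH; rewrite (_ : Posz n.+1 = Posz n + 1) ?gS //; lia.
  elim: n => [|n IH]; first by rewrite -gS.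
  by rewrite -IH (_ : Negz n = Negz n.+1 + 1) ?gS //; lia.
exists h => k; split=> //.
have [z [j [jL ->]]] := telescope_split fS hi lo k.
have := (gP z).2; rewrite wsE gE => /(rblk h _ _ hS).
exact.
Qed.

End FlattensMap.

Section Flattening.
Variable D : digraph.

Lemma readsP (p : walk D) (y : int -> edge D) a :
  reads y a (wedges p) <-> forall j : 'I_(wlen p), y (a + j%:Z) = wedge j.
Proof.
rewrite /reads size_wedges; split=> [e j|e].
  have /(congr1 (fun s => nth (wedge j) s j)) := e.
  rewrite nth_mkseq // => <-; rewrite /wedges (nth_map j) ?size_enum_ord //.
  by rewrite nth_ord_enum.
rewrite /mkseq -val_enum_ord -map_comp; apply: eq_map => j /=.
by rewrite e.
Qed.

Lemma flatteningE (w : gwalk D) w0 : flattening w w0 <->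
  flattens (fun z => wedges (gstep w z)) (fun k => homE w0 (line_edge k)).
Proof.
pose y k := homE w0 (line_edge k).
split=> -[f fP]; exists f => z; have [fS fr] := fP z; split.
- by rewrite fS size_wedges.
- exact: (readsP _ y _).2 fr.
- by rewrite fS size_wedges.
- exact: (readsP _ y _).1 fr.
Qed.

Lemma ndeg_hi (w : gwalk D) : ~ gdegenerate w ->
  forall N, exists2 z, N <= z & wlen (gstep w z) <> 0%N.
Proof.
move=> nd N; apply: contrapT => h; apply: nd; left; exists N => z Nz.
by apply: contrapT => l; apply: h; exists z.
Qed.

Lemma ndeg_lo (w : gwalk D) : ~ gdegenerate w ->
  forall N, exists2 z, z <= N & wlen (gstep w z) <> 0%N.
Proof.
move=> nd N; apply: contrapT => h; apply: nd; right; exists N => z Nz.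
by apply: contrapT => l; apply: h; exists z.
Qed.

Lemma wedge_src (p : walk D) (j : 'I_(wlen p)) :
  src (wedge j) = homV (projT2 p) (seg_vert (widen_ord (leqnSn _) j)).
Proof. by rewrite /wedge hom_src; congr homV; apply/val_inj. Qed.

Lemma wedge_tgt (p : walk D) (j : 'I_(wlen p)) :
  tgt (wedge j) = homV (projT2 p) (seg_vert (lift ord0 j)).
Proof.
rewrite /wedge hom_tgt; congr homV; apply/val_inj.
by rewrite /= /bump /= add1n -addn1.
Qed.

Lemma gstep_src (w : gwalk D) z : wsrc (gstep w z) = homV w (line_vert z).
Proof.
apply: etrans (hom_src w (line_edge z)) (congr1 (homV w) _); exact/val_inj.
Qed.

Lemma gstep_tgt (w : gwalk D) z : wtgt (gstep w z) = homV w (line_vert (z + 1)).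
Proof.
apply: etrans (hom_tgt w (line_edge z)) (congr1 (homV w) _); exact/val_inj.
Qed.

Lemma wlen0 (p : walk D) : wlen p = 0%N -> wsrc p = wtgt p.
Proof.
by move=> p0; rewrite /wsrc /wtgt; congr homV; apply/val_inj; rewrite /= -/(wlen p) p0.
Qed.

Lemma flattening_exists (w : gwalk D) : ~ gdegenerate w -> exists w0, flattening w w0.
Proof.
move=> nd; pose L z := wlen (gstep w z).
have [f fS] := int_telescope L.
have split := telescope_split fS (ndeg_hi nd) (ndeg_lo nd).
have uniq := telescope_uniq fS.
have : forall k, exists e : edge D, forall z (j : 'I_(L z)),
    k = f z + j%:Z -> e = wedge j.
  move=> k; have [z [j [jL ->]]] := split k.
  exists (wedge (Ordinal jL : 'I_(wlen (gstep w z)))) => z' j' e.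
  have [ez ej] := uniq _ _ _ _ jL (ltn_ord j') e; subst z'.
  by congr wedge; apply/val_inj.
move/choice => [x xP].
have srcx (n : nat) : forall z, f (z + n%:Z) = f z -> (0 < L (z + n%:Z)%R)%N ->
    src (x (f z)) = homV w (line_vert z).
  elim: n => [|n IH] z.
    rewrite (_ : z + 0%:Z = z); last by lia.
    move=> _ Lz; rewrite (xP _ z (Ordinal Lz)); last by rewrite /=; lia.
    by rewrite wedge_src -gstep_src; congr homV; apply/val_inj.
  rewrite (_ : z + n.+1%:Z = z + 1 + n%:Z); last by lia.
  move=> e Lz.
  have le1 : f (z + 1) <= f (z + 1 + n%:Z) by apply: (telescope_le fS); lia.
  have Lz0 : L z = 0%N by move: le1; rewrite e fS; lia.
  have e1 : f (z + 1) = f z by rewrite fS Lz0; lia.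
  rewrite -e1 IH // ?e ?e1 //.
  by rewrite -gstep_tgt -wlen0 // gstep_src.
have xtgt k : tgt (x k) = src (x (k + 1)).
  have [z [j [jL ek]]] := split k.
  rewrite (xP _ z (Ordinal jL)) // wedge_tgt.
  case: (ltnP j.+1 (L z)) => [j1|j1].
    rewrite (xP _ z (Ordinal j1)); last by rewrite ek /=; lia.
    by rewrite wedge_src; congr homV; apply/val_inj.
  have jE : j.+1 = L z by apply/eqP; rewrite eqn_leq jL j1.
  have k1 : k + 1 = f (z + 1) by rewrite fS ek -jE; lia.
  have [z' [j' [jL' ek']]] := split (k + 1).
  have zz' : z + 1 <= z'.
    case: (leP (z + 1) z') => // lt.
    have : z' + 1 <= z + 1 by lia.
    by move/(telescope_le fS); rewrite -k1 ek' fS; lia.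
  have ge := telescope_le fS zz'.
  have ez : z' = z + 1 + (absz (z' - (z + 1))%R)%:Z by lia.
  rewrite k1 (srcx (absz (z' - (z + 1))%R)) -?ez; [|lia|lia].
  rewrite -gstep_tgt /wtgt; congr homV; apply/val_inj => /=.
  by rewrite /bump /= add1n jE.
exists (@Hom (Zint `]-oo, +oo[) D (fun k => src (x (sval k)))
  (fun k => x (sval k)) (fun=> erefl) (fun k => xtgt (sval k))).
by exists f => z; split=> // j /=; apply: xP.
Qed.
End Flattening.

Section PushE.
Variables (D1 D2 : digraph) (phi : hom D1 (Walks D2)).

Lemma flattening_gcomp (w : gwalk D1) w0 y : ~ gdegenerate w ->
  flattening w w0 -> flattening (gcomp phi w) y <->
  flattens (fun k => wedges (homE phi (homE w0 (line_edge k)) : walk D2))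
           (fun k => homE y (line_edge k)).
Proof.
move=> nd /flatteningE fw; rewrite flatteningE.
have hi := ndeg_hi nd; have lo := ndeg_lo nd.
rewrite -(flattens_map (fun e => wedges (homE phi e : walk D2)) _ _ _ fw).
- have -> : (fun z => wedges (gstep (gcomp phi w) z)) =
    (fun z => flatten [seq wedges (homE phi e : walk D2) | e <- wedges (gstep w z)]).
    by apply/funext => z; exact: wedges_mkwalk.
  by [].
- by move=> N; have [z ? ?] := hi N; exists z; rewrite ?size_wedges.
- by move=> N; have [z ? ?] := lo N; exists z; rewrite ?size_wedges.
Qed.

Variable nd_phi : ~ hdegenerate phi.

Lemma gequiv_ndgcomp (p q : ndgwalk D1) :
  gequiv p q -> gequiv (ndgcomp nd_phi p) (ndgcomp nd_phi q).
Proof.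
move=> pq; have [w0 fp] := flattening_exists (svalP p).
have fq : flattening (sval q) w0 by rewrite -pq.
apply/funext => y; apply/propext.
by rewrite (flattening_gcomp y (svalP p) fp) (flattening_gcomp y (svalP q) fq).
Qed.

Lemma pushE (p : ndgwalk D1) :
  push nd_phi (route p) = route (ndgcomp nd_phi p).
Proof.
apply/eq_route/gequiv_ndgcomp/eq_route; exact: route_reprK.
Qed.
End PushE.

(** * UDAF digraphs and foldings *)

Definition is_udaf (D : finDigraph) : Prop := forall v : vert D,
  ~ (exists! h : hom (Zint `[0, +oo[) D, homV h (exist _ 0 isT) = v) /\
  ~ (exists! h : hom (Zint `]-oo, 0]) D, homV h (exist _ 0 isT) = v).

Record UDAF := MkUDAF {
  udaf_digraph :> finDigraph;
  udafP : is_udaf udaf_digraph }.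

Record folding (D1 D2 : finDigraph) := Folding {
  fold_hom :> hom D1 (Walks D2);
  fold_nd : ~ hdegenerate fold_hom;
  fold_bij : bijective (push fold_nd) }.

Arguments fold_nd {D1 D2} f _.

Definition star (D1 D2 : finDigraph) (f : folding D1 D2) : Route D1 -> Route D2 :=
  push (fold_nd f).

(** * Elementary foldings *)

Section Elementary.
Variables (D1 D2 : finDigraph) (f : folding D1 D2).

Definition add_isolated_vertex : Prop :=
  exists (g : hom D1 D2) (v : vert D2),
    [/\ fold_hom f = hom_comp (incl D2) g,
        injective (homV g) /\ injective (homE g),
        range (homV g) = [set u | u <> v],
        range (homE g) = setT &
        forall e : edge D2, src e <> v /\ tgt e <> v].

(** The walks of length 2 in [D2] whose first ([i = 0]), respectively second
    ([i = 1]), edge is [e]. *)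
Definition walks2 (i : 'I_2) (e : edge D2) : set (walk D2) :=
  [set existT _ 2%N h | h in
    [set h : hom (Zint `[0, 2%N%:Z]) D2 | homE h (seg_edge i) = e]].

(** [S] is given by its edge set [ES], all vertices of [D1] being kept; the
    restriction of [f] to it is an isomorphism onto [D2] minus the edge [e],
    seen inside [Walks D2], when it is bijective on vertices and on edges. *)
Definition split_edge (i : 'I_2) : Prop :=
  exists (e : edge D2) (ES : set (edge D1)),
    [/\ src e <> tgt e,
        bijective (homV f : vert D1 -> vert D2),
        set_bij ES [set walk1 e' | e' in [set e' : edge D2 | e' <> e]] (homE f) &
        set_bij (~` ES) (walks2 i e) (homE f)].

Definition elementary : Prop :=
  [\/ add_isolated_vertex, split_edge ord0 | split_edge ord_max].
End Elementary.

(** * The categories UDAFG and UDAFG'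

    The object (Route(D), D) is represented by [D]. *)

Inductive UDAFG : forall A B : UDAF, (Route A -> Route B) -> Prop :=
| UDAFG_id (A : UDAF) : @UDAFG A A id
| UDAFG_star (A B : UDAF) (f : folding A B) : @UDAFG A B (star f)
| UDAFG_comp (A B C : UDAF) (F : Route A -> Route B) (G : Route B -> Route C) :
    @UDAFG A B F -> @UDAFG B C G -> @UDAFG A C (G \o F)
| UDAFG_inv (A B : UDAF) (F : Route A -> Route B) (G : Route B -> Route A) :
    @UDAFG A B F -> cancel F G -> cancel G F -> @UDAFG B A G.

Inductive UDAFG' : forall A B : UDAF, (Route A -> Route B) -> Prop :=
| UDAFG'_id (A : UDAF) : @UDAFG' A A id
| UDAFG'_star (A B : UDAF) (f : folding A B) :
    elementary f -> @UDAFG' A B (star f)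
| UDAFG'_star_inv (A B : UDAF) (f : folding A B) (G : Route B -> Route A) :
    elementary f -> cancel (star f) G -> cancel G (star f) -> @UDAFG' B A G
| UDAFG'_comp (A B C : UDAF) (F : Route A -> Route B) (G : Route B -> Route C) :
    @UDAFG' A B F -> @UDAFG' B C G -> @UDAFG' A C (G \o F).

Definition is_iso (mor : forall A B : UDAF, (Route A -> Route B) -> Prop)
    (A B : UDAF) (F : Route A -> Route B) : Prop :=
  mor A B F /\
  exists G : Route B -> Route A, [/\ mor B A G, cancel F G & cancel G F].

Definition transducerable (A B : UDAF) (F : Route A -> Route B) : Prop :=
  exists (T : UDAF) (g : folding T A) (h : folding T B) (g' : Route A -> Route T),
    [/\ cancel (star g) g', cancel g' (star g) & star h \o g' = F].

(* Main.v *)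
From mathcomp Require Import all_boot all_order ssralg ssrnum ssrint intdiv interval.
From mathcomp Require Import boolp classical_sets functions.
From mathcomp Require Import zify.
Require Import Defs.

Set Implicit Arguments.
Unset Strict Implicit.
Unset Printing Implicit Defensive.

Import Order.TTheory GRing.Theory Num.Theory.
Local Open Scope ring_scope.

(** A route is a bi-infinite line of composable edges up to shift
    ([line_route_eq]), and the map of a folding sends the class of a line to the
    class of any line that reads its image words ([star_line_route]). In these
    terms a digraph is UDAF exactly when every line agrees from some point on, in
    either direction, with a different line ([is_udafP]).

    The core of the theorem is that the map of every folding is a product of
    elementary ones and their inverses ([folding_generated]); this makes the two
    categories equal. The basic elementary folding cuts a non-loop edge [e] and
    replaces it by its prolongations [e x] ([cut]); reversing all edges gives its
    mirror image ([generated_op]). Cutting dead edges and adding isolated vertices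
    handles every embedding whose image contains all lines
    ([embedding_generated_all]). Cutting a whole set of edges, no two of which
    follow each other, then handles every folding whose words have one or two
    letters and use that set for the first letters of the long ones
    ([elimination_folding]). In particular a digraph and its out-splitting both
    arise in this way from one bipartite digraph ([out_split_generated]).

    Given an arbitrary folding, edges with an empty word are cut and edges with a
    long word are subdivided until it becomes a homomorphism of digraphs. This
    homomorphism is injective on lines and not only on routes ([line_injective]).
    The danger is a periodic line whose image has a smaller period. UDAF provides
    lines leaving and entering that periodic line, and joining their images after
    a number of turns that the longer period forbids gives a line without
    preimage. By the pigeonhole principle a bounded window of the image of a line
    then determines its vertex at the origin ([window_exists]). Out-splitting
    source and target together shortens the window on one side ([window_step]),
    reversal gives the other side, and with an empty window the homomorphism is an
    embedding of the essential part ([window00]). This is the argument of Williams'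
    decomposition theorem for conjugacies of shifts of finite type.

    For transducers, the maps with a transducer have to be closed under composing
    with an elementary folding, which is clear, and with the inverse of one. For
    the latter the transducer is pulled back along the elementary folding: its
    vertices additionally remember whether the cut edge has been read and still
    waits for its second half ([pending], [elementary_pulls_back]). *)

(** * Reading words along a sequence *)

Section Aligned.
Variable E : Type.
Implicit Types (ws : int -> seq E) (x y : int -> E) (f g : int -> int).

Definition aligned ws y f : Prop := forall z : int,
  f (z + 1) = f z + (size (ws z))%:Z /\ reads y (f z) (ws z).

(** Nondegeneracy of a generalised walk, for the sequence of its edge words. *)
Definition recurrent ws : Prop :=
  (forall N : int, exists2 z, N <= z & size (ws z) <> 0%N) /\
  (forall N : int, exists2 z, z <= N & size (ws z) <> 0%N).

Lemma reads_nth y a s : reads y a s <->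
  forall e0 j, (j < size s)%N -> y (a + j%:Z) = nth e0 s j.
Proof.
split=> [e e0 j js|h]; first by rewrite e nth_mkseq.
rewrite /reads; case: s h => // e0 s h.
apply: (@eq_from_nth _ e0); rewrite ?size_mkseq // => j js.
by rewrite nth_mkseq // (h e0).
Qed.

Lemma reads_cons y a e s : reads y a (e :: s) <-> y a = e /\ reads y (a + 1) s.
Proof.
rewrite -cat1s reads_cat {1}/reads /= /mkseq /= addr0.
by split=> [[[->] r]|[-> r]].
Qed.

Lemma reads1 y a e : reads y a [:: e] <-> y a = e.
Proof. by rewrite reads_cons; split=> [[]//|]; split. Qed.

Lemma reads2 y a e e' : reads y a [:: e; e'] <-> y a = e /\ y (a + 1) = e'.
Proof. by rewrite reads_cons reads1. Qed.

Lemma reads_eq y y' a a' s : (forall j, (j < size s)%N -> y (a + j%:Z) = y' (a' + j%:Z)) ->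
  reads y a s -> reads y' a' s.
Proof.
by move=> e /reads_nth r; apply/reads_nth => e0 j js; rewrite -e // -r.
Qed.

Lemma telescope_const (L : int -> nat) f g :
    (forall z, f (z + 1) = f z + (L z)%:Z) ->
    (forall z, g (z + 1) = g z + (L z)%:Z) ->
  forall z z', f z - g z = f z' - g z'.
Proof.
move=> fS gS.
have S z : f (z + 1) - g (z + 1) = f z - g z by rewrite fS gS; lia.
suff h z : f z - g z = f 0 - g 0 by move=> z z'; rewrite h (h z').
case: z => n.
  by elim: n => // n <-; rewrite (_ : Posz n.+1 = Posz n + 1) ?S //; lia.
elim: n => [|n <-]; first by rewrite -S.
by rewrite -(S (Negz n.+1)) (_ : Negz n.+1 + 1 = Negz n) //; lia.
Qed.

Lemma aligned_split ws y f : recurrent ws -> aligned ws y f ->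
  forall k, exists z (j : nat), (j < size (ws z))%N /\ k = f z + j%:Z.
Proof.
move=> [hi lo] al; exact: (telescope_split (fun z => (al z).1) hi lo).
Qed.

(** Recurrent words fill the whole sequence that reads them, so this sequence is
    determined by the position of a single word. *)
Lemma aligned_uniq ws x y f g : recurrent ws ->
  aligned ws x f -> aligned ws y g -> forall z k, y k = x (k + (f z - g z)).
Proof.
move=> rw ax ay z k.
have [z' [j [js ->]]] := aligned_split rw ay k.
have := telescope_const (fun z => (ax z).1) (fun z => (ay z).1) z z' => e.
have := reads_nth y (g z') (ws z'); case: (ws z') (ax z').2 (ay z').2 js => // e0 s rx ry js _.
move/reads_nth/(_ e0 j js): rx => rx; move/reads_nth/(_ e0 j js): ry => ->.
by rewrite e -rx; congr x; lia.
Qed.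

Lemma aligned_shift ws y f t : aligned ws y f ->
  aligned ws (fun k => y (k - t)) (fun z => f z + t).
Proof.
move=> al z; have [fS r] := al z; split; first by rewrite fS; lia.
by apply: reads_eq r => j _; congr y; lia.
Qed.

Lemma aligned_at ws y f z a : aligned ws y f ->
  exists y' f', aligned ws y' f' /\ f' z = a.
Proof.
move=> al; exists (fun k => y (k - (a - f z))), (fun z' => f z' + (a - f z)).
by split; [exact: aligned_shift|lia].
Qed.
End Aligned.

Section AlignedComp.
Variables (E1 E2 : Type) (psi : E1 -> seq E2).

Lemma aligned_comp ws x f y h : aligned ws x f -> aligned (psi \o x) y h ->
  aligned (fun z => flatten (map psi (ws z))) y (h \o f).
Proof.
move=> ax ay z /=; rewrite (ax z).1.
have := (ax z).2; move: (ws z) (f z) => s a.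
elim: s a => [|e s IH] a; first by move=> _; split=> /=; rewrite ?addr0.
move=> /reads_cons[<- /IH[hS rs]] /=; have /= [h1 r1] := ay a.
rewrite size_cat reads_cat -h1; split=> //.
rewrite (_ : a + (size s).+1%:Z = a + 1 + (size s)%:Z) ?hS; last lia.
by rewrite h1 /=; lia.
Qed.

(** The positions [h] exist by [flattens_map] up to a constant. The constant is a
    period of [y] because [y] reads the same words twice, so it can be removed. *)
Lemma aligned_comp_inv ws x f y g : recurrent ws ->
    recurrent (fun z => flatten (map psi (ws z))) -> aligned ws x f ->
    aligned (fun z => flatten (map psi (ws z))) y g ->
  exists h, aligned (psi \o x) y h /\ forall z, g z = h (f z).
Proof.
move=> rw rf ax ag.
have /(flattens_map psi y rw.1 rw.2 (ex_intro _ f ax))[h ah] :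
  flattens (fun z => flatten (map psi (ws z))) y by exists g.
have ahf := aligned_comp ax ah.
pose c := g 0 - h (f 0).
have yc k : y k = y (k + c) by rewrite -(aligned_uniq rf ag ahf 0).
exists (fun z => h z + c); split=> z.
  have [hS r] := ah z; split; first by rewrite hS; lia.
  by apply: reads_eq r => j _; rewrite yc; congr y; lia.
by have /= := telescope_const (fun z => (ag z).1) (fun z => (ahf z).1) z 0; rewrite /c; lia.
Qed.
End AlignedComp.

Lemma recurrent_comp (E1 E2 : Type) (psi : E1 -> seq E2) ws (x : int -> E1) f :
  recurrent ws -> recurrent (psi \o x) -> aligned ws x f ->
  recurrent (fun z => flatten (map psi (ws z))).
Proof.
move=> rw rp ax.
have key z0 j : (j < size (ws z0))%N -> size (psi (x (f z0 + j%:Z))) <> 0%N ->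
    size (flatten (map psi (ws z0))) <> 0%N.
  case: (ws z0) (ax z0).2 => // e0 s /reads_nth/(_ e0 j) r js; rewrite r //.
  elim: (e0 :: s) j {r} js => // e s' IH [|j] /= js h1; rewrite size_cat; first lia.
  by have := IH j js h1; lia.
split=> N.
  have [k kN pk] := rp.1 (f N); have [z [j [js ek]]] := aligned_split rw ax k.
  exists z; last by apply: (key z j) => //; rewrite -ek.
  have : f N < f (z + 1) by rewrite (ax z).1; lia.
  by move/(telescope_lt (fun z => (ax z).1)); lia.
have [k kN pk] := rp.2 (f N - 1); have [z [j [js ek]]] := aligned_split rw ax k.
exists z; last by apply: (key z j) => //; rewrite -ek.
have : f z < f N by lia.
by move/(telescope_lt (fun z => (ax z).1)); lia.
Qed.

(** * Lines and routes *)

Section Lines.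
Variable D : digraph.

Record line := Line {
  lfun :> int -> edge D;
  lineP : forall k, tgt (lfun k) = src (lfun (k + 1)) }.

Lemma line_ext (x y : line) : (forall k, x k = y k) -> x = y.
Proof.
case: x y => [x xP] [y yP] /= /funext e; subst y; congr Line; exact: Prop_irrelevance.
Qed.

Definition line_hom (x : line) : hom (Zint `]-oo, +oo[) D :=
  @Hom (Zint `]-oo, +oo[) D (fun v => src (x (sval v))) (fun e => x (sval e))
    (fun=> erefl) (fun e => lineP x (sval e)).

Lemma hom_line_subproof (w : hom (Zint `]-oo, +oo[) D) k :
  tgt (homE w (line_edge k)) = src (homE w (line_edge (k + 1))).
Proof. by rewrite hom_src hom_tgt; congr homV; apply/val_inj. Qed.

Definition hom_line w : line := Line (hom_line_subproof w).

(** Lines are built below from a word of edges at each integer, possibly empty, so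
    that no reindexing of the integers is needed. *)
Section Gline.
Variables (vs : int -> vert D) (ws : int -> seq (edge D)).
Hypothesis wsP : forall k, chain (vs k) (ws k) /\
  last (vs k) [seq tgt e | e <- ws k] = vs (k + 1).

Lemma gline_src (k : edge (Zint `]-oo, +oo[)) :
  src (mkwalk (wsP (sval k)).1 : edge (Walks D)) = vs (sval (src k)).
Proof. by rewrite /= wsrc_mkwalk. Qed.

Lemma gline_tgt (k : edge (Zint `]-oo, +oo[)) :
  tgt (mkwalk (wsP (sval k)).1 : edge (Walks D)) = vs (sval (tgt k)).
Proof. by rewrite /= wtgt_mkwalk (wsP _).2. Qed.

Definition gline : gwalk D :=
  @Hom (Zint `]-oo, +oo[) (Walks D) (fun v => vs (sval v))
    (fun e => mkwalk (wsP (sval e)).1) gline_src gline_tgt.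

Lemma gline_wedges k : wedges (gstep gline k) = ws k.
Proof. by rewrite /gstep /= wedges_mkwalk. Qed.

Lemma gline_nd : recurrent ws -> ~ gdegenerate gline.
Proof.
move=> [hi lo] [[N h]|[N h]].
  have [z /h + sz] := hi N; by rewrite -size_wedges gline_wedges.
have [z /h + sz] := lo N; by rewrite -size_wedges gline_wedges.
Qed.

Lemma gline_flat : recurrent ws -> forall z a,
  exists (x : line) f, aligned ws x f /\ f z = a.
Proof.
move=> rw z a.
have [w0 /flatteningE[f al]] := flattening_exists (gline_nd rw).
have {al}al : aligned ws (hom_line w0) f.
  by move=> k; have := al k; rewrite gline_wedges.
have [y' [f' [al' e]]] := aligned_at z a al.
have yE := aligned_uniq rw al al' 0.
have yP k : tgt (y' k) = src (y' (k + 1)).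
  by rewrite !yE lineP; congr (src (lfun _ _)); lia.
by exists (Line yP), f'.
Qed.
End Gline.

Lemma recurrent_nd (w : gwalk D) : ~ gdegenerate w <-> recurrent (fun z => wedges (gstep w z)).
Proof.
split=> [nd|[hi lo] [[N h]|[N h]]].
- split=> N.
    by have [z ? ?] := ndeg_hi nd N; exists z; rewrite ?size_wedges.
  by have [z ? ?] := ndeg_lo nd N; exists z; rewrite ?size_wedges.
- by have [z /h + sz] := hi N; rewrite -size_wedges.
- by have [z /h + sz] := lo N; rewrite -size_wedges.
Qed.

Lemma recurrent_pos E (ws : int -> seq E) : (forall k, ws k <> [::]) -> recurrent ws.
Proof. by move=> h; split=> N; exists N => // /size0nil/h. Qed.

Definition line_gwalk (x : line) : gwalk D := hom_comp (incl D) (line_hom x).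

Lemma line_gstep x k : wedges (gstep (line_gwalk x) k) = [:: x k].
Proof. by rewrite /gstep /= wedges_mkwalk. Qed.

Lemma line_gwalk_nd x : ~ gdegenerate (line_gwalk x).
Proof. by apply/recurrent_nd/recurrent_pos => k; rewrite line_gstep. Qed.

Definition line_ndgwalk (x : line) : ndgwalk D :=
  exist (fun w => ~ gdegenerate w) _ (@line_gwalk_nd x).

Definition line_route (x : line) : Route D := route (line_ndgwalk x).

Lemma flatten_self x : aligned (fun z => wedges (gstep (line_gwalk x) z)) x id.
Proof. by move=> z; rewrite line_gstep; split=> //; apply/reads1. Qed.

Lemma route_line (w : ndgwalk D) (x : line) :
  flattens (fun z => wedges (gstep (sval w) z)) x -> route w = line_route x.
Proof.
case=> f al; apply/eq_route/funext => w0; apply/propext.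
have rw := (recurrent_nd (sval w)).1 (svalP w).
rewrite !flatteningE; split=> [[g ag]|[g ag]] /=.
  exists (fun z => z - (f 0 - g 0)) => z; rewrite line_gstep /=; split; first lia.
  by apply/reads1; rewrite (aligned_uniq rw al ag 0); congr (lfun x _); lia.
have := aligned_shift (g 0) al => al'.
exists (fun z => f z + g 0) => z; have [S r] := al' z; split=> //.
apply: reads_eq r => j _ /=.
have ru := (recurrent_nd _).1 (@line_gwalk_nd x).
by rewrite (aligned_uniq ru (flatten_self x) ag 0) /=; congr (lfun x _); lia.
Qed.

Lemma line_route_eq (x y : line) :
  line_route x = line_route y <-> exists t, forall k, y k = x (k + t).
Proof.
have rx := (recurrent_nd _).1 (@line_gwalk_nd x).
split=> [/eq_route e|[t e]].
  have : flattening (line_gwalk y) (line_hom y) by apply/flatteningE; exists id; exact: flatten_self.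
  rewrite -[flattening _]e => /flatteningE[g ag].
  by exists (0 - g 0) => k; exact: (aligned_uniq rx (flatten_self x) ag 0).
apply/esym/esym/route_line; exists (fun z => z - t) => z; rewrite line_gstep; split=> /=; first lia.
by apply/reads1; rewrite e; congr (lfun x _); lia.
Qed.

Lemma line_route_surj (R : Route D) : exists x, R = line_route x.
Proof.
rewrite -[R]route_reprK; set w := route_repr R.
have [w0 /flatteningE fw] := flattening_exists (svalP w).
by exists (hom_line w0); apply: route_line.
Qed.
End Lines.

(** * Words of homomorphisms and foldings *)

Lemma inj_surj_bij (S T : Type) (f : S -> T) :
  injective f -> (forall y, exists x, f x = y) -> bijective f.
Proof.
move=> fI /choice[g gK]; exists g => // x; exact/fI/gK.
Qed.

Lemma line_route_flattens (D : digraph) ws (y y' : line D) :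
  line_route y = line_route y' -> flattens ws y -> flattens ws y'.
Proof.
move=> /line_route_eq[t e] [f al]; exists (fun z => f z - t) => z.
have [S r] := al z; split; first by rewrite S; lia.
by apply: reads_eq r => j _; rewrite e; congr (lfun y _); lia.
Qed.

Lemma flattens_line_route (D : digraph) ws (y y' : line D) : recurrent ws ->
  flattens ws y -> flattens ws y' -> line_route y = line_route y'.
Proof.
move=> rw [f al] [g ag]; apply/line_route_eq; exists (f 0 - g 0) => k.
exact: (aligned_uniq rw al ag).
Qed.

Section Words.
Variables (D1 D2 : digraph).

Definition word (phi : hom D1 (Walks D2)) (e : edge D1) : seq (edge D2) :=
  wedges (homE phi e : walk D2).

Lemma word_chain (phi : hom D1 (Walks D2)) e :
  @chain D2 (homV phi (src e)) (word phi e) /\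
  last (homV phi (src e) : vert D2) [seq tgt a | a <- word phi e] = homV phi (tgt e).
Proof.
have := wedges_chain (homE phi e : walk D2).
by have /= -> := hom_src phi e; have /= -> := hom_tgt phi e.
Qed.

Section MkHom.
Variables (v : vert D1 -> vert D2) (psi : edge D1 -> seq (edge D2)).
Hypothesis psiP : forall e, chain (v (src e)) (psi e) /\
  last (v (src e)) [seq tgt a | a <- psi e] = v (tgt e).

Lemma mkhom_src e : src (mkwalk (psiP e).1 : edge (Walks D2)) = v (src e).
Proof. by rewrite /= wsrc_mkwalk. Qed.

Lemma mkhom_tgt e : tgt (mkwalk (psiP e).1 : edge (Walks D2)) = v (tgt e).
Proof. by rewrite /= wtgt_mkwalk (psiP e).2. Qed.

Definition mkhom : hom D1 (Walks D2) :=
  @Hom D1 (Walks D2) v (fun e => mkwalk (psiP e).1) mkhom_src mkhom_tgt.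

Lemma word_mkhom e : word mkhom e = psi e.
Proof. exact: wedges_mkwalk. Qed.
End MkHom.

Variable phi : hom D1 (Walks D2).

Definition nondeg : Prop := forall x : line D1, recurrent (word phi \o x).

Lemma image_line : nondeg -> forall (x : line D1) z a,
  exists (y : line D2) h, aligned (word phi \o x) y h /\ h z = a.
Proof.
move=> nd x z a.
apply: (@gline_flat D2 (fun k => homV phi (src (x k)))) => // k.
by rewrite -lineP; exact: word_chain.
Qed.

Lemma gstep_gcomp (p : gwalk D1) z :
  wedges (gstep (gcomp phi p) z) = flatten (map (word phi) (wedges (gstep p z))).
Proof. exact: wedges_mkwalk. Qed.

Lemma nondegP : ~ hdegenerate phi <-> nondeg.
Proof.
split=> [nd x|nd [p [np dp]]].
  have /recurrent_nd : ~ gdegenerate (gcomp phi (line_gwalk x)).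
    by move=> dg; apply: nd; exists (line_gwalk x); split=> //; exact: line_gwalk_nd.
  congr recurrent; apply/funext => z.
  by rewrite gstep_gcomp line_gstep /= cats0.
have rp := (recurrent_nd p).1 np.
have [w0 /flatteningE[f al]] := flattening_exists np.
have := recurrent_comp rp (nd (hom_line w0)) al.
suff e : (fun z => wedges (gstep (gcomp phi p) z)) =
  (fun z => flatten [seq word phi i | i <- wedges (gstep p z)]).
  by rewrite -e => /recurrent_nd.
by apply/funext => z; rewrite gstep_gcomp.
Qed.

Lemma push_line_route (nd : ~ hdegenerate phi) x y :
  push nd (line_route x) = line_route y <-> flattens (word phi \o x) y.
Proof.
have nd' := (nondegP).1 nd.
have key (y' : line D2) : flattens (word phi \o x) y' -> push nd (line_route x) = line_route y'.
  move=> fl; rewrite pushE; apply: route_line.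
  suff -> : (fun z => wedges (gstep (sval (ndgcomp nd (line_ndgwalk x))) z))
    = word phi \o x by [].
  by apply/funext => z; rewrite gstep_gcomp line_gstep /= cats0.
split=> [e|/key//].
have [y' [h [al _]]] := image_line nd' x 0 0.
apply: (@line_route_flattens _ _ y'); last by exists h.
by rewrite -e; apply/esym/key; exists h.
Qed.
End Words.

Section Foldings.
Implicit Types A B C : finDigraph.

Lemma fold_nondeg A B (f : folding A B) : nondeg f.
Proof. apply/nondegP; exact: fold_nd. Qed.

Lemma star_line_route A B (f : folding A B) x y :
  star f (line_route x) = line_route y <-> flattens (word f \o x) y.
Proof. exact: push_line_route. Qed.

Lemma fold_surj A B (f : folding A B) (y : line B) :
  exists x : line A, flattens (word f \o x) y.
Proof.
have [g _ gK] := fold_bij f; have [x e] := line_route_surj (g (line_route y)).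
by exists x; apply/star_line_route; rewrite -e /star gK.
Qed.

Lemma fold_inj A B (f : folding A B) (x x' : line A) (y : line B) :
  flattens (word f \o x) y -> flattens (word f \o x') y -> line_route x = line_route x'.
Proof.
by move=> /star_line_route e /star_line_route e'; apply/(bij_inj (fold_bij f)); rewrite [LHS]e [RHS]e'.
Qed.

Lemma mkfold A B (phi : hom A (Walks B)) : nondeg phi ->
    (forall y : line B, exists x : line A, flattens (word phi \o x) y) ->
    (forall (x x' : line A) (y : line B),
      flattens (word phi \o x) y -> flattens (word phi \o x') y -> line_route x = line_route x') ->
  exists f : folding A B, fold_hom f = phi.
Proof.
move=> nd sj ij; have nd' := (nondegP _).2 nd.
suff b : bijective (push nd') by exists (Folding b).
apply: inj_surj_bij => [R R'|R].
  have [x ->] := line_route_surj R; have [x' ->] := line_route_surj R'.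
  have [y [h [al _]]] := image_line nd x 0 0.
  have fl : flattens (word phi \o x) y by exists h.
  rewrite ((push_line_route nd' x y).2 fl) => /esym/push_line_route; exact: ij.
have [y ->] := line_route_surj R; have [x fl] := sj y.
by exists (line_route x); apply/push_line_route.
Qed.

Lemma flattens_comp A B C (f : hom A (Walks B)) (g : hom B (Walks C))
    (h : hom A (Walks C)) (x : line A) (y : line B) (z : line C) :
  (forall e, word h e = flatten (map (word g) (word f e))) ->
  flattens (word f \o x) y -> flattens (word g \o y) z -> flattens (word h \o x) z.
Proof.
move=> e [i al] [j aj]; exists (j \o i); have := aligned_comp al aj.
by congr (aligned _ _ _); apply/funext => k /=; rewrite e.
Qed.

Lemma star_comp A B C (f : folding A B) (g : folding B C) (h : folding A C) :
  (forall e, word h e = flatten (map (word g) (word f e))) ->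
  star h = star g \o star f.
Proof.
move=> e; apply/funext => R; have [x ->] := line_route_surj R.
have [y [i [al _]]] := image_line (@fold_nondeg _ _ f) x 0 0.
have [z [j [aj _]]] := image_line (@fold_nondeg _ _ g) y 0 0.
have fl : flattens (word f \o x) y by exists i.
have gl : flattens (word g \o y) z by exists j.
rewrite /= ((star_line_route f x y).2 fl) ((star_line_route g y z).2 gl).
exact/star_line_route/(flattens_comp e fl gl).
Qed.

Lemma fold_comp A B C (f : folding A B) (g : folding B C) :
  exists h : folding A C,
    [/\ forall v, homV h v = homV g (homV f v),
        forall e, word h e = flatten (map (word g) (word f e)) &
        star h = star g \o star f].
Proof.
pose phi : hom A (Walks C) := hom_comp (extend g) f.
have we e : word phi e = flatten (map (word g) (word f e)) by exact: wedges_mkwalk.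
have nd : nondeg phi.
  move=> x; have [y [i [al _]]] := image_line (@fold_nondeg _ _ f) x 0 0.
  have := recurrent_comp (@fold_nondeg _ _ f x) (@fold_nondeg _ _ g y) al.
  by congr recurrent; apply/funext => k /=; rewrite we.
have push_phi (x : line A) (z : line C) :
    flattens (word phi \o x) z <-> star g (star f (line_route x)) = line_route z.
  have [y [i [al _]]] := image_line (@fold_nondeg _ _ f) x 0 0.
  have fl : flattens (word f \o x) y by exists i.
  rewrite ((star_line_route f x y).2 fl); split=> [fz|/star_line_route gl]; last exact: flattens_comp fl gl.
  have [z' [j [aj _]]] := image_line (@fold_nondeg _ _ g) y 0 0.
  have gl : flattens (word g \o y) z' by exists j.
  rewrite ((star_line_route g y z').2 gl); apply: flattens_line_route fz; first exact: nd.
  exact: flattens_comp fl gl.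
have [||h hE] := mkfold nd.
- move=> z; have [y gl] := fold_surj g z; have [x fl] := fold_surj f y.
  by exists x; apply: flattens_comp fl gl.
- move=> x x' z /push_phi e /push_phi e'.
  apply/(bij_inj (fold_bij f))/(bij_inj (fold_bij g)).
  by rewrite [LHS]e [RHS]e'.
exists h; rewrite hE; split=> //; apply: star_comp => e; rewrite hE; exact: we.
Qed.

(** For the triangle [h = g o p] it suffices to know that [h] and [g] are foldings. *)
Lemma fold_cancel_l A B C (h : folding A C) (g : folding B C) (p : hom A (Walks B)) :
    (forall e, word h e = flatten (map (word g) (word p e))) ->
  exists f : folding A B, fold_hom f = p /\ star h = star g \o star f.
Proof.
move=> we.
have nd : nondeg p.
  move=> x; have [hi lo] := @fold_nondeg _ _ h x.
  have key z : size ((word h \o x) z) <> 0%N -> size ((word p \o x) z) <> 0%N.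
    by rewrite /= we; case: (word p _).
  by split=> N; [have [z ? /key] := hi N|have [z ? /key] := lo N]; exists z.
have [||f fE] := mkfold nd.
- move=> y; have [z [j [aj _]]] := image_line (@fold_nondeg _ _ g) y 0 0.
  have gl : flattens (word g \o y) z by exists j.
  have [x hl] := fold_surj h z; exists x.
  have [y' [i [al _]]] := image_line nd x 0 0.
  have fl' : flattens (word p \o x) y' by exists i.
  have [z' [j' [aj' _]]] := image_line (@fold_nondeg _ _ g) y' 0 0.
  have gl' : flattens (word g \o y') z' by exists j'.
  have hl' := flattens_comp we fl' gl'.
  apply: (@line_route_flattens _ _ y') => //; apply: (fold_inj (f := g) (y := z)) (gl).
  apply: (@line_route_flattens _ _ z') => //.
  exact: flattens_line_route (@fold_nondeg _ _ h x) hl' hl.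
- move=> x x' y fl fl'.
  have [z [j [aj _]]] := image_line (@fold_nondeg _ _ g) y 0 0.
  have gl : flattens (word g \o y) z by exists j.
  by apply: (fold_inj (f := h) (y := z)); apply: flattens_comp gl.
by exists f; split=> //; apply: star_comp => e; rewrite fE.
Qed.

Lemma aligned_unbounded E (ws : int -> seq E) x f : recurrent ws -> aligned ws x f ->
  (forall N, exists z, forall z', z <= z' -> N <= f z') /\
  (forall N, exists z, forall z', z' <= z -> f z' <= N).
Proof.
move=> rw al; have le := telescope_le (fun z => (al z).1).
split=> N; have [z [j [js e]]] := aligned_split rw al N.
  by exists (z + 1) => z' /le; rewrite (al z).1; lia.
by exists z => z' /le; lia.
Qed.

(** Every line of [B] is read by words of [p], so [g] inherits nondegeneracy from
    [h]: a stretch of empty words of [g] would be one of [h]. *)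
Lemma fold_cancel_r A B C (h : folding A C) (p : folding A B) (g : hom B (Walks C)) :
    (forall e, word h e = flatten (map (word g) (word p e))) ->
  exists f : folding B C, fold_hom f = g /\ star h = star f \o star p.
Proof.
move=> we.
have nd : nondeg g.
  move=> y; have [x [i al]] := fold_surj p y.
  have rp := @fold_nondeg _ _ p x; have [hi lo] := @fold_nondeg _ _ h x.
  have [uhi ulo] := aligned_unbounded rp al.
  have key z : size ((word h \o x) z) <> 0%N ->
      exists2 k, i z <= k < i (z + 1) & size ((word g \o y) k) <> 0%N.
    have [iS r] := al z; rewrite iS /= we => hz.
    apply: contrapT => no; apply: hz.
    have {}no j : (j < size ((word p \o x) z))%N -> size (word g (y (i z + j%:Z))) = 0%N.
      by move=> /= js; apply: contrapT => h1; apply: no; exists (i z + j%:Z) => //=; lia.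
    move: r no; rewrite /= ; move: (word p (x z)) (i z) => s a.
    elim: s a => // e s IH a /reads_cons[<- r] no /=; rewrite size_cat.
    have := no 0%N isT; rewrite addr0 => ->; apply: IH r _ => j js.
    by rewrite -(no j.+1) //; congr (size (word g (lfun y _))); lia.
  split=> N.
    have [z zP] := uhi N; have [z' /zP] := hi z; move=> le /key[k /andP[k1 _] ?].
    by exists k => //; exact: le_trans le k1.
  have [z zP] := ulo N; have [z' zz'] := lo (z - 1); move=> /key[k /andP[_ k2] ?].
  exists k => //; have : i (z' + 1) <= N by apply: zP; lia.
  lia.
have [||f fE] := mkfold nd.
- move=> z; have [x hl] := fold_surj h z.
  have [y [i [al _]]] := image_line (@fold_nondeg _ _ p) x 0 0.
  have fl : flattens (word p \o x) y by exists i.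
  exists y; have [z' [j [aj _]]] := image_line nd y 0 0.
  have gl : flattens (word g \o y) z' by exists j.
  apply: line_route_flattens (gl).
  exact: flattens_line_route (@fold_nondeg _ _ h x) (flattens_comp we fl gl) hl.
- move=> y y' z gl gl'.
  have [x fl] := fold_surj p y; have [x' fl'] := fold_surj p y'.
  have e : line_route x = line_route x'.
    by apply: (fold_inj (f := h) (y := z)); [exact: flattens_comp gl|exact: flattens_comp gl'].
  by move/star_line_route: fl => <-; move/star_line_route: fl' => <-; rewrite e.
by exists f; split=> //; apply: star_comp => e; rewrite fE.
Qed.
End Foldings.

(** * Joining lines and running round cycles *)

Section Surgery.
Variable D : digraph.
Implicit Types x y : line D.

Lemma shift_subproof x t k : tgt (x (k + t)) = src (x (k + 1 + t)).
Proof. by rewrite lineP; congr (src (lfun x _)); lia. Qed.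
Definition shift x t : line D := Line (shift_subproof x t).

Lemma line_route_shift x t : line_route (shift x t) = line_route x.
Proof. by apply/esym/line_route_eq; exists t. Qed.

Lemma glue_subproof x y k (e : src (x k) = src (y k)) j :
  tgt (if j < k then x j else y j) = src (if j + 1 < k then x (j + 1) else y (j + 1)).
Proof.
case: (ltP j k) => jk; case: (ltP (j + 1) k) => jk'; rewrite ?lineP //; last by exfalso; lia.
by have -> : j + 1 = k by lia.
Qed.
Definition glue x y k e : line D := Line (@glue_subproof x y k e).

Lemma loop_line_subproof x (i n : int) (n0 : 0 < n) (e : src (x i) = src (x (i + n))) j :
  tgt (x (i + ((j - i) %% n)%Z)) = src (x (i + ((j + 1 - i) %% n)%Z)).
Proof.
have n1 : n != 0 by rewrite gt_eqF.
have m0 := modz_ge0 (j - i) n1; have m1 := ltz_pmod (j - i) n0.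
rewrite lineP (_ : j + 1 - i = j - i + 1); last lia.
rewrite -[in RHS]modzDml; move: m0 m1; move: ((j - i) %% n)%Z => r m0 m1.
case: (ltP (r + 1) n) => h.
  by rewrite (modz_small (m := r + 1)); [congr (src (lfun x _))|]; lia.
have -> : r + 1 = n by lia.
by rewrite modzz addr0 e; congr (src (lfun x _)); lia.
Qed.
(** The line running forever round the cycle formed by the edges of [x] at
    [i, ..., i + n - 1]. *)
Definition loop_line x i n n0 e : line D := Line (@loop_line_subproof x i n n0 e).
End Surgery.

(** * The UDAF property in terms of lines *)

Definition op (D : finDigraph) : finDigraph := FinDigraph (@ftgt D) (@fsrc D).

Lemma pigeonhole (T : finType) (g : nat -> T) :
  exists i j, (i < j <= #|T|)%N /\ g i = g j.
Proof.
have : ~ injective (fun i : 'I_#|T|.+1 => g i).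
  by move=> /leq_card; rewrite card_ord ltnn.
move=> ni; apply: contrapT => no; apply: ni => i j e; apply/val_inj.
case: (ltngtP i j) => // ij; case: no.
  by exists i, j; rewrite ij -ltnS ltn_ord.
by exists j, i; rewrite ij -ltnS ltn_ord.
Qed.

Section OpLine.
Variable D : finDigraph.

Lemma op_line_subproof (x : line D) k :
  @tgt (op D) (x (- 1 - k)) = @src (op D) (x (- 1 - (k + 1))).
Proof.
have e : - 1 - k = - 1 - (k + 1) + 1 by lia.
by have /= := lineP x (- 1 - (k + 1)); rewrite -e => ->.
Qed.
Definition op_line (x : line D) : line (op D) := @Line (op D) _ (op_line_subproof x).

Lemma unop_line_subproof (x : line (op D)) k :
  @tgt D (x (- 1 - k)) = @src D (x (- 1 - (k + 1))).
Proof.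
have e : - 1 - k = - 1 - (k + 1) + 1 by lia.
by have /= := lineP x (- 1 - (k + 1)); rewrite -e => ->.
Qed.
Definition unop_line (x : line (op D)) : line D := @Line D _ (unop_line_subproof x).

Lemma op_lineK x : unop_line (op_line x) = x.
Proof. by apply: line_ext => k /=; congr (lfun x _); lia. Qed.

Lemma unop_lineK x : op_line (unop_line x) = x.
Proof. by apply: line_ext => k /=; congr (lfun x _); lia. Qed.
End OpLine.

(** The boolean chooses a direction, left for [true], so that the two halves of the
    UDAF property are treated at once. *)
Definition beyond (d : bool) (K j : int) : Prop := if d then j < K else K <= j.

Definition asymp (d : bool) T (x x' : int -> T) : Prop :=
  exists K, forall j, beyond d K j -> x' j = x j.

Definition branching (d : bool) (D : digraph) : Prop := forall x : line D,
  exists x' : line D, asymp d x x' /\ exists k, x' k <> x k.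

Lemma branching_op d (D : finDigraph) : branching d (op D) <-> branching (~~ d) D.
Proof.
split=> br x.
  have [x' [[K e] [k ne]]] := br (op_line x).
  exists (unop_line x'); split.
    exists (- K) => j; case: d {br} e; rewrite /beyond => /= e h.
      by rewrite e /=; [congr (lfun x _)|]; lia.
    by rewrite e /=; [congr (lfun x _)|]; lia.
  exists (- 1 - k) => /=; rewrite (_ : - 1 - (- 1 - k) = k); last lia.
  by [].
have [x' [[K e] [k ne]]] := br (unop_line x).
exists (op_line x'); split.
  exists (- K) => j; case: d {br} e; rewrite /beyond => /= e h.
    by rewrite e /=; [congr (lfun x _)|]; lia.
  by rewrite e /=; [congr (lfun x _)|]; lia.
exists (- 1 - k) => /=; rewrite (_ : - 1 - (- 1 - k) = k); last lia.
by [].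
Qed.

Section Rays.
Variable D : finDigraph.
Implicit Types (v : vert D) (r : nat -> edge D).

(** Forward rays; backward rays are the rays of [op D]. *)
Definition ray v r : Prop := src (r 0%N) = v /\ forall n, tgt (r n) = src (r n.+1).

Lemma ray_cycle r : (forall n, tgt (r n) = src (r n.+1)) ->
  exists (c : line D) (i n : nat), (0 < n)%N /\ forall k : int, c k = r (i + `|(k %% n%:Z)%Z|)%N.
Proof.
move=> rS; have [i [j [/andP[ij _] e]]] := pigeonhole (fun n => fsrc (r n)).
pose n := (j - i)%N.
have n0 : 0 < n%:Z by rewrite /n; lia.
pose c k := r (i + `|(k %% n%:Z)%Z|)%N.
have cP k : tgt (c k) = src (c (k + 1)).
  rewrite /c -[in RHS]modzDml rS.
  have m0 := modz_ge0 k (lt0r_neq0 n0); have m1 := ltz_pmod k n0.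
  move: m0 m1; move: (k %% n%:Z)%Z => q m0 m1.
  case: (ltP (q + 1) n%:Z) => h.
    by rewrite (modz_small (m := q + 1)); [congr (src (r _))|]; lia.
  have -> : q + 1 = n%:Z by lia.
  rewrite modzz addn0 /= e; congr (fsrc (r _)); rewrite /n in m1 h *; lia.
by exists (Line cP), i, n; split=> //; rewrite /n; lia.
Qed.

(** A unique ray runs into a cycle, and a line that agrees with this cycle far to
    the left but not everywhere leaves it at some vertex, which gives a second ray.
    Conversely a line is modified after the origin using a second ray there. *)
Lemma branching_ray : branching true D <-> forall v, ~ exists! r, ray v r.
Proof.
split=> [br v [r [[rv rS] ru]]|no x].
  have [c [i [n [n0 cE]]]] := ray_cycle rS.
  have [x' [[K xK] [k ne]]] := br c.
  pose m := (`|K| + `|k| + 1)%N.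
  (* a multiple of the period before [K] and [k], so that [c] starts there like [r] at [i] *)
  pose j0 : int := - (n * m)%N%:Z.
  have nm : (m <= n * m)%N by rewrite leq_pmull.
  have jK : j0 < K by rewrite /j0 /m in nm *; lia.
  have jk : j0 <= k by rewrite /j0 /m in nm *; lia.
  have cmul t : c (j0 + t) = c t.
    rewrite !cE /j0; congr (r (i + `|_|)%N).
    have -> : - (n * m)%N%:Z + t = (- m%:Z) * n%:Z + t by lia.
    by rewrite modzMDl.
  pose mk (y : int -> edge D) p := if (p < i)%N then r p else y (j0 + (p - i)%N%:Z).
  have mkP (y : line D) : src (y j0) = src (c j0) -> ray v (mk y).
    move=> yj.
    have y0 : src (y j0) = src (r i).
      by rewrite yj -[j0]addr0 cmul cE mod0z addn0.
    split.
      rewrite /mk; case: ltnP => [//|i0]; have {}i0 : i = 0%N by lia.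
      by rewrite i0 addr0 y0 i0.
    move=> p; rewrite /mk; case: ltnP => pi; case: ltnP => pi'; rewrite ?rS //; last 1 first.
    - by rewrite lineP; congr (src (lfun y _)); lia.
    - have -> : p.+1 = i by lia.
      by rewrite subnn addr0 y0.
    by exfalso; lia.
  have e1 : mk x' = r by apply/esym/ru/mkP; rewrite xK.
  have e2 : mk c = r by apply/esym/ru/(mkP c).
  apply: ne; have := congr1 (@^~ (i + `|k - j0|)%N) (etrans e1 (esym e2)).
  rewrite /mk ltnNge leq_addr /=.
  by rewrite (_ : j0 + (i + `|k - j0| - i)%N%:Z = k) //; lia.
have rx : ray (src (x 0)) (fun n => x n%:Z).
  by split=> // n; rewrite lineP; congr (src (lfun x _)); lia.
have [r [[r0 rS] rne]] : exists r, ray (src (x 0)) r /\ r <> (fun n => x n%:Z).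
  apply: contrapT => h; apply: (no (src (x 0))); exists (fun n => x n%:Z); split=> // r rr.
  by apply: contrapT => h1; apply: h; exists r; split=> // h2; apply: h1.
pose y (k : int) := if k < 0 then x k else r `|k|%N.
have yP k : tgt (y k) = src (y (k + 1)).
  rewrite /y; case: ltP => k0; case: ltP => k1; rewrite ?lineP //; first 1 last.
  - by exfalso; lia.
  - by rewrite rS; congr (src (r _)); lia.
  have -> : k + 1 = 0 by lia.
  by rewrite r0.
exists (Line yP); split; first by exists 0 => j /= j0; rewrite /y j0.
have [n ne] : exists n, r n <> x n%:Z.
  by apply: contrapT => h; apply: rne; apply/funext => n; apply: contrapT => h1; apply: h; exists n.
by exists n%:Z.
Qed.
End Rays.

Section HomRays.
Variable D : finDigraph.

Lemma fwd_edge_subproof (n : nat) : (n%:Z \in `[0, +oo[) && (n%:Z + 1 \in `[0, +oo[).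
Proof. by rewrite !in_itv /=; lia. Qed.
Definition fwd_edge n : edge (Zint `[0, +oo[) := exist _ n%:Z (fwd_edge_subproof n).

Lemma bwd_edge_subproof (n : nat) : (Negz n \in `]-oo, 0]) && (Negz n + 1 \in `]-oo, 0]).
Proof. by rewrite !in_itv /=; lia. Qed.
Definition bwd_edge n : edge (Zint `]-oo, 0]) := exist _ (Negz n) (bwd_edge_subproof n).

Lemma hom_ext (D1 D2 : digraph) (f g : hom D1 D2) :
  (forall v, homV f v = homV g v) -> (forall e, homE f e = homE g e) -> f = g.
Proof.
case: f g => [fV fE fs ft] [gV gE gs gt] /= /funext eV /funext eE; subst gV gE.
by congr Hom; exact: Prop_irrelevance.
Qed.

Lemma hom_ray v : (exists! h : hom (Zint `[0, +oo[) D, homV h (exist _ 0 isT) = v) <->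
  exists! r, @ray D v r.
Proof.
have mkP (r : nat -> edge D) : (forall n, tgt (r n) = src (r n.+1)) ->
    forall e : edge (Zint `[0, +oo[), tgt (r `|sval e|%N) = src (r `|sval (tgt e)|%N).
  move=> rS [k /= /andP[k0 k1]]; have /= -> := rS `|k|%N; congr (fsrc (r _)).
  by move: k0; rewrite in_itv /=; lia.
pose f (h : hom (Zint `[0, +oo[) D) n := homE h (fwd_edge n).
have fP (h : hom (Zint `[0, +oo[) D) : ray (homV h (exist _ 0 isT)) (f h).
  split=> [|n]; first by rewrite /f hom_src; congr (homV h); apply/val_inj.
  by rewrite /f hom_src hom_tgt; congr (homV h); apply/val_inj => /=; lia.
have ext (h : hom (Zint `[0, +oo[) D) :
    (forall k : vert (Zint `[0, +oo[), homV h k = src (f h `|sval k|%N)) /\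
             (forall k : edge (Zint `[0, +oo[), homE h k = f h `|sval k|%N).
  split=> -[k k0].
    rewrite /f hom_src; congr (homV h); apply/val_inj => /=.
    by move: k0; rewrite in_itv /=; lia.
  rewrite /f; congr (homE h); apply/val_inj => /=.
  by move: k0; rewrite !in_itv /=; lia.
pose mk r (rS : forall n, tgt (r n) = src (r n.+1)) : hom (Zint `[0, +oo[) D :=
  @Hom (Zint `[0, +oo[) D (fun k => src (r `|sval k|%N)) (fun k => r `|sval k|%N)
    (fun=> erefl) (mkP r rS).
have ray_mk r rS : f (mk r rS) = r by [].
have homVE (h : hom (Zint `[0, +oo[) D) : homV h (exist _ 0 isT) = src (f h 0%N) by rewrite (ext h).1.
split=> [[h [hv hu]]|[r [[rv rS] ru]]].
  exists (f h); split=> [|r [rv rS]]; first by rewrite -hv.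
  by rewrite -(ray_mk r rS) (hu (mk r rS)).
exists (mk r rS); split=> // h hv.
have e : r = f h by apply: ru; rewrite -hv.
apply: hom_ext => k /=; first by rewrite e (ext h).1.
by rewrite e (ext h).2.
Qed.

Lemma hom_ray_op (v : vert D) :
  (exists! h : hom (Zint `]-oo, 0]) D, homV h (exist _ 0 isT) = v) <->
  exists! r, @ray (op D) v r.
Proof.
have absN (k : int) : k <= -1 -> Negz (`|k|.-1) = k by lia.
pose f (h : hom (Zint `]-oo, 0]) D) n := homE h (bwd_edge n).
have fP (h : hom (Zint `]-oo, 0]) D) : @ray (op D) (homV h (exist _ 0 isT)) (f h).
  split=> [|n].
    apply: etrans (hom_tgt h (bwd_edge 0)) _.
    by congr (homV h); apply/val_inj => /=; lia.
  apply: etrans (hom_src h (bwd_edge n)) _.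
  apply: etrans (esym (hom_tgt h (bwd_edge n.+1))).
  by congr (homV h); apply/val_inj => /=; lia.
have ext (h : hom (Zint `]-oo, 0]) D) :
    (forall k : vert (Zint `]-oo, 0]), homV h k = tgt (f h `|sval k|%N)) /\
             (forall k : edge (Zint `]-oo, 0]), homE h k = f h `|sval k|.-1%N).
  split=> -[k k0].
    rewrite /f hom_tgt; congr (homV h); apply/val_inj => /=.
    by move: k0; rewrite in_itv /=; lia.
  rewrite /f; congr (homE h); apply/val_inj => /=.
  by move: k0; rewrite !in_itv /=; lia.
have mkS (r : nat -> edge D) (rS : forall n, @tgt (op D) (r n) = @src (op D) (r n.+1))
    (e : edge (Zint `]-oo, 0])) : src (r `|sval e|.-1%N) = tgt (r `|sval (src e)|%N).
  case: e => k /= /andP[k0 k1]; have /= -> := rS (`|k|.-1)%N; congr (ftgt (r _)).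
  by move: k1; rewrite in_itv /=; lia.
have mkT (r : nat -> edge D) (e : edge (Zint `]-oo, 0])) :
    tgt (r `|sval e|.-1%N) = tgt (r `|sval (tgt e)|%N).
  case: e => k /= /andP[k0 k1]; congr (ftgt (r _)).
  by move: k1; rewrite in_itv /=; lia.
pose mk r rS : hom (Zint `]-oo, 0]) D :=
  @Hom (Zint `]-oo, 0]) D (fun k => tgt (r `|sval k|%N)) (fun k => r `|sval k|.-1%N)
    (mkS r rS) (mkT r).
have ray_mk r rS : f (mk r rS) = r by [].
have homVE (h : hom (Zint `]-oo, 0]) D) : homV h (exist _ 0 isT) = tgt (f h 0%N) by rewrite (ext h).1.
split=> [[h [hv hu]]|[r [[rv rS] ru]]].
  exists (f h); split=> [|r [rv rS]]; first by rewrite -hv.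
  by rewrite -(ray_mk r rS) (hu (mk r rS)).
exists (mk r rS); split=> // h hv.
have e : r = f h by apply: ru; rewrite -hv.
apply: hom_ext => k /=; first by rewrite e (ext h).1.
by rewrite e (ext h).2.
Qed.
End HomRays.

Lemma is_udafP (D : finDigraph) : is_udaf D <-> forall d, branching d D.
Proof.
split=> [ud [|]|br v].
- by apply/branching_ray => v; rewrite -hom_ray; exact: (ud v).1.
- by apply/(branching_op true)/branching_ray => v; rewrite -hom_ray_op; exact: (ud v).2.
split; first by rewrite hom_ray; move: v; apply/branching_ray.
rewrite hom_ray_op; have := br false; rewrite -(branching_op true) => /branching_ray.
by apply.
Qed.

(** * Elementary foldings in terms of words *)

Section WalkExt.
Variable D : digraph.
Implicit Types p q : walk D.

Lemma nth_wedges p (j : 'I_(wlen p)) e0 : nth e0 (wedges p) j = wedge j.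
Proof. by rewrite /wedges (nth_map j) ?size_enum_ord // nth_ord_enum. Qed.

Lemma walk_ext p q : wsrc p = wsrc q -> wedges p = wedges q -> p = q.
Proof.
move=> es ew; have en : wlen p = wlen q by rewrite -!size_wedges ew.
case: p q es ew en => n h [m h'] /= es ew en; move: en; rewrite /wlen /= => en; subst m.
have eE (j : 'I_n) : homE h (seg_edge j) = homE h' (seg_edge j).
  have := congr1 (fun s => nth (homE h (seg_edge j)) s j) ew.
  by rewrite (@nth_wedges (existT _ n h) j) (@nth_wedges (existT _ n h') j).
have eE' (k : edge (Zint `[0, n%:Z])) : homE h k = homE h' k.
  case: k => k kP; have kn : (`|k| < n)%N by move: kP; rewrite !in_itv /=; lia.
  have -> : exist _ k kP = seg_edge (Ordinal kn); last exact: eE.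
  by apply/val_inj => /=; move: kP; rewrite !in_itv /=; lia.
congr existT; apply: hom_ext => // -[k kP].
case: (ltrP 0 k) => k0.
  have kQ : (k - 1 \in `[0, n%:Z]) && (k - 1 + 1 \in `[0, n%:Z]).
    by move: kP; rewrite !in_itv /=; lia.
  pose e : edge (Zint `[0, n%:Z]) := exist _ (k - 1) kQ.
  have -> : exist _ k kP = tgt e by apply/val_inj => /=; lia.
  by rewrite -!hom_tgt eE'.
have -> : exist _ k kP = seg_vert (ord0 : 'I_n.+1); last exact: es.
by apply/val_inj => /=; move: kP; rewrite in_itv /=; lia.
Qed.

(** The first edge of a nonempty walk determines its source. *)
Lemma walk_ext_ne p q : wedges p <> [::] -> wedges p = wedges q -> p = q.
Proof.
move=> ne e; apply: walk_ext => //.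
have := (wedges_chain p).1; have := (wedges_chain q).1; rewrite -e.
by case: (wedges p) ne => // a s _ /= [<- _] [<- _].
Qed.
End WalkExt.

Definition pairw (E : Type) (b : bool) (e e' : E) : seq E :=
  if b then [:: e'; e] else [:: e; e'].

Definition composable (D : digraph) (b : bool) (e e' : edge D) : Prop :=
  if b then tgt e' = src e else tgt e = src e'.

Section SplitWords.
Variables (D1 D2 : finDigraph).

(** Condition (2) of an elementary folding for [b = false] and condition (3) for
    [b = true]. The subdigraph is encoded as the set of edges with a word of
    length 1. *)
Record split_words (b : bool) (f : hom D1 (Walks D2)) (e : edge D2) : Prop := SplitWords {
  split_loop : src e <> tgt e;
  split_homV : bijective (homV f : vert D1 -> vert D2);
  split_inj : injective (word f);
  split_cover : forall a, (exists2 e', e' <> e & word f a = [:: e']) \/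
                          (exists e', word f a = pairw b e e');
  split_single : forall e', e' <> e -> exists a, word f a = [:: e'];
  split_pair : forall e', composable b e e' -> exists a, word f a = pairw b e e' }.

Lemma word_walk1 (D : digraph) (e : edge D) : wedges (walk1 e) = [:: e].
Proof. exact: wedges_mkwalk. Qed.

Lemma walks2P (D : finDigraph) (i : 'I_2) (e : edge D) (p : walk D) :
  walks2 i e p <-> exists e', wedges p = pairw (i == ord_max) e e'.
Proof.
have w2 (h : hom (Zint `[0, 2%N%:Z]) D) : wedges (existT _ 2%N h : walk D) =
    [:: homE h (seg_edge ord0); homE h (seg_edge ord_max)].
  rewrite /wedges /= enum_ordSl enum_ordSl (size0nil (size_enum_ord 0)) /= /wedge /=.
  by congr [:: _; homE h (seg_edge _)]; apply/val_inj.
have i2 : i = ord0 \/ i = ord_max.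
  by case: i => -[|[|//]] ilt; [left|right]; apply/val_inj.
split=> [[h /= he <-]|[e' we]].
  by rewrite w2 -he; case: i2 => -> /=; eexists; reflexivity.
have : wlen p = 2%N by rewrite -size_wedges we /pairw; case: ifP.
case: p we => n h we; rewrite /wlen /= => n2; subst n.
exists h => //=; move: we; rewrite w2 /pairw.
by case: i2 => -> /= [].
Qed.

Lemma split_edgeP (f : folding D1 D2) (i : 'I_2) :
  split_edge f i <-> exists e, split_words (i == ord_max) f e.
Proof.
have single (a : edge D1) e' : homE f a = walk1 e' <-> word f a = [:: e'].
  rewrite /word; split=> [->|we]; first exact: word_walk1.
  by apply: walk_ext_ne; rewrite we ?word_walk1.
split=> [[e [ES [nl bV [/= b1 b2 b3] [/= c1 c2 c3]]]]|[e [nl bV wi wc ws wp]]].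
  have sz a : ES a <-> size (word f a) = 1%N.
    split=> [/b1[e' _ /esym/single -> //]|s1].
    apply: contrapT => /c1/walks2P[e']; rewrite -/(word f a) => we.
    by move: s1; rewrite we /pairw; case: ifP.
  have fne a : word f a <> [::].
    case: (pselect (ES a)) => [/b1[e' _ /esym/single -> //]|/c1/walks2P[e']].
    by rewrite -/(word f a) => ->; rewrite /pairw; case: ifP.
  exists e; split=> //.
  - move=> a a' ew; have ea : homE f a = homE f a' by apply: walk_ext_ne => //; exact: fne.
    case: (pselect (ES a)) => Ea.
      by apply: b2; rewrite ?inE //; apply/sz; rewrite -ew; apply/sz.
    by apply: c2; rewrite ?inE //= => /sz; rewrite -ew => /sz.
  - move=> a; case: (pselect (ES a)) => [/b1[e' ne /esym/single ?]|/c1/walks2P//].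
      by left; exists e'.
    by right.
  - move=> e' ne; have [|a _ /single ?] := b3 (walk1 e'); first by exists e'.
    by exists a.
  - move=> e' co; have [p pw] : exists p : walk D2, wedges p = pairw (i == ord_max) e e'.
      have c : chain (src (if i == ord_max then e' else e)) (pairw (i == ord_max) e e').
        by move: co; rewrite /composable /pairw; case: ifP => _ /= ->.
      by exists (mkwalk c); rewrite wedges_mkwalk.
    have [|a _ ea] := c3 p; first by apply/walks2P; exists e'.
    by exists a; rewrite /word ea.
have pairw_size e' : size (pairw (i == ord_max) e e') = 2%N by rewrite /pairw; case: ifP.
exists e, (fun a => size (word f a) = 1%N); split=> //.
  split=> /=.
  - move=> a /= s1; case: (wc a) => [[e' ne /single we]|[e' we]]; first by exists e'.
    by rewrite we pairw_size in s1.
  - by move=> a a' _ _ ea; apply: wi; rewrite /word ea.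
  - move=> _ [e' /= ne <-]; have [a we] := ws e' ne.
    by exists a; [rewrite /= we|apply/single].
split=> /=.
- move=> a /= s1; apply/walks2P; case: (wc a) => [[e' ne we]|//].
  by rewrite we in s1.
- by move=> a a' _ _ ea; apply: wi; rewrite /word ea.
- move=> p /= /walks2P[e' we].
  have [|a wa] := wp e'.
    have := (wedges_chain p).1; rewrite we /pairw /composable.
    by case: ifP => _ /= [_ []].
  exists a; first by rewrite /= wa pairw_size.
  apply: walk_ext_ne; rewrite -/(word f a) wa ?we //.
  by move: (pairw_size e'); case: pairw.
Qed.
End SplitWords.

Section Generated.
Implicit Types A B C : finDigraph.

(** The generators come with their inverses, so the category is a groupoid. *)
Lemma UDAFG'_inverse (A B : UDAF) (F : Route A -> Route B) : UDAFG' F ->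
  exists G : Route B -> Route A, [/\ cancel F G, cancel G F & UDAFG' G].
Proof.
elim=> {A B F} [A|A B f ef|A B f G ef fG Gf|A B C F G uF [F' [FK KF uF']] uG [G' [GK KG uG']]].
- by exists id; split=> //; exact: UDAFG'_id.
- have [G fG Gf] := fold_bij f; exists G; split=> //; exact: UDAFG'_star_inv ef fG Gf.
- by exists (star f); split=> //; exact: UDAFG'_star.
- exists (F' \o G'); split; [|exact: can_comp..|exact: UDAFG'_comp].
  by move=> R /=; rewrite GK FK.
Qed.

(** The generated maps are stated for plain digraphs and arbitrary proofs of the
    UDAF property, so that intermediate digraphs need no bundling. *)
Definition generated A B (F : Route A -> Route B) : Prop :=
  forall (PA : is_udaf A) (PB : is_udaf B), @UDAFG' (MkUDAF PA) (MkUDAF PB) F.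

Lemma generated_elementary A B (f : folding A B) : elementary f -> generated (star f).
Proof. by move=> ef PA PB; exact: UDAFG'_star. Qed.

Lemma generated_comp A B C (F : Route A -> Route B) (G : Route B -> Route C) :
  is_udaf B -> generated F -> generated G -> generated (G \o F).
Proof. by move=> PB gF gG PA PC; exact: UDAFG'_comp (gF PA PB) (gG PB PC). Qed.

Lemma generated_cancel_l A B C (F : Route A -> Route B) (G : Route B -> Route C) :
  is_udaf C -> generated G -> generated (G \o F) -> generated F.
Proof.
move=> PC gG gGF PA PB; have [G' [GK KG uG']] := UDAFG'_inverse (gG PB PC).
suff -> : F = G' \o (G \o F) by exact: UDAFG'_comp (gGF PA PC) uG'.
by apply/funext => R /=; rewrite GK.
Qed.

Lemma generated_cancel_r A B C (F : Route A -> Route B) (G : Route B -> Route C) :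
  is_udaf A -> generated F -> generated (G \o F) -> generated G.
Proof.
move=> PA gF gGF PB PC; have [F' [FK KF uF']] := UDAFG'_inverse (gF PA PB).
suff -> : G = (G \o F) \o F' by exact: UDAFG'_comp uF' (gGF PA PC).
by apply/funext => R /=; rewrite KF.
Qed.
End Generated.

(** * Cutting an edge *)

(** Words determine what reads them from a common position on, in each direction. *)
Lemma aligned_beyond d E (ws ws' : int -> seq E) x x' f f' K :
    recurrent ws -> aligned ws x f -> aligned ws' x' f' ->
    (forall j, beyond d K j -> ws' j = ws j) -> f' K = f K ->
  (forall j, beyond d K j -> f' j = f j) /\
  (forall j, beyond d (f K) j -> x' j = x j).
Proof.
move=> rw al al' ew eK.
have ef j : beyond d K j -> f' j = f j.
  rewrite /beyond; case: d ew => ew jK.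
    have -> : j = K - `|K - j|%N%:Z by lia.
    elim: `|K - j|%N => [|n IH]; first by rewrite subr0.
    have e1 : K - n.+1%:Z + 1 = K - n%:Z by lia.
    have := (al (K - n.+1%:Z)).1; have := (al' (K - n.+1%:Z)).1.
    by rewrite e1 ew ?IH /beyond; lia.
  have -> : j = K + `|j - K|%N%:Z by lia.
  elim: `|j - K|%N => [|n IH]; first by rewrite addr0.
  have e1 : K + n%:Z + 1 = K + n.+1%:Z by lia.
  have := (al (K + n%:Z)).1; have := (al' (K + n%:Z)).1.
  by rewrite e1 ew ?IH /beyond; lia.
split=> // j jb.
have le := telescope_le (fun z => (al z).1).
have [z [i [iz ej]]] := aligned_split rw al j; subst j.
have zb : beyond d K z.
  move: jb; rewrite /beyond; case: d {ew ef} => jb.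
    by rewrite ltNge; apply/negP => /le; lia.
  have : f K < f (z + 1) by rewrite (al z).1; lia.
  by move/(telescope_lt (fun z => (al z).1)); lia.
have := (al z).2; have := (al' z).2; rewrite ew // ef //.
case: (ws z) iz => // e0 s iz /reads_nth/(_ e0 i iz) -> /reads_nth/(_ e0 i iz) ->.
by [].
Qed.

Section Cut.
Variables (D : finDigraph) (e : edge D).

(** The edge [e] is removed, and [inr x] is the detour [e x] through it. *)
Definition cut_edge : finType :=
  ({x : fedge D | x != e} + {x : fedge D | ftgt e == fsrc x})%type.

Definition cut : finDigraph := @FinDigraph (fvert D) cut_edge
  (fun a => match a with inl x => fsrc (sval x) | inr _ => fsrc e end)
  (fun a => match a with inl x => ftgt (sval x) | inr x => ftgt (sval x) end).

Definition keep (x : fedge D) (P : x != e) : edge cut :=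
  inl (exist (fun x : fedge D => x != e) x P).
Definition detour (x : fedge D) (P : ftgt e == fsrc x) : edge cut :=
  inr (exist (fun x : fedge D => ftgt e == fsrc x) x P).

Definition cut_word (a : edge cut) : seq (edge D) :=
  match a with inl x => [:: sval x] | inr x => [:: e; sval x] end.

Lemma cut_wordP (a : edge cut) : @chain D (src a) (cut_word a) /\
  last (src a : vert D) [seq tgt b | b <- cut_word a] = tgt a.
Proof. by case: a => -[x xP] //=; rewrite (eqP xP). Qed.

Definition cut_hom : hom cut (Walks D) := @mkhom cut D id cut_word cut_wordP.

Lemma word_cut a : word cut_hom a = cut_word a.
Proof. exact: word_mkhom. Qed.

Hypothesis nl : src e <> tgt e.

Lemma cut_word_inj : injective cut_word.
Proof.
move=> [[x xP]|[x xP]] [[x' xP']|[x' xP']] //= [ex].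
  by congr inl; apply/val_inj.
by congr inr; apply/val_inj.
Qed.

(** How to parse a line of [D] into cut edges, given three consecutive edges: the
    token starting at [b] is empty if [b] is the second half of a detour; the
    defaults of [insub] are not met on lines. Since [e] is not a loop, the parse is
    determined locally. *)
Definition token (a b c : edge D) : seq (edge cut) :=
  if (a == e :> fedge D) then [::] else
  if (b == e :> fedge D) then oapp (fun u => [:: inr u]) [::] (insub c)
  else oapp (fun u => [:: inl u]) [::] (insub b).

Definition tokens (y : line D) (k : int) := token (y (k - 1)) (y k) (y (k + 1)).

(** Where the token of [k] is read: one step later if [k] is inside a detour. *)
Definition token_position (y : line D) (k : int) := k + (y (k - 1) == e :> fedge D)%:Z.

Lemma next_neq (y : line D) (k : int) : y k = e -> (y (k + 1) == e :> fedge D) = false.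
Proof.
by move=> ye; apply/eqP => ye'; have := lineP y k; rewrite ye ye' => h; apply: nl.
Qed.

Lemma tokenP (y : line D) (k : int) :
  (y (k - 1) = e /\ tokens y k = [::]) \/
  (y (k - 1) <> e /\ exists t, tokens y k = [:: t] /\
    cut_word t = (if y k == e :> fedge D then [:: y k; y (k + 1)] else [:: y k])).
Proof.
rewrite /tokens /token; case: eqP => [|ne]; [by left|right; split=> //].
case: ifP => ye.
  have P : ftgt e == fsrc (y (k + 1)) by apply/eqP; rewrite -(eqP ye); exact: (lineP y k).
  by exists (detour P); rewrite insubT /=; split; rewrite // (eqP ye).
have P : y k != e :> fedge D by rewrite ye.
by exists (keep P); rewrite insubT.
Qed.

Lemma tokens_recurrent y : recurrent (tokens y).
Proof.
have key k : size (tokens y k) <> 0%N \/ size (tokens y (k + 1)) <> 0%N.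
  case: (tokenP y k) => [[yk _]|[_ [t [-> _]]]]; last by left.
  right; case: (tokenP y (k + 1)) => [[+ _]|[_ [t [-> _]]]] //.
  have /eqP := next_neq yk; rewrite (_ : k - 1 + 1 = k + 1 - 1) //; lia.
split=> N.
  by case: (key N) => h; [exists N|exists (N + 1)] => //; lia.
by case: (key (N - 1)) => h; [exists (N - 1)|exists (N - 1 + 1)] => //; lia.
Qed.

Lemma tokens_aligned y :
  aligned (fun z => flatten (map cut_word (tokens y z))) y (token_position y).
Proof.
move=> k; rewrite /token_position (_ : k + 1 - 1 = k); last lia.
case: (tokenP y k) => [[yk ->]|[yk [t [-> /= ->]]]].
  split; last by [].
  by have := next_neq yk; rewrite (_ : k - 1 + 1 = k); [move=> -> /=; rewrite yk eqxx|]; lia.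
rewrite cats0; have -> : (y (k - 1) == e :> fedge D) = false by apply/eqP.
case: ifP => ye; rewrite /= !addr0.
  by split; [lia|apply/reads2].
by split; [lia|apply/reads1].
Qed.

Definition token_vertex (y : line D) (k : int) : vert cut :=
  if (y (k - 1) == e :> fedge D) then tgt (y k) else src (y k).

Lemma tokens_chain y (k : int) : chain (token_vertex y k) (tokens y k) /\
  last (token_vertex y k) [seq tgt a | a <- tokens y k] = token_vertex y (k + 1).
Proof.
rewrite /token_vertex (_ : k + 1 - 1 = k); last lia.
case: (tokenP y k) => [[yk ->]|[yk [t [-> et]]]].
  rewrite yk eqxx /=; have := next_neq yk; rewrite (_ : k - 1 + 1 = k); last lia.
  by move=> ->; split=> //; exact: (lineP y k).
have -> : (y (k - 1) == e :> fedge D) = false by apply/eqP.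
have [/= c l] := cut_wordP t.
move: c l; rewrite et; case: ifP => ye /= [-> _] <-; split=> //.
exact: (lineP y k).
Qed.

Lemma tokens_line y z a : exists (x : line cut) f, aligned (tokens y) x f /\ f z = a.
Proof. exact: gline_flat (tokens_chain y) (tokens_recurrent y) z a. Qed.

Lemma cut_word_ne a : cut_word a <> [::].
Proof. by case: a. Qed.

Lemma cut_recurrent (x : line cut) : recurrent (cut_word \o x).
Proof. by apply: recurrent_pos => k /=; exact: cut_word_ne. Qed.

Lemma tokens_flat_recurrent y : recurrent (fun z => flatten (map cut_word (tokens y z))).
Proof.
have [x [f [al _]]] := tokens_line y 0 0.
exact: recurrent_comp (tokens_recurrent y) (cut_recurrent x) al.
Qed.

Lemma cut_position_inj (x : line cut) y h : aligned (cut_word \o x) y h -> injective h.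
Proof.
move=> al a b; have pos z : h z < h (z + 1).
  by rewrite (al z).1 /=; case: (x z) => /=; lia.
have lt u v : u < v -> h u < h v.
  move=> uv; apply: lt_le_trans (pos u) _.
  by apply: (telescope_le (fun z => (al z).1)); lia.
by case: (ltgtP a b) => // /lt; lia.
Qed.

(** Any line of the cut digraph is recovered from its image by parsing: positions
    not preceded by [e] are exactly the starts of its words. *)
Lemma tokens_of_image (x : line cut) (y : line D) h : aligned (cut_word \o x) y h ->
  exists f, aligned (tokens y) x f /\ forall k, h (f k) = token_position y k.
Proof.
move=> al; have hI := cut_position_inj al.
have start z : y (h z - 1) <> e.
  have := al (z - 1); rewrite (_ : z - 1 + 1 = z); last lia.
  case=> -> /=; case: (x (z - 1)) => -[u uP] /=.
    move/reads1 => yu; rewrite (_ : _ - 1 = h (z - 1)) ?yu; last lia.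
    exact/eqP.
  move/reads2 => [ye yu]; rewrite (_ : _ - 1 = h (z - 1) + 1); last lia.
  exact/eqP/negbT/next_neq.
have /choice[f fP] : forall k, exists z, h z = token_position y k.
  move=> k; have [z [j [js ek]]] := aligned_split (cut_recurrent x) al k.
  have [hS r] := al z; rewrite /token_position.
  move: hS r js; rewrite /=; case: (x z) => -[u uP] /=.
    move=> _ _ j0; exists z; rewrite {1}ek (_ : k = h z); last lia.
    by have /eqP/negbTE -> := start z; lia.
  move=> hS /reads2[ye yu] js; case: (ltnP 0 j) => j0.
    by exists (z + 1); rewrite (_ : k - 1 = h z) ?ye ?eqxx /=; lia.
  exists z; rewrite {1}ek (_ : k = h z); last lia.
  by have /eqP/negbTE -> := start z; lia.
exists f; split=> // k.
have := tokens_aligned y k; rewrite -!fP.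
case: (tokenP y k) => [[yk ->]|[yk [t [-> et]]]] /=.
  by rewrite !addr0 => -[/hI -> _]; split; rewrite ?addr0.
rewrite cats0 => -[fS rd].
have tx : t = x (f k).
  have rx := (al (f k)).2; apply: cut_word_inj.
  have fk : h (f k) = k by rewrite fP /token_position; move/eqP/negbTE: yk => ->; lia.
  move: rx rd; rewrite fk et /=; case: (x (f k)) => -[u uP] /=.
    by move/reads1 => ->; rewrite (negbTE uP).
  by move/reads2 => [-> ->]; rewrite eqxx.
split; last by apply/reads1; rewrite tx.
by apply: hI; rewrite fS (al (f k)).1 tx.
Qed.

Lemma tokens_image (y : line D) (x : line cut) f : aligned (tokens y) x f ->
  exists h, aligned (cut_word \o x) y h /\ forall k, token_position y k = h (f k).
Proof.
move=> al; exact: aligned_comp_inv (tokens_recurrent y) (tokens_flat_recurrent y) al (tokens_aligned y).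
Qed.

Lemma cut_homE : word cut_hom = cut_word.
Proof. by apply/funext => a; exact: word_cut. Qed.

Lemma cut_folding : exists f : folding cut D, fold_hom f = cut_hom.
Proof.
apply: mkfold; rewrite ?cut_homE.
- by move=> x; rewrite cut_homE; exact: cut_recurrent.
- move=> y; have [x [f [al _]]] := tokens_line y 0 0; exists x.
  by have [h [ah _]] := tokens_image al; exists h.
move=> x x' y [h /tokens_of_image[f [al _]]] [h' /tokens_of_image[f' [al' _]]].
by apply: flattens_line_route (tokens_recurrent y) _ _; [exists f|exists f'].
Qed.

Lemma cut_split : split_words false cut_hom e.
Proof.
split=> //.
- by exists id.
- by rewrite cut_homE; exact: cut_word_inj.
- rewrite cut_homE; move=> [[x xP]|[x xP]] /=; [left|right]; exists x => //.
  exact/eqP.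
- by rewrite cut_homE => x /eqP xP; exists (keep xP).
- by rewrite cut_homE => x /eqP xP; exists (detour xP).
Qed.

Lemma cut_generated (f : folding cut D) : fold_hom f = cut_hom -> generated (star f).
Proof.
move=> fE; apply: generated_elementary; apply: Or32.
by apply/split_edgeP; exists e; rewrite fE; exact: cut_split.
Qed.

Lemma tokens_beyond d (y y' : line D) K : (forall j, beyond d K j -> y' j = y j) ->
  exists K', forall j, beyond d K' j ->
    tokens y' j = tokens y j /\ token_position y' j = token_position y j.
Proof.
move=> e1; exists (if d then K - 1 else K + 1) => j jb.
rewrite /tokens /token_position !e1 //; move: jb; rewrite /beyond; case: (d); lia.
Qed.

(** Reading and parsing are local in both directions, so asymptotic lines
    correspond. That distinct lines stay distinct needs the positions too: a line
    and its shift may have the same image up to shift, but not with the positions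
    agreeing far away. *)
Lemma branching_cut d : branching d cut <-> branching d D.
Proof.
split=> br.
  move=> y; have [x [f0 [/tokens_image[h [al _]] _]]] := tokens_line y 0 0.
  have [f [af fP]] := tokens_of_image al.
  have [x' [[K xK] [k ne]]] := br x.
  have [y' [h' [al' hK]]] : exists (y' : line D) h', aligned (cut_word \o x') y' h' /\ h' K = h K.
    have nd : nondeg cut_hom by move=> z; rewrite cut_homE; exact: cut_recurrent.
    by have := image_line nd x' K (h K); rewrite cut_homE.
  have [|hb yb] := aligned_beyond (d := d) (cut_recurrent x) al al' _ hK.
    by move=> j /xK /= ->.
  exists y'; split; first by exists (h K).
  apply: contrapT => same; apply: ne.
  have {}same : y' = y.
    by apply: line_ext => j; apply: contrapT => h1; apply: same; exists j.
  subst y'; have [f' [af' fP']] := tokens_of_image al'.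
  have [uhi ulo] := aligned_unbounded (tokens_recurrent y) af.
  have [uhi' ulo'] := aligned_unbounded (tokens_recurrent y) af'.
  have [j [jb jb']] : exists j, beyond d K (f j) /\ beyond d K (f' j).
    rewrite /beyond; case: (d).
      have [a aP] := ulo (K - 1); have [b bP] := ulo' (K - 1).
      exists (Num.min a b); have := aP (Num.min a b); have := bP (Num.min a b); lia.
    have [a aP] := uhi K; have [b bP] := uhi' K.
    exists (Num.max a b); have := aP (Num.max a b); have := bP (Num.max a b); lia.
  (* far away, the positions of [x] and [x'] in the common image agree *)
  have ff : f' j = f j.
    by apply: (cut_position_inj al); rewrite fP -fP' hb.
  rewrite (aligned_uniq (tokens_recurrent y) af af' j) ff.
  by congr (lfun x _); lia.
move=> x; have nd : nondeg cut_hom by move=> z; rewrite cut_homE; exact: cut_recurrent.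
have [y [h [al _]]] := image_line nd x 0 0.
rewrite cut_homE in al; have [f [af fP]] := tokens_of_image al.
have [y' [[K0 yK] [k ne]]] := br y.
have [K Kb] := tokens_beyond yK.
have [x' [f' [af' fK]]] := tokens_line y' K (f K).
have [|fb xb] := aligned_beyond (d := d) (tokens_recurrent y) af af' _ fK.
  by move=> j /Kb[].
have [h' [al' fP']] := tokens_image af'.
exists x'; split; first by exists (f K).
apply: contrapT => same; apply: ne.
have {}same : x' = x.
  by apply: line_ext => j; apply: contrapT => h1; apply: same; exists j.
subst x'; pose j := if d then K - 1 else K.
have jb : beyond d K j by rewrite /beyond /j; case: (d); lia.
have hh : h' (f j) = h (f j) by rewrite -{1}(fb j jb) -fP' fP (Kb j jb).2.
rewrite (aligned_uniq (cut_recurrent x) al al' (f j)) hh.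
by congr (lfun y _); lia.
Qed.

Lemma cut_udaf : is_udaf cut <-> is_udaf D.
Proof. by split=> /is_udafP br; apply/is_udafP => d; apply/branching_cut. Qed.
End Cut.

(** * Reversing all edges *)

Lemma chain_op (B : finDigraph) (v u : vert B) s :
  @chain B v s -> last v [seq tgt a | a <- s] = u ->
  @chain (op B) u (rev s) /\ last u [seq @tgt (op B) a | a <- rev s] = v.
Proof.
elim: s v => [|a s IH] v /=; first by move=> _ ->.
move=> [<- c] l; have [c' l'] := IH _ c l.
rewrite rev_cons -cats1; split; first by apply: chain_cat => //; rewrite l'.
by rewrite map_cat last_cat.
Qed.

Section OpHom.
Variables (A B : finDigraph) (f : hom A (Walks B)).

Lemma op_homP (a : edge (op A)) :
  @chain (op B) (homV f (@src (op A) a)) (rev (word f a)) /\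
  last (homV f (@src (op A) a) : vert (op B)) [seq @tgt (op B) b | b <- rev (word f a)] =
  homV f (@tgt (op A) a).
Proof. have [c l] := word_chain f a; exact: (@chain_op B _ _ _ c l). Qed.

Definition op_hom : hom (op A) (Walks (op B)) :=
  @mkhom (op A) (op B) (homV f) (fun a => rev (word f a)) op_homP.

Lemma word_op a : word op_hom a = rev (word f a).
Proof. exact: word_mkhom. Qed.
End OpHom.

Lemma aligned_rev E (ws : int -> seq E) y h : aligned ws y h ->
  aligned (fun z => rev (ws (- 1 - z))) (fun k => y (- 1 - k)) (fun z => - h (- z)).
Proof.
move=> al z; have [hS r] := al (- 1 - z).
have e : - 1 - z + 1 = - z by lia.
rewrite e in hS; rewrite size_rev (_ : - (z + 1) = - 1 - z) ?hS; last lia.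
split; first lia.
apply/reads_nth => e0 j; rewrite size_rev => js; rewrite nth_rev //.
have /reads_nth r' := r; rewrite -(r' e0); last lia.
by congr y; lia.
Qed.

Lemma recurrent_rev E (ws : int -> seq E) : recurrent ws ->
  recurrent (fun z => rev (ws (- 1 - z))).
Proof.
move=> [hi lo]; split=> N.
  have [z zN ?] := lo (- 1 - N); exists (- 1 - z); first lia.
  by rewrite size_rev (_ : - 1 - (- 1 - z) = z) //; lia.
have [z zN ?] := hi (- 1 - N); exists (- 1 - z); first lia.
by rewrite size_rev (_ : - 1 - (- 1 - z) = z) //; lia.
Qed.

Section OpFold.
Variables (A B : finDigraph).

Lemma flattens_op (f : hom A (Walks B)) (x : line A) (y : line B) :
  flattens (word f \o x) y -> flattens (word (op_hom f) \o op_line x) (op_line y).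
Proof.
case=> h /aligned_rev al; exists (fun z => - h (- z)) => z.
by have := al z; rewrite /= word_op.
Qed.

Lemma flattens_unop (f : hom A (Walks B)) (x : line (op A)) (y : line (op B)) :
  flattens (word (op_hom f) \o x) y -> flattens (word f \o unop_line x) (unop_line y).
Proof.
case=> h /aligned_rev al; exists (fun z => - h (- z)) => z.
by have := al z; rewrite /= word_op revK.
Qed.

Lemma line_route_unop (x x' : line (op A)) :
  line_route (unop_line x) = line_route (unop_line x') -> line_route x = line_route x'.
Proof.
move=> /line_route_eq[t e]; apply/line_route_eq; exists (- t) => k.
have := e (- 1 - k) => /=; rewrite (_ : - 1 - (- 1 - k) = k); last lia.
by move=> ->; congr (lfun x _); lia.
Qed.

Lemma op_folding (f : folding A B) : exists f' : folding (op A) (op B), fold_hom f' = op_hom f.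
Proof.
apply: mkfold.
- move=> x; have := recurrent_rev (@fold_nondeg _ _ f (unop_line x)).
  congr recurrent; apply/funext => k /=; rewrite word_op.
  by congr (rev (word f (lfun x _))); lia.
- move=> y; have [x fl] := fold_surj f (unop_line y); exists (op_line x).
  by rewrite -(unop_lineK y); apply: flattens_op.
- move=> x x' y /flattens_unop fl /flattens_unop fl'; apply: line_route_unop; exact: fold_inj fl fl'.
Qed.

Lemma split_words_op b (f : hom A (Walks B)) e :
  split_words b f e -> @split_words (op A) (op B) (~~ b) (op_hom f) e.
Proof.
have rp e' : rev (pairw b e e') = pairw (~~ b) e e' by case: b.
case=> nl bV wi wc ws wp; split=> //.
- by move=> /esym/nl.
- by move=> a a'; rewrite !word_op => /(can_inj revK)/wi.
- move=> a; rewrite word_op; case: (wc a) => [[e' ne ->]|[e' ->]]; [left|right]; exists e' => //.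
- by move=> e' /ws[a we]; exists a; rewrite word_op we.
- move=> e' co; have [|a we] := wp e'; last by exists a; rewrite word_op we rp.
  by move: co; rewrite /composable; case: (b) => /= ->.
Qed.

Lemma elementary_op (f : folding A B) (f' : folding (op A) (op B)) :
  fold_hom f' = op_hom f -> elementary f -> elementary f'.
Proof.
move=> fE [[g [v [fg [gV gE] rV rE iso]]]|/split_edgeP[e sw]|/split_edgeP[e sw]].
- apply: Or31.
  pose g' : hom (op A) (op B) := @Hom (op A) (op B) (homV g) (homE g) (hom_tgt g) (hom_src g).
  exists g', v; split=> //; last by move=> e; case: (iso e).
  rewrite fE; apply: hom_ext => [u|a]; first by rewrite /= fg.
  have w1 : wedges (homE (hom_comp (incl (op B)) g') a) = [:: homE g a] by exact: word_walk1.
  apply: walk_ext_ne; rewrite ?w1 -/(word (op_hom f) a) word_op fg.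
    by rewrite /word (word_walk1 (homE g a)).
  by rewrite /word (word_walk1 (homE g a)).
- apply: Or33; apply/split_edgeP; exists e; rewrite fE; exact: (split_words_op sw).
- apply: Or32; apply/split_edgeP; exists e; rewrite fE; exact: (split_words_op sw).
Qed.

Lemma star_op (f : folding A B) (f' : folding (op A) (op B)) x y :
  fold_hom f' = op_hom f -> star f (line_route x) = line_route y ->
  star f' (line_route (op_line x)) = line_route (op_line y).
Proof. by move=> fE /star_line_route fl; apply/star_line_route; rewrite fE; exact: flattens_op. Qed.
End OpFold.

Lemma op_udaf (D : finDigraph) : is_udaf D -> is_udaf (op D).
Proof. by move=> /is_udafP br; apply/is_udafP => d; apply/branching_op. Qed.

(** Reversal acts on routes through representatives, so the reversed map is
    characterised on lines. *)
Lemma UDAFG'_op (A B : UDAF) (F : Route A -> Route B) : UDAFG' F ->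
  exists G : Route (op A) -> Route (op B), generated G /\
    forall x y, F (line_route x) = line_route y ->
      G (line_route (op_line x)) = line_route (op_line y).
Proof.
have rto (D : finDigraph) (x y : line D) :
    line_route x = line_route y -> line_route (op_line x) = line_route (op_line y).
  move=> e; apply: line_route_unop; rewrite !op_lineK; exact: e.
elim=> {A B F} [A|A B f ef|A B f G ef fG Gf|A B C F G uF [F' [gF FF]] uG [G' [gG GG]]].
- exists id; split; last exact: rto.
  by move=> PA PB; have -> : PA = PB; [exact: Prop_irrelevance|exact: UDAFG'_id].
- have [f' fE] := op_folding f; exists (star f'); split; last by move=> x y; exact: (star_op fE).
  exact: generated_elementary (elementary_op fE ef).
- have [f' fE] := op_folding f; have [G' fG' Gf'] := fold_bij f'.
  exists G'; split.
    move=> PA PB; have ef' := elementary_op fE ef.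
    exact: (@UDAFG'_star_inv (MkUDAF PB) (MkUDAF PA) f' G' ef' fG' Gf').
  move=> x y e; have : star f (line_route y) = line_route x by rewrite -e Gf.
  by move=> /(star_op fE) <-; rewrite [LHS]fG'.
- exists (G' \o F'); split; first exact: generated_comp (op_udaf (@udafP B)) gF gG.
  move=> x z /=; have [y e] := line_route_surj (F (line_route x)).
  by rewrite e => /GG <-; rewrite (FF x y).
Qed.

(** Reversing twice gives the original digraph, up to eta for records. *)
Lemma generated_op (A B : finDigraph) (f : folding A B) (f' : folding (op A) (op B)) :
  fold_hom f' = op_hom f -> generated (star f') -> generated (star f).
Proof.
move=> fE gf PA PB.
have [G [gG GG]] := UDAFG'_op (gf (op_udaf PA) (op_udaf PB)).
have fG x y : star f (line_route x) = line_route y ->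
    G (line_route (op_line (op_line x))) = line_route (op_line (op_line y)).
  by move=> /(star_op fE)/GG.
case: A B f f' fE gf PA PB G gG GG fG => [VA EA sA tA] [VB EB sB tB] f f' _ _ PA PB G gG _ fG.
have := gG PA PB; suff -> : star f = G by [].
have oo (V E : finType) (s t : E -> V) (x : line (FinDigraph s t)) : op_line (op_line x) = x.
  by apply: line_ext => k /=; congr (lfun x _); lia.
apply/funext => R; have [x ->] := line_route_surj R; have [y e] := line_route_surj (star f (line_route x)).
by rewrite e; have := fG x y e; rewrite !oo => <-.
Qed.

(** * Homomorphisms of digraphs as foldings *)

Definition letters (A C : digraph) (f : hom A C) : hom A (Walks C) := hom_comp (incl C) f.

Section Letters.
Variables (A C : finDigraph).
Implicit Type f : hom A C.

Lemma word_letters f a : word (letters f) a = [:: homE f a].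
Proof. exact: word_walk1. Qed.

Lemma lettersP f (phi : hom A (Walks C)) : (forall v, homV phi v = homV f v) ->
  (forall a, word phi a = [:: homE f a]) -> phi = letters f.
Proof.
move=> eV eE; apply: hom_ext => // a.
by apply: walk_ext_ne; rewrite -/(word phi a) -?/(word (letters f) a) ?word_letters eE.
Qed.

Lemma hom_line_image_subproof f (x : line A) k :
  tgt (homE f (x k)) = src (homE f (x (k + 1))).
Proof. by rewrite hom_src hom_tgt lineP. Qed.
Definition hom_image f x : line C := Line (hom_line_image_subproof f x).

Lemma flattens_letters f (x : line A) (y : line C) :
  flattens (word (letters f) \o x) y <-> exists t, forall k, y (k + t) = homE f (x k).
Proof.
split=> [[h al]|[t e]].
  exists (h 0) => k.
  have hS (z : int) : h (z + 1) = h z + 1%N%:Z by rewrite (al z).1 /= word_letters.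
  have := @telescope_const (fun=> 1%N) h id hS (fun z => erefl) k 0.
  have := (al k).2; rewrite /= word_letters => /reads1 <- hk.
  by congr (lfun y _); lia.
exists (fun z => z + t) => z; rewrite /= word_letters; split=> /=; first lia.
by apply/reads1.
Qed.

Lemma letters_folding f :
    (forall y : line C, exists x : line A, forall k, homE f (x k) = y k) ->
    (forall x x' : line A, (forall k, homE f (x k) = homE f (x' k)) -> x = x') ->
  exists F : folding A C, fold_hom F = letters f.
Proof.
move=> sj ij; apply: mkfold.
- by move=> x; apply: recurrent_pos => k /=; rewrite word_letters.
- move=> y; have [x e] := sj y; exists x; apply/flattens_letters.
  by exists 0 => k; rewrite addr0.
move=> x x' y /flattens_letters[t e] /flattens_letters[t' e'].
rewrite -(line_route_shift x (- t)) -(line_route_shift x' (- t')); congr line_route; apply: ij => k /=.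
by rewrite -e -e'; congr (lfun y _); lia.
Qed.
End Letters.

(** * Embeddings whose image contains every line *)

Record embedding (A C : finDigraph) (f : hom A C) : Prop := Embedding {
  embedding_V : injective (homV f : fvert A -> fvert C);
  embedding_E : injective (homE f : fedge A -> fedge C);
  embedding_lines : forall (y : line C) k, exists a, homE f a = y k }.

Lemma int_orbit (T : Type) (p s : T -> T) (t : T) :
  exists x : int -> T, x 0 = t /\ forall k : int, (0 <= k -> x (k + 1) = s (x k)) /\
    (k < 0 -> x k = p (x (k + 1))).
Proof.
exists (fun k : int => if 0 <= k then iter `|k|%N s t else iter `|k|%N p t); split=> // k; split=> k0.
  have k1 : 0 <= k + 1 by lia.
  by rewrite k0 k1; have -> : `|(k + 1)%R|%N = `|k|%N.+1 by lia.
have e : `|k|%N = `|(k + 1)%R|%N.+1 by lia.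
rewrite leNgt k0 /= e /=; congr p; case: ifP => // k1.
by have -> : `|(k + 1)%R|%N = 0%N by lia.
Qed.

Definition all_used (D : digraph) : Prop :=
  forall e : edge D, exists (x : line D) k, x k = e.

Lemma extendable_used (D : digraph) :
    (forall e : edge D, exists e' : edge D, tgt e = src e') ->
    (forall e : edge D, exists e' : edge D, tgt e' = src e) -> all_used D.
Proof.
move=> /choice[s sP] /choice[p pP] e.
have [x [x0 xP]] := int_orbit p s e.
have xL k : tgt (x k) = src (x (k + 1)).
  case: (ltP k 0) => k0; first by rewrite (xP k).2 ?pP.
  by rewrite (xP k).1 ?sP.
by exists (Line xL), 0.
Qed.

Section Embedding.
Variables (A C : finDigraph) (f : hom A C).
Hypothesis fP : embedding f.

Lemma embedding_preimage (y : line C) : exists x : line A, forall k, homE f (x k) = y k.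
Proof.
have /choice[x xP] := embedding_lines fP y.
have xL k : tgt (x k) = src (x (k + 1)).
  by apply: (embedding_V fP); rewrite -hom_src -hom_tgt !xP; exact: (lineP y k).
by exists (Line xL).
Qed.

Lemma embedding_line_inj (x x' : line A) : (forall k, homE f (x k) = homE f (x' k)) -> x = x'.
Proof. by move=> e; apply: line_ext => k; exact: (embedding_E fP). Qed.

Lemma embedding_folding : exists F : folding A C, fold_hom F = letters f.
Proof. exact: letters_folding embedding_preimage embedding_line_inj. Qed.

Lemma embedding_branching d : branching d A <-> branching d C.
Proof.
split=> br => [y|x].
  have [x xP] := embedding_preimage y; have [x' [[K e] [k ne]]] := br x.
  exists (hom_image f x'); split; first by exists K => j /e /= ->.
  by exists k; rewrite -xP /= => /(embedding_E fP).
have [y' [[K e] [k ne]]] := br (hom_image f x); have [x' xP] := embedding_preimage y'.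
exists x'; split; first by exists K => j /e; rewrite -xP => /(embedding_E fP).
by exists k => ek; apply: ne; rewrite -xP ek.
Qed.

Lemma embedding_udaf : is_udaf A <-> is_udaf C.
Proof. by split=> /is_udafP br; apply/is_udafP => d; apply/embedding_branching. Qed.
End Embedding.

Section AddVertex.
Variable D : finDigraph.

Definition add_vertex : finDigraph :=
  @FinDigraph (option (fvert D)) (fedge D) (fun e => Some (fsrc e)) (fun e => Some (ftgt e)).

Definition add_vertex_hom : hom D add_vertex :=
  @Hom D add_vertex Some id (fun=> erefl) (fun=> erefl).

Lemma add_vertex_emb : embedding add_vertex_hom.
Proof. by split=> [u v [] //| //|y k]; exists (y k). Qed.
End AddVertex.

Lemma add_vertex_generated (A C : finDigraph) (g : hom A (add_vertex C)) (F : folding A (add_vertex C)) :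
    fold_hom F = letters g -> injective (homE g : fedge A -> fedge C) ->
    (forall e, exists a, homE g a = e) -> injective (homV g : fvert A -> option (fvert C)) ->
    (forall u, (exists v, homV g v = u) <-> u <> None) ->
  generated (star F).
Proof.
move=> FE gE sE gV sV; apply: generated_elementary; apply: Or31; exists g, None; split=> //.
- apply/seteqP; split=> u /=; first by case=> v _ <-; apply/sV; exists v.
  by case/sV => v <-; exists v.
- by apply/seteqP; split=> e //= _; have [a <-] := sE e; exists a.
Qed.

(** Elementary foldings only add an isolated vertex. An isomorphism is obtained by
    adding one to the target in two ways, which differ by the isomorphism. *)
Lemma iso_generated (A C : finDigraph) (f : hom A C) (F : folding A C) :
    fold_hom F = letters f -> is_udaf A -> embedding f ->
    (forall e, exists a, homE f a = e) -> (forall u, exists v, homV f v = u) ->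
  generated (star F).
Proof.
move=> FE PA fP sE sV.
have PC : is_udaf C by apply/(embedding_udaf fP).
have [G GE] := embedding_folding (add_vertex_emb C).
have PC' : is_udaf (add_vertex C) by apply/(embedding_udaf (add_vertex_emb C)).
have gG : generated (star G).
  apply: (add_vertex_generated GE) => //; first by move=> e; exists e.
  move=> [u|]; split=> //; first by exists u.
  by case.
pose h : hom A (add_vertex C) := hom_comp (add_vertex_hom C) f.
have [H [vH wH sH]] := fold_comp F G.
apply: (generated_cancel_l PC' gG); rewrite -sH.
have HE : fold_hom H = letters h.
  by apply: lettersP => [v|a]; [rewrite vH FE GE|rewrite wH FE GE word_letters /= word_letters].
apply: (add_vertex_generated HE).
- exact: (embedding_E fP).
- exact: sE.
- by move=> u v [] /(embedding_V fP).
- move=> [u|]; split=> //; last by case.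
  by have [v <-] := sV u; exists v.
Qed.

(** The vertices of [C] outside the image of [f] are isolated, since all edges are
    in the image, and are added to [A] one by one. *)
Lemma vertices_generated (m : nat) (A C : finDigraph) (f : hom A C) (F : folding A C) :
    fold_hom F = letters f -> is_udaf A -> embedding f ->
    (forall e, exists a, homE f a = e) -> (#|fvert C| <= #|fvert A| + m)%N ->
  generated (star F).
Proof.
elim: m A f F => [|m IH] A f F FE PA fP sE cV;
  case: (pselect (forall u, exists v, homV f v = u)) => sV; try exact: iso_generated FE PA fP sE sV.
  case: sV => u; have : u \in codom (homV f : fvert A -> fvert C).
    by rewrite addn0 in cV; exact: (inj_card_onto (embedding_V fP) cV).
  by case/codomP => v ->; exists v.
have [u uP] : exists u, forall v, homV f v <> u.
  apply: contrapT => h; apply: sV => u; apply: contrapT => h1; apply: h; exists u => v e.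
  by apply: h1; exists v.
have [G GE] := embedding_folding (add_vertex_emb A).
have gG : generated (star G).
  apply: (add_vertex_generated GE) => //; first by move=> e; exists e.
  move=> [v|]; split=> //; first by exists v.
  by case.
(* the new vertex goes to the missing vertex [u] *)
pose f' : hom (add_vertex A) C := @Hom (add_vertex A) C
  (fun v : vert (add_vertex A) => if v is Some v then homV f v else u)
  (homE f) (hom_src f) (hom_tgt f).
have f'P : embedding f'.
  split; [|exact: (embedding_E fP)|exact: (embedding_lines fP)].
  move=> [v|] [w|] //=.
  - by move=> /(embedding_V fP) ->.
  - by move/uP.
  - by move/esym/uP.
have [F' [FE' sF]] : exists F' : folding (add_vertex A) C,
    fold_hom F' = letters f' /\ star F = star F' \o star G.
  by apply: fold_cancel_r => a; rewrite FE GE word_letters word_letters /= word_letters.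
have PA' : is_udaf (add_vertex A) by apply/(embedding_udaf (add_vertex_emb A)).
rewrite sF; apply: generated_comp => //.
apply: (IH _ f' F') => //.
by rewrite /= card_option addSnnS.
Qed.

Definition sink_edge (D : digraph) (e : edge D) : Prop := forall e' : edge D, tgt e <> src e'.

Definition embedding_generated (n : nat) : Prop :=
  forall (A C : finDigraph) (f : hom A C) (F : folding A C),
    fold_hom F = letters f -> is_udaf A -> embedding f -> all_used A ->
    (#|fedge C| <= n)%N -> generated (star F).

(** An edge into a vertex without outgoing edges has no prolongation, so cutting it
    just deletes it. *)
Lemma remove_sink_edge (n : nat) (A C : finDigraph) (f : hom A C) (F : folding A C)
    (e : edge C) :
    embedding_generated n ->
    fold_hom F = letters f -> is_udaf A -> embedding f -> all_used A ->
    (#|fedge C| <= n.+1)%N -> sink_edge e -> generated (star F).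
Proof.
move=> IH FE PA fP uA cC se.
have nl : src e <> tgt e by move=> h; apply: (se e).
have ne a : homE f a != e :> fedge C.
  apply/eqP => fa; have [x [k xk]] := uA a.
  by apply: (se (homE f (x (k + 1)))); rewrite -fa hom_tgt hom_src -lineP xk.
have nodetour (x : {x : fedge C | ftgt e == fsrc x}) : False.
  by case: x => x /eqP; exact: se.
pose g : hom A (cut e) := @Hom A (cut e) (homV f) (fun a => keep (ne a)) (hom_src f) (hom_tgt f).
have gP : embedding g.
  split; first exact: (embedding_V fP).
    by move=> a a' [] /(embedding_E fP).
  move=> y; pose u (c : edge (cut e)) : edge C := match c with inl x => sval x | inr _ => e end.
  have yL k : tgt (u (y k)) = src (u (y (k + 1))).
    by have := lineP y k; case: (y k) => [x|/nodetour//]; case: (y (k + 1)) => [x'|/nodetour//].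
  move=> k; have [a ea] := embedding_lines fP (Line yL) k; exists a.
  move: ea => /=; case: (y k) => [[x xP]|/nodetour//] /= ea.
  by congr inl; apply/val_inj.
have [G GE] := cut_folding nl.
have [F' [FE' sF]] : exists F' : folding A (cut e),
    fold_hom F' = letters g /\ star F = star G \o star F'.
  by apply: fold_cancel_l => a; rewrite FE GE !word_letters /= word_cut.
have PC' : is_udaf (cut e) by apply/(embedding_udaf gP).
rewrite sF; apply: generated_comp => //; last exact: (cut_generated nl GE).
apply: (IH _ _ g F') => //.
rewrite /= card_sum !card_sig (eq_card0 (A := [pred x | ftgt e == fsrc x])); last first.
  by move=> x; rewrite !inE; apply/eqP; exact: se.
rewrite addn0; move: cC; rewrite (cardD1 (e : fedge C)) inE /= add1n ltnS.
by apply: leq_trans; apply: subset_leq_card; apply/fintype.subsetP => x; rewrite !inE andbT.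
Qed.

Lemma used_op (A : finDigraph) : all_used A -> all_used (op A).
Proof.
move=> uA a; have [x [k xk]] := uA a; exists (op_line x), (- 1 - k) => /=.
by rewrite (_ : - 1 - (- 1 - k) = k) //; lia.
Qed.

(** Edges into sinks, and by reversal edges out of sources, are deleted from [C].
    When none is left, every edge of [C] lies on a line, hence in the image. *)
Lemma used_embedding_generated n : embedding_generated n.
Proof.
elim: n => [|n IH] A C f F FE PA fP uA cC.
  have C0 (e : edge C) : False.
    by move: cC; rewrite leqn0 => /eqP/card0_eq/(_ e); rewrite inE.
  by apply: (@vertices_generated #|fvert C| _ _ f) => //; exact: leq_addl.
case: (pselect (exists e : edge C, sink_edge e)) => [[e se]|nosink].
  exact: remove_sink_edge IH FE PA fP uA cC se.
case: (pselect (exists e : edge C, @sink_edge (op C) e)) => [[e se]|nosource].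
  have [F' FE'] := op_folding F.
  apply: (generated_op FE').
  pose f' : hom (op A) (op C) := @Hom (op A) (op C) (homV f) (homE f) (hom_tgt f) (hom_src f).
  have fP' : embedding f'.
    split; [exact: (embedding_V fP)|exact: (embedding_E fP)|move=> y k].
    by have [a ea] := embedding_lines fP (unop_line y) (- 1 - k); exists a; rewrite /= ea /=;
      congr (lfun y _); lia.
  have FE2 : fold_hom F' = letters f'.
    by apply: lettersP => [v|a]; rewrite FE' ?word_op FE // word_letters.
  exact: (@remove_sink_edge n (op A) (op C) f' F' e IH FE2 (op_udaf PA) fP' (used_op uA)).
have uC : all_used C.
  apply: extendable_used => e; apply: contrapT => h.
    by apply: nosink; exists e => e' h1; apply: h; exists e'.
  by apply: nosource; exists e => e' h1; apply: h; exists e'.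
apply: (@vertices_generated #|fvert C| _ _ f) => //; last exact: leq_addl.
by move=> e; have [y [k <-]] := uC e; exact: (embedding_lines fP).
Qed.

Section Essential.
Variable D : finDigraph.

Definition used_vert (v : fvert D) : bool := `[< exists (x : line D) k, src (x k) = v >].
Definition used_edge (e : fedge D) : bool := `[< exists (x : line D) k, x k = e >].

Lemma used_src (e : {e : fedge D | used_edge e}) : used_vert (fsrc (sval e)).
Proof. by case: e => e /= /asboolP[x [k <-]]; apply/asboolP; exists x, k. Qed.

Lemma used_tgt (e : {e : fedge D | used_edge e}) : used_vert (ftgt (sval e)).
Proof.
by case: e => e /= /asboolP[x [k <-]]; apply/asboolP; exists x, (k + 1); rewrite -lineP.
Qed.

Definition essential : finDigraph :=
  @FinDigraph {v : fvert D | used_vert v} {e : fedge D | used_edge e}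
  (fun e => exist (fun v => used_vert v) _ (used_src e))
  (fun e => exist (fun v => used_vert v) _ (used_tgt e)).

Definition essential_hom : hom essential D :=
  @Hom essential D sval sval (fun=> erefl) (fun=> erefl).

Lemma essential_emb : embedding essential_hom.
Proof.
split=> [u v /= e|u v /= e|y k]; [exact/val_inj|exact/val_inj|].
have P : used_edge (y k) by apply/asboolP; exists y, k.
by exists (exist (fun e => used_edge e) _ P).
Qed.

Lemma essential_used : all_used essential.
Proof.
move=> [e eP]; have /asboolP[x [k xk]] := eP.
have [y yP] := embedding_preimage essential_emb x; exists y, k.
by apply/val_inj; rewrite /= -xk; exact: yP.
Qed.
End Essential.

Lemma embedding_generated_all (A C : finDigraph) (f : hom A C) (F : folding A C) :
  fold_hom F = letters f -> is_udaf A -> embedding f -> generated (star F).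
Proof.
move=> FE PA fP; have [G GE] := embedding_folding (essential_emb A).
have PE : is_udaf (essential A) by apply/(embedding_udaf (essential_emb A)).
have gG : generated (star G).
  by apply: (used_embedding_generated GE); [|exact: essential_emb|exact: essential_used|].
apply: (generated_cancel_r PE gG).
have [H [vH wH <-]] := fold_comp G F.
pose h : hom (essential A) C := hom_comp f (essential_hom A).
have HE : fold_hom H = letters h.
  by apply: lettersP => [v|a]; [rewrite vH FE GE|rewrite wH FE GE word_letters /= word_letters].
apply: (used_embedding_generated HE) => //; last exact: essential_used.
split=> [u v /= /(embedding_V fP) e|u v /= /(embedding_E fP) e|y k]; [exact/val_inj|exact/val_inj|].
have [x xP] := embedding_preimage fP y; have [a aP] := embedding_lines (essential_emb A) x k.
by exists a; rewrite -xP -aP.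
Qed.

(** * Eliminating a set of edges *)

Lemma hom_walks_ext (A B : digraph) (f g : hom A (Walks B)) :
  (forall v, homV f v = homV g v) -> (forall a, word f a = word g a) -> f = g.
Proof.
move=> eV eE; apply: hom_ext => // a; apply: walk_ext => //; last exact: eE.
by have /= -> := hom_src f a; have /= -> := hom_src g a.
Qed.

Lemma chain_catP (D : digraph) (v : vert D) s1 s2 : chain v (s1 ++ s2) ->
  chain v s1 /\ chain (last v [seq tgt a | a <- s1]) s2.
Proof. by elim: s1 v => [|a s1 IH] v //= [<- /IH[c1 c2]]. Qed.

(** Nonempty words and injectivity on vertices make composability of edges visible
    in the image. *)
Lemma chain_reflect (A B : digraph) (f : hom A (Walks B)) (v : vert A) (s : seq (edge A)) :
    injective (homV f) -> (forall a, word f a <> [::]) ->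
    @chain B (homV f v) (flatten (map (word f) s)) ->
  chain v s /\ homV f (last v [seq tgt a | a <- s]) =
    last (homV f v : vert B) [seq tgt b | b <- flatten (map (word f) s)].
Proof.
move=> fI ne c; suff cs : chain v s by split=> //; rewrite (ext_edges_chain f cs).2.
elim: s v c => [|a s IH] v //= /chain_catP[c1 c2].
have [c3 l3] := word_chain f a.
have e : src a = v.
  by apply: fI; case: (word f a) (ne a) c1 c3 => // b w _ [<- _] [<- _].
by split=> //; apply: IH; rewrite -l3 e.
Qed.

Lemma cut_decode (D : finDigraph) (e : edge D) :
  injective (fun s : seq (edge (cut e)) => flatten (map (@cut_word D e) s)).
Proof.
elim=> [|[[x xP]|[x xP]] s IH] [|[[x' xP']|[x' xP']] s'] //=.
- by move=> [ex /IH ->]; congr (inl _ :: _); apply/val_inj.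
- by move=> [ex _]; case/eqP: (xP).
- by move=> [ex _]; case/eqP: (xP').
by move=> [ex /IH ->]; congr (inr _ :: _); apply/val_inj.
Qed.

(** The last condition is a local form of surjectivity: an edge of a line of [M]
    outside [S], together with the preceding edge if that one is in [S], is a word
    of [f]. Since no two edges of [S] follow each other, these words tile the line. *)
Record elimination (N M : finDigraph) (S : fedge M -> bool) (f : hom N (Walks M)) : Prop :=
  Elimination {
    elim_S : forall e e' : edge M, S e -> S e' -> tgt e <> src e';
    elim_V : injective (homV f : fvert N -> fvert M);
    elim_E : injective (word f);
    elim_words : forall n, (exists2 x, ~~ S x & word f n = [:: x]) \/
                           (exists e x, S e /\ word f n = [:: e; x]);
    elim_lines : forall (y : line M) k, ~~ S (y k) ->
      exists n, word f n = if S (y (k - 1)) then [:: y (k - 1); y k] else [:: y k] }.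

Section ElimStep.
Variables (N M : finDigraph) (S : fedge M -> bool) (f : hom N (Walks M)).
Hypothesis fP : elimination S f.
Variable e : edge M.
Hypothesis Se : S e.

Definition cut_pred (a : fedge (cut e)) : bool :=
  match a with inl x => S (sval x) | inr _ => false end.

Lemma cut_pred_card n : (#|[pred x | S x]| <= n.+1)%N -> (#|[pred a | cut_pred a]| <= n)%N.
Proof.
rewrite (cardD1 (e : fedge M)) inE Se add1n ltnS; apply: leq_trans.
pose p (a : fedge (cut e)) : fedge M := match a with inl x => sval x | inr _ => e end.
rewrite -(card_in_image (f := p)).
  apply: subset_leq_card; apply/fintype.subsetP => x xi.
  have /fintype.imageP[[a|a]] := xi; rewrite inE //= => Sa ->.
  by rewrite !inE Sa (svalP a).
by move=> [a|a] [b|b]; rewrite !inE //= => _ _ ab; congr inl; apply/val_inj.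
Qed.

(** Cutting an edge of [S] turns the two-letter words that start with it into single
    letters, and leaves the conditions true for the rest of [S]. *)
Lemma cut_elim : exists f1 : hom N (Walks (cut e)), [/\ elimination cut_pred f1,
  forall v, homV f1 v = homV f v &
  forall n, word f n = flatten (map (@cut_word M e) (word f1 n))].
Proof.
have nl : @src M e <> @tgt M e by move=> h; exact: (elim_S fP Se Se (esym h)).
have neS x : ~~ S x -> x != e by move=> Sx; apply: contraNneq Sx => ->.
have /choice[w wP] : forall n, exists w : seq (edge (cut e)),
    word f n = flatten (map (@cut_word M e) w) /\
    ((exists2 x, ~~ cut_pred x & w = [:: x]) \/
     (exists a x, cut_pred a /\ w = [:: a; x])).
  move=> n; case: (elim_words fP n) => [[x Sx wx]|[a [x [Sa wx]]]].
    by exists [:: keep (neS x Sx)]; split=> //; left; exists (keep (neS x Sx)).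
  have ax : @tgt M a = @src M x by have := (word_chain f n).1; rewrite wx /= => -[_ []].
  have Sx : ~~ S x by apply/negP => Sx; exact: (elim_S fP Sa Sx ax).
  case: (eqVneq a e) => ae.
    have P : ftgt e == fsrc x by rewrite -ae; apply/eqP.
    by exists [:: detour P]; rewrite wx ae; split=> //; left; exists (detour P).
  by exists [:: keep ae; keep (neS x Sx)]; rewrite wx; split=> //; right; exists (keep ae), (keep (neS x Sx)).
have wc n : @chain (cut e) (homV f (src n)) (w n) /\
    last (homV f (src n) : vert (cut e)) [seq tgt a | a <- w n] = homV f (tgt n).
  have [c l] := word_chain f n; rewrite (wP n).1 in c l.
  have cw : word (cut_hom e) = @cut_word M e by apply/funext => a; exact: word_cut.
  have := @chain_reflect (cut e) M (cut_hom e) (homV f (src n)) (w n).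
  rewrite cw => -[//| |//|c' l']; first by case.
  by split=> //; rewrite -l -l'.
pose f1 : hom N (Walks (cut e)) := @mkhom N (cut e) (homV f) w wc.
have w1 n : word f1 n = w n by exact: word_mkhom.
exists f1; split=> //; last by move=> n; rewrite w1; exact: (wP n).1.
have parse n s : word f n = flatten (map (@cut_word M e) s) -> word f1 n = s.
  by move=> ws; apply: (@cut_decode M e); rewrite w1 -ws (wP n).1.
split.
- by move=> [[a aP]|//] [[b bP]|//] /=; exact: (elim_S fP).
- exact: (elim_V fP).
- by move=> n n'; rewrite !w1 => ww; apply: (elim_E fP); rewrite (wP n).1 (wP n').1 ww.
- by move=> n; rewrite w1; exact: (wP n).2.
move=> y1 k; have [y [h [al _]]] : exists (y : line M) h,
    aligned (@cut_word M e \o y1) y h /\ h 0 = 0.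
  have nd : nondeg (cut_hom e) by move=> z; rewrite cut_homE; exact: cut_recurrent.
  by have := image_line nd y1 0 0; rewrite cut_homE.
have := (al k).2; have lk := lineP y1 (k - 1).
have := al (k - 1); rewrite /= (_ : k - 1 + 1 = k) in lk *; last lia.
case: (y1 k) lk => [[x xP]|[x xP]] /=; last first.
  case: (y1 (k - 1)) => [[x' xP']|[x' xP']] /= lk _ /reads2[ye yx] _;
    have [|n] := elim_lines fP (y := y) (k := h k + 1).
  - by rewrite yx; apply/negP => /(elim_S fP Se); apply; apply/eqP.
  - rewrite (_ : h k + 1 - 1 = h k) ?ye ?yx ?Se => [wn|]; last lia.
    exists n; rewrite ifF; first exact: parse.
    by apply/negP => /(elim_S fP) /(_ Se); apply.
  - by rewrite yx; apply/negP => /(elim_S fP Se); apply; apply/eqP.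
  - rewrite (_ : h k + 1 - 1 = h k) ?ye ?yx ?Se => [wn|]; last lia.
    by exists n; exact: parse.
case: (y1 (k - 1)) => [[x' xP']|[x' xP']] /= lk [hk rk] /reads1 yx Sx;
  have [|n] := elim_lines fP (y := y) (k := h k); rewrite ?yx //.
  move: rk => /reads1; rewrite (_ : h (k - 1) = h k - 1) ?hk => [->|]; last lia.
  by move=> wn; exists n; move: wn; case: ifP => _ wn; exact: parse.
move: rk => /reads2[_]; rewrite (_ : h (k - 1) + 1 = h k - 1) ?hk => [->|]; last lia.
have -> : S x' = false by apply/negP => /(elim_S fP Se); apply; apply/eqP.
by move=> wn; exists n; exact: parse.
Qed.
End ElimStep.

Lemma elimination_none (N M : finDigraph) (S : fedge M -> bool) (f : hom N (Walks M)) :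
    elimination S f -> (forall e, S e = false) ->
  exists g : hom N M, f = letters g /\ embedding g.
Proof.
move=> fP noS.
have /choice[g gP] : forall a, exists x, word f a = [:: x].
  by move=> a; case: (elim_words fP a) => [[x _ ?]|[e [x []]]]; [exists x|rewrite noS].
have gs a : src (g a) = homV f (src a).
  by have := (word_chain f a).1; rewrite gP => -[].
have gt a : tgt (g a) = homV f (tgt a).
  by have := (word_chain f a).2; rewrite gP.
exists (@Hom N M (homV f) g gs gt); split; first exact: lettersP.
split; first exact: (elim_V fP).
  by move=> a b /= ab; apply: (elim_E fP); rewrite !gP ab.
by move=> y k; have [|a] := elim_lines fP (y := y) (k := k); rewrite ?noS // gP => -[<-]; exists a.
Qed.

(** Once [S] is exhausted all words are letters and [f] is an embedding containing
    all lines. *)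
Theorem elimination_folding (N M : finDigraph) (S : fedge M -> bool) (f : hom N (Walks M)) :
    elimination S f ->
  exists F : folding N M, [/\ fold_hom F = f, is_udaf N <-> is_udaf M &
    is_udaf N -> generated (star F)].
Proof.
have base (M' : finDigraph) (S' : fedge M' -> bool) (f' : hom N (Walks M')) :
    elimination S' f' -> (forall e, S' e = false) ->
    exists F : folding N M', [/\ fold_hom F = f', is_udaf N <-> is_udaf M' &
      is_udaf N -> generated (star F)].
  move=> fP /(elimination_none fP)[g [-> gE]].
  have [F FE] := embedding_folding gE; exists F; split=> //; first exact: embedding_udaf gE.
  by move=> PN; exact: embedding_generated_all FE PN gE.
have [n Sn] : exists n, (#|[pred x | S x]| <= n)%N by exists #|[pred x | S x]|.
elim: n M S f Sn => [|n IH] M S f Sn fP.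
  apply: base fP _ => e; apply/negP => Se.
  by move: Sn; rewrite leqn0 => /eqP/card0_eq/(_ e); rewrite inE Se.
case: (pselect (exists e, S e)) => [[e Se]|S0]; last first.
  by apply: base fP _ => e; apply/negP => Se; apply: S0; exists e.
have [f1 [f1P f1V f1W]] := cut_elim fP Se.
have [F1 [F1E uF1 gF1]] := IH _ _ _ (cut_pred_card Se Sn) f1P.
have nl : @src M e <> @tgt M e by move=> h; exact: (elim_S fP Se Se (esym h)).
have [G GE] := cut_folding nl; have [F [vF wF sF]] := fold_comp F1 G.
exists F; split.
- apply: hom_walks_ext => [v|a]; first by rewrite vF GE F1E; exact: f1V.
  rewrite wF f1W F1E; congr (flatten (map _ _)).
  by rewrite GE; apply/funext => b; exact: word_cut.
- by rewrite uF1; exact: (cut_udaf nl).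
move=> PN; rewrite sF; apply: generated_comp (cut_generated nl GE); last exact: gF1.
by apply/uF1.
Qed.

(** * Out-splitting *)

Section OutSplit.
Variables (G : finDigraph) (L : finType) (lam : fedge G -> L).

(** Vertices are split according to the label of the next edge. A vertex whose
    label does not occur on an outgoing edge is a harmless sink. *)
Definition out_split : finDigraph := @FinDigraph (fvert G * L)%type (fedge G * L)%type
  (fun a => (fsrc a.1, lam a.1)) (fun a => (ftgt a.1, a.2)).

Definition out_split_hom : hom out_split G :=
  @Hom out_split G fst fst (fun=> erefl) (fun=> erefl).

Lemma out_split_next (x : line out_split) k : (x k).2 = lam (x (k + 1)).1.
Proof. by have := lineP x k => -[]. Qed.

Lemma out_split_lift (x : line G) :
  exists x' : line out_split, forall k, x' k = (x k, lam (x (k + 1))).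
Proof.
have xL k : @tgt out_split (x k, lam (x (k + 1))) =
    @src out_split (x (k + 1), lam (x (k + 1 + 1))).
  by have /= := lineP x k => /= ->.
by exists (@Line out_split (fun k => (x k, lam (x (k + 1)))) xL).
Qed.

Lemma out_split_inj (x x' : line out_split) : (forall k, (x k).1 = (x' k).1) -> x = x'.
Proof.
move=> e; apply: line_ext => k.
by rewrite [LHS]surjective_pairing [RHS]surjective_pairing !out_split_next !e.
Qed.

Lemma out_split_folding : exists O : folding out_split G, fold_hom O = letters out_split_hom.
Proof.
apply: letters_folding => [y|x x' e]; last exact: out_split_inj.
by have [x xE] := out_split_lift y; exists x => k; rewrite xE.
Qed.

(** An edge of [G] is preceded by the choice of its label. Contracting the choices
    into the following edge gives back [G], and contracting the edges of [G] into the
    following choice gives the out-splitting. *)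
Definition bipartite : finDigraph :=
  @FinDigraph (fvert G + fvert G * L)%type (fvert G * L + fedge G)%type
    (fun a => match a with inl u => inl u.1 | inr x => inr (fsrc x, lam x) end)
    (fun a => match a with inl u => inr u | inr x => inl (ftgt x) end).

Definition base_word (x : edge G) : seq (edge bipartite) := [:: inl (fsrc x, lam x); inr x].

Lemma base_wordP (x : edge G) : @chain bipartite (inl (fsrc x)) (base_word x) /\
  last (inl (fsrc x)) [seq @tgt bipartite a | a <- base_word x] = inl (ftgt x).
Proof. by []. Qed.

Definition base_hom : hom G (Walks bipartite) := @mkhom G bipartite inl base_word base_wordP.

Definition split_word (a : edge out_split) : seq (edge bipartite) :=
  [:: inr a.1; inl (ftgt a.1, a.2)].

Lemma split_wordP (a : edge out_split) :
  @chain bipartite (inr (fsrc a.1, lam a.1)) (split_word a) /\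
  last (inr (fsrc a.1, lam a.1)) [seq @tgt bipartite b | b <- split_word a] = inr (ftgt a.1, a.2).
Proof. by []. Qed.

Definition split_hom : hom out_split (Walks bipartite) :=
  @mkhom out_split bipartite inr split_word split_wordP.

Lemma base_elim :
  elimination (fun a : fedge bipartite => if a is inl _ then true else false) base_hom.
Proof.
split.
- by move=> [u|x] [u'|x'].
- by move=> u v [].
- by move=> x x'; rewrite !word_mkhom => -[].
- by move=> x; rewrite word_mkhom; right; exists (inl (fsrc x, lam x)), (inr x).
move=> y k; have := lineP y (k - 1); rewrite (_ : k - 1 + 1 = k); last lia.
case: (y k) => [//|x]; case: (y (k - 1)) => [u|//] /= [->] _.
by exists x; rewrite word_mkhom.
Qed.

Lemma split_elim :
  elimination (fun a : fedge bipartite => if a is inl _ then false else true) split_hom.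
Proof.
split.
- by move=> [u|x] [u'|x'].
- by move=> u v [].
- by move=> [x l] [x' l']; rewrite !word_mkhom => -[-> _ ->].
- move=> x; rewrite word_mkhom; right; by exists (inr x.1), (inl (ftgt x.1, x.2)).
move=> y k; have := lineP y (k - 1); rewrite (_ : k - 1 + 1 = k); last lia.
case: (y k) => [[g l]|//]; case: (y (k - 1)) => [//|x] /= [<-] _.
by exists (x, l); rewrite word_mkhom.
Qed.

Lemma out_split_udaf : is_udaf out_split <-> is_udaf G.
Proof.
have [A [_ uA _]] := elimination_folding base_elim.
have [B [_ uB _]] := elimination_folding split_elim.
by rewrite uA uB.
Qed.

(** Both images of a line in the bipartite digraph alternate the same choices and
    edges; they differ only by starting one step apart. *)
Lemma out_split_generated (O : folding out_split G) : fold_hom O = letters out_split_hom ->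
  is_udaf G -> generated (star O).
Proof.
move=> OE PG.
have [A [AE uA gA]] := elimination_folding base_elim.
have [B [BE uB gB]] := elimination_folding split_elim.
have PO : is_udaf out_split by apply/out_split_udaf.
apply: (generated_cancel_l (proj1 uA PG) (gA PG)).
suff <- : star B = star A \o star O by exact: gB.
apply/funext => R; have [x ->] := line_route_surj R.
have [y [h [al _]]] := image_line (@fold_nondeg _ _ A) (hom_image out_split_hom x) 0 0.
rewrite /=; have -> : star O (line_route x) = line_route (hom_image out_split_hom x).
  by apply/star_line_route; rewrite OE; apply/flattens_letters; exists 0 => k; rewrite addr0.
have -> : star A (line_route (hom_image out_split_hom x)) = line_route y by apply/star_line_route; exists h.
apply/star_line_route; exists (fun k => h k + 1) => k.
have [hS rk] := al k; have [_ rk1] := al (k + 1).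
rewrite /= AE word_mkhom /= in hS rk; rewrite hS /= AE word_mkhom in rk1; have [_ y2] := proj1 (reads2 _ _ _ _) rk.
have [y1 _] := proj1 (reads2 _ _ _ _) rk1.
rewrite /= BE word_mkhom /= hS; split; first lia.
apply/reads2; split=> //; rewrite out_split_next.
have := lineP x k => -[-> _]; rewrite -y1; congr (lfun y _); lia.
Qed.
End OutSplit.

(** * Homomorphisms that are bijective on routes are injective on lines *)

Definition periodic T (n : int) (w : int -> T) : Prop := forall k, w (k + n) = w k.

Lemma periodic_mul T n (w : int -> T) m : periodic n w -> periodic (n * m) w.
Proof.
move=> pw; have pos (i : nat) k : w (k + n * i%:Z) = w k.
  elim: i k => [|i IH] k; first by rewrite mulr0 addr0.
  by rewrite -[RHS]IH -[RHS]pw; congr w; lia.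
move=> k; case: (leP 0 m) => m0.
  by rewrite -(pos `|m|%N k); congr w; congr (_ + _ * _); lia.
rewrite -(pos `|m|%N (k + n * m)); congr w; rewrite -addrA -mulrDr.
by rewrite (_ : m + _ = 0) ?mulr0 ?addr0 //; lia.
Qed.

Lemma periodic_mod T n (w : int -> T) k i : periodic n w ->
  w (i + ((k - i) %% n)%Z) = w k.
Proof.
move=> /(periodic_mul ((k - i) %/ n)%Z) <-; congr w.
by have := divz_eq (k - i) n; lia.
Qed.

Lemma periodic_shift T n (w : int -> T) t : periodic n w -> periodic n (fun k => w (k + t)).
Proof. by move=> pw k; rewrite -[RHS]pw; congr w; lia. Qed.

Lemma periodic_eq_ge T n m (w w' : int -> T) K : 0 < n -> 0 < m -> periodic n w -> periodic m w' ->
  (forall k, K <= k -> w k = w' k) -> forall k, w k = w' k.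
Proof.
move=> n0 m0 pw pw' e k.
have q0 := periodic_mul (m * (`|K - k|%N)%:Z) pw k.
have q1 := periodic_mul (n * (`|K - k|%N)%:Z) pw' k.
rewrite -q0 -q1 e; first by congr w'; lia.
have : (`|K - k|%N)%:Z <= n * (m * (`|K - k|%N)%:Z).
  by rewrite mulrA ler_peMl //; nia.
lia.
Qed.

Section LineInjective.
Variables (A C : finDigraph) (f : hom A C).
Hypothesis route_inj : forall x x' : line A,
  (exists t, forall k, homE f (x (k + t)) = homE f (x' k)) -> exists s, forall k, x' k = x (k + s).
Hypothesis line_surj : forall y : line C, exists x : line A, forall k, homE f (x k) = y k.
Hypothesis branch : forall d, branching d A.

(** While the image of [z] follows a periodic sequence [w], the vertex of [z] recurs
    in the same phase, which closes up to a periodic line with image [w]. *)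
Lemma periodic_window (z : line A) (w : int -> edge C) (n a : int) :
    0 < n -> periodic n w ->
    (forall j, a <= j < a + n * #|fvert A|%:Z -> homE f (z j) = w j) ->
  exists (i1 i2 : int) (c : line A),
    [/\ a <= i1 /\ i1 + n <= i2, i2 <= a + n * #|fvert A|%:Z,
      (exists m, periodic m c /\ 0 < m), (forall k, homE f (c k) = w k) &
      (forall j, i1 <= j < i2 -> c j = z j)].
Proof.
move=> n0 pw zw.
have [i [j [/andP[ij jV] e]]] := pigeonhole (fun i : nat => fsrc (z (a + n * i%:Z))).
pose i1 := a + n * i%:Z; pose m := n * (j - i)%N%:Z.
have m0 : 0 < m by rewrite /m; nia.
have e' : src (z i1) = src (z (i1 + m)).
  rewrite /= /i1 e; congr (fsrc (lfun z _)); rewrite -addrA -mulrDr; congr (_ + _ * _); lia.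
have nm : n <= m by rewrite /m; nia.
have mV : i1 + m <= a + n * #|fvert A|%:Z by rewrite /i1 /m; nia.
have ai : a <= i1 by rewrite /i1; nia.
exists i1, (i1 + m), (loop_line m0 e'); split=> //; first by split=> //; lia.
- exists m; split=> // k /=; congr (lfun z (i1 + _)).
  by rewrite (_ : k + m - i1 = (k - i1) + m) ?modzDr //; lia.
- move=> k /=.
  have r0 := modz_ge0 (k - i1) (lt0r_neq0 m0); have r1 := ltz_pmod (k - i1) m0.
  rewrite zw; last lia.
  by apply: periodic_mod; exact: periodic_mul.
by move=> k k1 /=; congr (lfun z _); rewrite modz_small; lia.
Qed.

(** Some periodic line has the same image, hence the same route, as [x]. *)
Lemma periodic_of_shift (x : line A) t : t != 0 ->
  periodic t (fun k => homE f (x k)) -> exists2 n, 0 < n & periodic n x.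
Proof.
move=> t0 pt.
have pt' : periodic `|t|%N%:Z (fun k => homE f (x k)).
  have := periodic_mul (sgz t) pt; congr periodic; lia.
have t1 : 0 < `|t|%N%:Z by lia.
have := @periodic_window x _ _ 0 t1 pt' (fun _ _ => erefl).
move=> [_ [_ [c [_ _ [m [pc m0]] fc _]]]].
exists m => //; have [|s sP] := route_inj (x := c) (x' := x).
  by exists 0 => k; rewrite addr0 fc.
by move=> k; rewrite !sP -(periodic_shift s pc k).
Qed.

(** If the image of [y] were periodic then so would be [y], which agrees on a
    half-line with the periodic line [x] and would then be equal to it. *)
Lemma branch_aperiodic (x y : line A) n t : 0 < n -> periodic n x ->
    (exists k, y k <> x k) ->
    (exists d, forall k, beyond d 0 k -> y k = x k) ->
  periodic t (fun k => homE f (y k)) -> t = 0.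
Proof.
move=> n0 px [k ne] [d e] pt; apply/eqP; apply: contrapT => /negP t0; apply: ne.
have [m m0 py] := periodic_of_shift t0 pt.
case: d e => e; last by move: k; apply: (periodic_eq_ge m0 n0 py px (K := 0)).
have := @periodic_eq_ge _ m n (fun k => y (- 1 - k)) (fun k => x (- 1 - k)) 0 m0 n0.
have neg (z : line A) l : periodic l z -> periodic l (fun k => z (- 1 - k)).
  by move=> pz i; rewrite -[LHS]pz; congr (lfun z _); lia.
move=> /(_ (neg _ _ py) (neg _ _ px)) h.
have := h _ (- 1 - k); rewrite (_ : - 1 - (- 1 - k) = k); last lia.
by apply=> i i0; apply: e; rewrite /beyond; lia.
Qed.

(** Shifting by a multiple of the period moves the branching point to the origin. *)
Lemma branch_at (d : bool) (x : line A) n : 0 < n -> periodic n x ->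
  exists y : line A, (exists k, y k <> x k) /\ forall k, beyond d 0 k -> y k = x k.
Proof.
move=> n0 px; have [y [[K yK] [k ne]]] := branch d x.
pose s := n * (if d then - (`|K|%N)%:Z else (`|K|%N)%:Z).
have ps : periodic s x := periodic_mul _ px.
exists (shift y s); split.
  by exists (k - s); rewrite /= subrK -(ps (k - s)) subrK.
move=> j jb /=; rewrite -[RHS]ps; apply: yK.
have h : (`|K|%N)%:Z <= n * (`|K|%N)%:Z by nia.
by move: jb; rewrite /beyond /s; case: (d); rewrite ?mulrN; lia.
Qed.

(** Otherwise some periodic [x] has an image of smaller period, so that [t] is a
    period of the image but not of [x]. Let [r] be asymptotic to [x] on the right
    and [s] on the left. The image of [r] up to [K], followed by the image of [s]
    shifted by [K], is a line, where [K] is large and [x (j - K) = x (j + t)]. Its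
    preimage [z] closes up to a periodic line [c] in between. The left part of [z]
    followed by [c] has the image of [r], and [c] followed by the right part of [z]
    has the image of the shifted [s]; as these images are aperiodic, [c] agrees
    with [x] on one side and with the shift of [x] by [t] on the other. *)
Lemma line_injective (x x' : line A) : (forall k, homE f (x k) = homE f (x' k)) -> x = x'.
Proof.
move=> e; have [|t xt] := route_inj (x := x) (x' := x').
  by exists 0 => k; rewrite addr0.
have pt : periodic t (fun k => homE f (x k)) by move=> k; rewrite -xt e.
case: (eqVneq t 0) => t0.
  by apply: line_ext => k; rewrite xt t0 addr0.
suff pxt : periodic t x by apply: line_ext => k; rewrite xt pxt.
have [n n0 px] := periodic_of_shift t0 pt.
have [r [rne rx]] := branch_at false n0 px.
have [s [sne sx]] := branch_at true n0 px.
have ar q := @branch_aperiodic x r n q n0 px rne (ex_intro _ false rx).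
have as_ q := @branch_aperiodic x s n q n0 px sne (ex_intro _ true sx).
have {}rx k : 0 <= k -> r k = x k by exact: rx.
have {}sx k : k < 0 -> s k = x k by exact: sx.
pose V := #|fvert A|%:Z.
have V0 : 0 <= V by rewrite /V.
(* a multiple of the period minus [t], leaving room for [periodic_window] *)
pose q := V + (`|t|%N)%:Z + 1; pose K := n * q - t.
have KV : n * V <= K by rewrite /K /q; nia.
have K0 : 0 < K by rewrite /K /q; nia.
have xK j : x (j - K) = x (j + t).
  by rewrite -(periodic_mul q px (j - K)); congr (lfun x _); rewrite /K; lia.
have fxK j : homE f (x (j - K)) = homE f (x j) by rewrite xK pt.
pose R := hom_image f r; pose S := shift (hom_image f s) (- K).
have RE j : 0 <= j -> R j = homE f (x j) by move=> j0 /=; rewrite rx.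
have SE j : j < K -> S j = homE f (x j).
  by move=> jK; rewrite /= sx; [exact: fxK|lia].
(* both are the target of the edge of the image of [x] at [K - 1] *)
have RS : src (R K) = src (S K).
  have -> : K = K - 1 + 1 by lia.
  by rewrite -!lineP RE ?SE //; lia.
have [z zE] := line_surj (glue RS).
have [|i1 [i2 [c [[i10 ni] i2V [m [pc m0]] fc cz]]]] :=
    @periodic_window z (fun k => homE f (x k)) n 0 n0 (fun k => congr1 (homE f) (px k)).
  by move=> j; rewrite add0r => /andP[j0 jV]; rewrite zE /= ifT; [exact: RE|lia].
rewrite add0r -/V in i2V.
have zR j : j < i2 -> homE f (z j) = R j by move=> ji; rewrite zE /= ifT //; lia.
have zS j : 0 <= j -> homE f (z j) = S j.
  by move=> j0; rewrite zE /=; case: ltP => // jK; have /= -> := SE j jK; rewrite rx.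
have ic : src (z i1) = src (c i1) by rewrite cz //; lia.
have ci : src (c i2) = src (z i2).
  have -> : i2 = i2 - 1 + 1 by lia.
  by rewrite -!lineP cz //; lia.
have zr k : i1 <= k -> c k = r k.
  move=> ik; have eq j : homE f (glue ic j) = homE f (r j).
    rewrite /=; case: ltP => ji; first by rewrite zR //; lia.
    by rewrite fc rx //=; lia.
  have [|u uE] := route_inj (x := r) (x' := glue ic).
    by exists 0 => j; rewrite addr0 eq.
  have u0 : u = 0 by apply: ar => j; rewrite -uE eq.
  by have := uE k; rewrite u0 addr0 /= ltNge ik.
have zs k : k < i2 -> c k = s (k - K).
  move=> ik; have eq j : homE f (glue ci j) = S j.
    rewrite /=; case: ltP => ji; last by rewrite zS //; lia.
    by rewrite fc; apply/esym/SE; lia.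
  have [|u uE] := route_inj (x := shift s (- K)) (x' := glue ci).
    by exists 0 => j; rewrite addr0 eq.
  have u0 : u = 0.
    apply: as_ => j; have e1 : j + K + u - K = j + u by lia.
    have e2 : j + K - K = j by lia.
    by have := eq (j + K); rewrite uE /= e1 e2.
  by have := uE k; rewrite u0 addr0 /= ik.
have win j : i1 <= j < i2 -> x (j + t) = x j.
  move=> /andP[j1 j2]; rewrite -xK -[LHS]sx; last lia.
  by rewrite -zs // zr // rx //=; lia.
move=> k; have r0 := modz_ge0 (k - i1) (lt0r_neq0 n0); have r1 := ltz_pmod (k - i1) n0.
rewrite -(periodic_mod k i1 px) -(periodic_mod k i1 (periodic_shift t px)).
by apply: win; lia.
Qed.
End LineInjective.

(** * Shrinking the window of a homomorphism *)

Definition line_inj (A C : finDigraph) (f : hom A C) : Prop :=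
  forall x x' : line A, (forall k, homE f (x k) = homE f (x' k)) -> x = x'.

(** The window only has to separate vertices with the same image, so that an empty
    window means injectivity on the vertices that lie on lines. *)
Definition window (p q : nat) (A C : finDigraph) (f : hom A C) : Prop :=
  forall x x' : line A, homV f (src (x 0)) = homV f (src (x' 0)) ->
    (forall j : int, - p%:Z <= j < q%:Z -> homE f (x j) = homE f (x' j)) ->
  src (x 0) = src (x' 0).

Section Window.
Variables (A C : finDigraph) (f : hom A C).

(** Two lines with the same image on a long window pass twice through the same pair
    of vertices on either side of the origin. Running round these cycles gives two
    lines with the same image everywhere. *)
Lemma window_exists : line_inj f -> exists p q, window p q f.
Proof.
move=> fI; pose n := #|{: fvert A * fvert A}|; exists n, n => x x' _ e.
have [i1 [i2 [/andP[i12 i2n] [e12 e12']]]] :=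
  pigeonhole (fun i : nat => (fsrc (x i%:Z), fsrc (x' i%:Z))).
have [i3 [i4 [/andP[i34 i4n] [e34 e34']]]] :=
  pigeonhole (fun i : nat => (fsrc (x (- i%:Z)), fsrc (x' (- i%:Z)))).
rewrite -/n in i2n i4n.
pose g (j : int) : int :=
  if j < - i3%:Z then - i4%:Z + ((j - - i4%:Z) %% (i4 - i3)%N%:Z)%Z
  else if j < i1%:Z then j else i1%:Z + ((j - i1%:Z) %% (i2 - i1)%N%:Z)%Z.
have d0 : 0 < (i4 - i3)%N%:Z by lia.
have d1 : 0 < (i2 - i1)%N%:Z by lia.
(* [g] is the identity between [- i3] and [i1] and runs round a cycle on either side *)
have loop (y : line A) : src (y i1%:Z) = src (y i2%:Z) ->
    src (y (- i3%:Z)) = src (y (- i4%:Z)) -> exists y' : line A, forall j, y' j = y (g j).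
  move=> y12 y34.
  have s1 : src (y i1%:Z) = src (y (i1%:Z + (i2 - i1)%N%:Z)).
    by rewrite y12; congr (src (lfun y _)); lia.
  have s2 : src (y (- i4%:Z)) = src (y (- i4%:Z + (i4 - i3)%N%:Z)).
    by rewrite -y34; congr (src (lfun y _)); lia.
  have s3 : src (y i1%:Z) = src (loop_line d1 s1 i1%:Z) by rewrite /= subrr mod0z addr0.
  have s4 : src (loop_line d0 s2 (- i3%:Z)) = src (glue s3 (- i3%:Z)).
    have -> : glue s3 (- i3%:Z) = y (- i3%:Z).
      rewrite /=; case: ltP => // i13; rewrite (_ : - i3%:Z - i1%:Z = 0); last lia.
      by rewrite mod0z addr0; congr (lfun y _); lia.
    have -> : loop_line d0 s2 (- i3%:Z) = y (- i4%:Z); last by rewrite y34.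
    by rewrite /= (_ : - i3%:Z - - i4%:Z = (i4 - i3)%N%:Z) ?modzz ?addr0 //; lia.
  exists (glue s4) => j; rewrite /g /=; case: ifP => // _; by case: ifP.
have [y yE] := loop x e12 e34; have [y' yE'] := loop x' e12' e34'.
have g0 : g 0 = 0.
  rewrite /g; case: ltP => [|_]; first lia.
  case: ltP => // i0; rewrite (_ : 0 - i1%:Z = 0); last lia.
  by rewrite mod0z addr0; lia.
have yy : y = y'.
  apply: fI => j; rewrite yE yE'; apply: e; rewrite /g.
  have r1 := ltz_pmod (j - - i4%:Z) d0; have r2 := modz_ge0 (j - - i4%:Z) (lt0r_neq0 d0).
  have r3 := ltz_pmod (j - i1%:Z) d1; have r4 := modz_ge0 (j - i1%:Z) (lt0r_neq0 d1).
  by case: ltP => ?; [|case: ltP => ?]; lia.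
by rewrite -g0 -yE yy yE'.
Qed.
End Window.

Definition window_generated (p q : nat) : Prop :=
  forall (A C : finDigraph) (f : hom A C) (F : folding A C),
    fold_hom F = letters f -> is_udaf A -> is_udaf C -> line_inj f -> window p q f ->
  generated (star F).

Lemma letters_surj (A C : finDigraph) (f : hom A C) (F : folding A C) :
  fold_hom F = letters f -> forall y : line C, exists x : line A, forall k, homE f (x k) = y k.
Proof.
move=> FE y; have [x fl] := fold_surj F y; move: fl; rewrite FE => /flattens_letters[t e].
by exists (shift x (- t)) => k /=; rewrite -e subrK.
Qed.

(** With an empty window, used vertices with the same image are equal; parallel
    edges with the same image would give two lines with the same image. *)
Lemma window00 : window_generated 0 0.
Proof.
move=> A C f F FE PA PC fI W.
have [G GE] := embedding_folding (essential_emb A).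
have PE : is_udaf (essential A) by apply/(embedding_udaf (essential_emb A)).
apply: (generated_cancel_r PE (embedding_generated_all GE PE (essential_emb A))).
have [H [vH wH <-]] := fold_comp G F.
pose h : hom (essential A) C := hom_comp f (essential_hom A).
have HE : fold_hom H = letters h.
  by apply: lettersP => [v|a]; [rewrite vH FE GE|rewrite wH FE GE word_letters /= word_letters].
have WV (x x' : line A) k k' : homV f (src (x k)) = homV f (src (x' k')) ->
    src (x k) = src (x' k').
  have := W (shift x k) (shift x' k'); rewrite /= !add0r => w e; apply: w => // j; lia.
apply: (embedding_generated_all HE) => //; split.
- move=> [u uP] [v vP] /= e; apply/val_inj => /=.
  by move: uP vP e => /asboolP[x [k <-]] /asboolP[x' [k' <-]]; exact: WV.
- move=> [a aP] [b bP] /= e; apply/val_inj => /=.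
  move: aP bP e => /asboolP[x [k <-]] /asboolP[x' [k' <-]] e.
  have s : src (x k) = src (shift x' (k' - k) k).
    by rewrite /= (_ : k + (k' - k) = k'); [apply: WV; rewrite -!hom_src e|lia].
  have t : src (shift x' (k' - k) (k + 1)) = src (x (k + 1)).
    have -> : shift x' (k' - k) (k + 1) = x' (k' + 1) by rewrite /=; congr (lfun x' _); lia.
    by apply: WV; rewrite -!lineP -!hom_tgt e.
  have s' : src (x k) = src (glue t k) by rewrite /= ltrDl.
  have xg : x = glue s'.
    apply: fI => j /=; case: ltP => // kj; case: ltP => // jk.
    have -> : j = k by lia.
    by rewrite (_ : k + (k' - k) = k') //; lia.
  by rewrite xg /= ltxx ltrDl /= (_ : k + (k' - k) = k') //; lia.
move=> y k; have [x xE] := letters_surj FE y.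
have [a aE] := embedding_lines (essential_emb A) x k.
by exists a; rewrite -xE -aE.
Qed.

(** Splitting the vertices of [A] and [C] by the next letter of the image moves that
    letter from the window into the vertex. *)
Lemma window_step p q : window_generated p q -> window_generated p q.+1.
Proof.
move=> IH A C f F FE PA PC fI W.
pose A' := out_split (homE f : fedge A -> fedge C).
pose C' := out_split (id : fedge C -> fedge C).
have [OA OAE] := out_split_folding (homE f : fedge A -> fedge C).
have [OC OCE] := out_split_folding (id : fedge C -> fedge C).
have hs (a : edge A') : @src C' (homE f a.1, a.2) = (homV f (@src A' a).1, (@src A' a).2).
  by rewrite /=; have /= -> := hom_src f a.1.
have ht (a : edge A') : @tgt C' (homE f a.1, a.2) = (homV f (@tgt A' a).1, (@tgt A' a).2).
  by rewrite /=; have /= -> := hom_tgt f a.1.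
pose f' : hom A' C' := @Hom A' C' (fun v => (homV f v.1, v.2)) (fun a => (homE f a.1, a.2)) hs ht.
have [H [vH wH sH]] := fold_comp OA F.
have [F' [F'E sF]] : exists F' : folding A' C',
    fold_hom F' = letters f' /\ star H = star OC \o star F'.
  by apply: fold_cancel_l => a; rewrite wH FE OAE OCE !word_letters /= !word_letters.
have PA' : is_udaf A' by apply/out_split_udaf.
have PC' : is_udaf C' by apply/out_split_udaf.
apply: (generated_cancel_r PA' (out_split_generated OAE PA)); rewrite -sH sF.
apply: (generated_comp PC'); last exact: out_split_generated OCE PC.
apply: (IH _ _ f') => // [x x' e|x x' [e0 l0] e].
  apply: out_split_inj => k.
  suff /(congr1 (fun y : line A => y k)) : hom_image (out_split_hom _) x = hom_image (out_split_hom _) x' by [].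
  by apply: fI => j; have /= [] := e j.
have s0 : fsrc (x 0).1 = fsrc (x' 0).1.
  apply: (W (hom_image (out_split_hom _) x) (hom_image (out_split_hom _) x')) => // j /andP[j0 jq].
  case: (ltP j q%:Z) => jq'; first by have /= [] : homE f' (x j) = homE f' (x' j) by apply: e; rewrite j0.
  case: q W IH e jq jq' => [|q] W IH e jq jq'.
    by have -> : j = 0 by lia.
  have -> : j = q%:Z + 1 by lia.
  have /= [_] : homE f' (x q%:Z) = homE f' (x' q%:Z) by apply: e; lia.
  by rewrite !out_split_next.
by congr pair.
Qed.

Lemma line_inj_op (A C : finDigraph) (f : hom A C) (f' : hom (op A) (op C)) :
  (forall a, homE f' a = homE f a) -> line_inj f -> line_inj f'.
Proof.
move=> e fI x x' xx; rewrite -(unop_lineK x) -(unop_lineK x'); congr op_line; apply: fI => k /=.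
by rewrite -!e xx.
Qed.

Lemma window_op p q : window_generated p q -> window_generated q p.
Proof.
move=> gen A C f F FE PA PC fI W.
have [F' FE'] := op_folding F; apply: (generated_op FE').
pose f' : hom (op A) (op C) := @Hom (op A) (op C) (homV f) (homE f) (hom_tgt f) (hom_src f).
have FE2 : fold_hom F' = letters f'.
  by apply: lettersP => [v|a]; rewrite FE' ?word_op FE // word_letters.
apply: (gen _ _ f') => //; [exact: op_udaf|exact: op_udaf|exact: line_inj_op fI|].
move=> x x' e0 e.
have tE (y : line (op A)) : @src (op A) (y 0) = @src A (unop_line y 0).
  have e1 : unop_line y (- 1) = y 0 by rewrite /=; congr (lfun y _); lia.
  by have := lineP (unop_line y) (- 1); rewrite e1 (_ : - 1 + 1 = 0) // => <-.
rewrite !tE; apply: W; first by rewrite -!tE.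
by move=> j jb; apply: e; lia.
Qed.

Lemma all_windows p q : window_generated p q.
Proof.
elim: q => [|q IH]; last exact: window_step.
apply: window_op; elim: p => [|p IH]; [exact: window00|exact: window_step].
Qed.

Lemma letters_generated (A C : finDigraph) (f : hom A C) (F : folding A C) :
  fold_hom F = letters f -> is_udaf A -> is_udaf C -> generated (star F).
Proof.
move=> FE PA PC.
have fI : line_inj f.
  apply: line_injective; last by move=> d; move/is_udafP: PA.
    move=> x x' [t e]; apply/line_route_eq; apply: (fold_inj (f := F) (y := hom_image f x')).
      by rewrite FE; apply/flattens_letters; exists (- t) => k; rewrite /= -e subrK.
    by rewrite FE; apply/flattens_letters; exists 0 => k; rewrite addr0.
  exact: letters_surj FE.
have [p [q W]] := window_exists fI.
exact: (all_windows FE PA PC fI W).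
Qed.

(** * Arbitrary foldings *)

Section Subdivide.
Variables (A : finDigraph) (a0 : edge A).

Definition subdiv : finDigraph := @FinDigraph (option (fvert A)) (option (fedge A))
  (fun a => if a is Some a then Some (fsrc a) else None)
  (fun a => if a is Some a then (if a == a0 :> fedge A then None else Some (ftgt a))
            else Some (ftgt a0)).

Definition subdiv_word (a : edge A) : seq (edge subdiv) :=
  if a == a0 :> fedge A then [:: Some a; None] else [:: Some a].

Lemma subdiv_wordP (a : edge A) : @chain subdiv (Some (fsrc a)) (subdiv_word a) /\
  last (Some (fsrc a)) [seq @tgt subdiv b | b <- subdiv_word a] = Some (ftgt a).
Proof.
rewrite /subdiv_word; case: ifP => e /=; rewrite e; last by [].
by rewrite (eqP e).
Qed.

Definition subdiv_hom : hom A (Walks subdiv) := @mkhom A subdiv Some subdiv_word subdiv_wordP.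

Lemma subdiv_elim :
  elimination (fun a : fedge subdiv => if a is Some a then a == a0 :> fedge A else false)
    subdiv_hom.
Proof.
split.
- by move=> [a|] [b|] //= ->.
- by move=> u v [].
- move=> a b; rewrite !word_mkhom /subdiv_word.
  by do 2!case: ifP => _; case.
- move=> a; rewrite word_mkhom /subdiv_word; case: ifP => e; [right|left].
    by exists (Some a), None.
  by exists (Some a); rewrite ?e.
move=> y k; have := lineP y (k - 1); rewrite (_ : k - 1 + 1 = k); last lia.
case: (y k) => [a|]; case: (y (k - 1)) => [b|] //=.
- case: ifP => // _ _ /negbTE e; exists a; by rewrite word_mkhom /subdiv_word e.
- move=> _ /negbTE e; exists a; by rewrite word_mkhom /subdiv_word e.
- by case: ifP => // e _ _; exists b; rewrite word_mkhom /subdiv_word e.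
Qed.
End Subdivide.

Lemma sum_option (T : finType) (F : option T -> nat) :
  (\sum_(o : option T) F o = F None + \sum_(t : T) F (Some t))%N.
Proof.
rewrite (bigD1 None) //=; congr (_ + _)%N.
rewrite (reindex_omap Some id) /=; last by case.
by apply: eq_bigl => t; rewrite eqxx.
Qed.

Definition excess (A C : finDigraph) (f : hom A (Walks C)) : nat :=
  (\sum_(a : fedge A) (size (word f a)).-1)%N.

Lemma unit_words_generated (A C : finDigraph) (F : folding A C) :
  (forall a, size (word F a) = 1%N) -> is_udaf A -> is_udaf C -> generated (star F).
Proof.
move=> sz PA PC.
have /choice[g gP] : forall a, exists x, word F a = [:: x].
  by move=> a; case: (word F a) (sz a) => [|x [|]] // _; exists x.
have gs a : src (g a) = homV F (src a).
  by have := (word_chain F a).1; rewrite gP => -[].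
have gt a : tgt (g a) = homV F (tgt a).
  by have := (word_chain F a).2; rewrite gP.
by apply: (letters_generated (f := @Hom A C (homV F) g gs gt)) => //; exact: lettersP.
Qed.

(** Subdividing an edge with a long word lets the first half carry the first letter
    and the second half carry the rest. *)
Lemma nonempty_generated (A C : finDigraph) (F : folding A C) :
  (forall a, word F a <> [::]) -> is_udaf A -> is_udaf C -> generated (star F).
Proof.
have [n Fn] : exists n, (excess F <= n)%N by exists (excess F).
elim: n A F Fn => [|n IH] A F Fn ne PA PC.
  apply: unit_words_generated => // a; have := ne a.
  move: Fn; rewrite leqn0 sum_nat_eq0 => /forallP/(_ a)/=.
  by case: (word F a) => [|x [|]].
case: (pselect (exists a, (1 < size (word F a))%N)) => [[a0 a0s]|short]; last first.
  apply: unit_words_generated => // a; have := ne a.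
  have : ~ (1 < size (word F a))%N by move=> h; apply: short; exists a.
  by case: (word F a) => [|x [|]].
have [b [s [ws s0]]] : exists b s, word F a0 = b :: s /\ s <> [::].
  by case: (word F a0) a0s => [|b [|c s]] // _; exists b, (c :: s).
have [G [GE uG gG]] := elimination_folding (subdiv_elim a0).
pose A2 := subdiv a0.
pose v (u : vert A2) : vert C := if u is Some u then homV F u else tgt b.
pose w (a : edge A2) : seq (edge C) :=
  if a is Some a then (if a == a0 :> fedge A then [:: b] else word F a) else s.
have [c0 l0] := word_chain F a0; rewrite ws /= in c0 l0; case: c0 => c0 c1.
have wP (a : edge A2) : chain (v (src a)) (w a) /\
    last (v (src a)) [seq tgt d | d <- w a] = v (tgt a).
  case: a => [a|] //=; case: ifP => [/eqP -> //|_]; exact: word_chain.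
pose g : hom A2 (Walks C) := @mkhom A2 C v w wP.
have [F2 [F2E sF]] : exists F2 : folding A2 C, fold_hom F2 = g /\ star F = star F2 \o star G.
  apply: fold_cancel_r => a; rewrite GE word_mkhom /subdiv_word.
  case: ifP => e; rewrite /= !word_mkhom /= ?e ?cats0 ?eqxx //.
  by rewrite (eqP e) ws ?cats0.
have w2 a : word F2 a = w a by rewrite F2E word_mkhom.
have PA2 : is_udaf A2 by apply/uG.
rewrite sF; apply: (generated_comp PA2); first exact: gG.
apply: IH => // [|[a|]]; last 2 first.
- by rewrite w2 /=; case: ifP.
- by rewrite w2.
have -> : excess F2 = ((size s).-1 + \sum_(a | a != a0 :> fedge A) (size (word F a)).-1)%N.
  rewrite /excess sum_option (bigD1 (a0 : fedge A)) //= !w2 /= eqxx add0n; congr addn.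
  by apply: eq_bigr => a /negbTE ae; rewrite w2 /= ae.
move: Fn; rewrite /excess (bigD1 (a0 : fedge A)) //= ws.
by case: (s) s0 => //= c s' _; rewrite addSn.
Qed.

(** Cutting an edge with an empty word that is not followed by another such edge
    lowers their number, as its prolongations have nonempty words. Such an edge
    exists, for otherwise a cycle of edges with empty words would give a line with
    degenerate image. *)
Lemma folding_generated (A C : finDigraph) (F : folding A C) :
  is_udaf A -> is_udaf C -> generated (star F).
Proof.
have [n Fn] : exists n, (#|[pred a | word F a == [::] :> seq (fedge C)]| <= n)%N by eexists.
elim: n A F Fn => [|n IH] A F Fn PA PC.
  apply: nonempty_generated => // a wa.
  by move: Fn; rewrite leqn0 => /eqP/card0_eq/(_ a); rewrite inE wa.
case: (pselect (exists a, word F a = [::])) => [[a wa]|ne]; last first.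
  by apply: nonempty_generated => // a wa; apply: ne; exists a.
have [e [we ze]] : exists e, word F e = [::] /\
    forall e', tgt e = src e' -> word F e' <> [::].
  apply: contrapT => h.
  have /choice[nx nxP] : forall e, exists e', word F e = [::] -> word F e' = [::] /\ tgt e = src e'.
    move=> e; case: (pselect (word F e = [::])) => we; last by exists e => /we.
    apply: contrapT => h1; apply: h; exists e; split=> // e' te we'.
    by apply: h1; exists e'.
  pose r i := iter i nx a.
  have r0 i : word F (r i) = [::] by elim: i => [|i /nxP[]].
  have rS i : tgt (r i) = src (r i.+1) by have [] := nxP _ (r0 i).
  have [c [i [m [_ cE]]]] := ray_cycle rS.
  have [hi _] := @fold_nondeg _ _ F c; have [z _] := hi 0.
  by rewrite /= cE r0.
have nl : src e <> tgt e by move=> h; exact: (ze e (esym h)).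
have [G GE] := cut_folding nl.
have [H [vH wH sH]] := fold_comp G F.
have PA' : is_udaf (cut e) by apply/(cut_udaf nl).
apply: (generated_cancel_r PA' (cut_generated nl GE)); rewrite -sH.
have wH' a' : word H a' = flatten (map (word F) (cut_word a')).
  by rewrite wH GE; congr (flatten (map _ _)); exact: word_cut.
apply: IH => //.
move: Fn; rewrite (cardD1 (e : fedge A)) inE we eqxx add1n ltnS; apply: leq_trans.
pose p (a : fedge (cut e)) : fedge A := match a with inl x => sval x | inr _ => e end.
have det (x : {x : fedge A | ftgt e == fsrc x}) : word F (sval x) <> [::].
  by apply: ze; exact: (eqP (svalP x)).
rewrite -(card_in_image (f := p)).
  apply: subset_leq_card; apply/fintype.subsetP => x xi.
  have /fintype.imageP[[b|b]] := xi; rewrite inE wH' /= ?we cats0 => /eqP wb ->; last by case: (det b).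
  by rewrite !inE (svalP b) /= wb.
move=> [b|b] [d|d]; rewrite !inE !wH' /= ?we ?cats0 => /eqP wb /eqP wd //=.
- by move=> bd; congr inl; apply/val_inj.
- by case: (det d).
- by case: (det b).
- by case: (det b).
Qed.

(** * Pulling transducers back along elementary foldings *)

Definition pulls_back (T B C : finDigraph) (h : folding T B) (f : folding C B) : Prop :=
  exists (T' : finDigraph) (p : folding T' T) (q : folding T' C),
    is_udaf T' /\ star f \o star q = star h \o star p.

Lemma int_up (P : int -> Prop) (a : int) :
  P a -> (forall k, a <= k -> P k -> P (k + 1)) -> forall k, a <= k -> P k.
Proof.
move=> Pa PS k ak; have -> : k = a + `|k - a|%N%:Z by lia.
elim: `|k - a|%N => [|n IH]; first by rewrite addr0.
by rewrite (_ : a + n.+1%:Z = a + n%:Z + 1); [apply: PS => //|]; lia.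
Qed.

Lemma unbounded_recurrent E (ws : int -> seq E) y f : aligned ws y f ->
  (forall N, exists z, N <= f z) -> (forall N, exists z, f z <= N) -> recurrent ws.
Proof.
move=> al hi lo; have lt := telescope_lt (fun z => (al z).1).
have stay a : (forall j, a <= j -> size (ws j) = 0%N) -> forall k, a <= k -> f k = f a.
  by move=> w0; apply: int_up => // j aj IH; rewrite (al j).1 w0 // IH addr0.
split=> N; apply: contrapT => no.
  have [z fz] := hi (f N + 1); have Nz : N < z by apply: lt; lia.
  have := @stay N _ z; rewrite (ltW Nz) => h.
  suff : f z = f N by lia.
  by apply: h => // j jN; apply: contrapT => s; apply: no; exists j.
have [z fz] := lo (f (N + 1) - 1); have zN : z < N + 1 by apply: lt; lia.
have : forall k, z <= k -> k <= N + 1 -> f k = f z.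
  apply: int_up => // j zj IH jN; rewrite (al j).1 IH; last lia.
  have -> : size (ws j) = 0%N; last by rewrite addr0.
  by apply: contrapT => s; apply: no; exists j => //; lia.
by move=> /(_ (N + 1)); lia.
Qed.

(** A property of a line that holds right after each nonempty word and persists
    holds everywhere, since nonempty words occur arbitrarily far back. *)
Lemma recurrent_ind E (ws : int -> seq E) (P : int -> Prop) : recurrent ws ->
  (forall k, ws k <> [::] -> P (k + 1)) -> (forall k, P k -> P (k + 1)) -> forall k, P k.
Proof.
move=> [_ lo] P0 PS k; have [z zk wz] := lo (k - 1).
apply: (@int_up P (z + 1)); [|by move=> j _; exact: PS|lia].
by apply: P0 => w0; apply: wz; rewrite w0.
Qed.

Section Pending.
Variables (T B C : finDigraph) (h : folding T B) (f : folding C B) (e : edge B).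
Hypothesis fP : split_words false f e.

Definition pend (b : bool) : seq (edge B) := if b then [:: e] else [::].
(** Whether an occurrence of [e] waits for its second half after reading [s]; [b]
    tells whether one was waiting before. *)
Definition pend_after (b : bool) (s : seq (edge B)) : bool :=
  last b [seq x == e :> fedge B | x <- s].

Lemma pend_after_last (b : bool) s u : @chain B u s -> (b -> u = tgt e) -> pend_after b s ->
  last u [seq tgt x | x <- s] = tgt e.
Proof.
rewrite /pend_after; elim: s b u => [|x s IH] b u /=; first by move=> _ ub /ub.
by move=> [_ c] _; apply: IH => // /eqP ->.
Qed.

Lemma pend_after_ne b b' s : s <> [::] -> pend_after b s = pend_after b' s.
Proof. by case: s. Qed.

(** The word [s], with the waiting [e] put in front and the newly waiting one taken
    off the end, is a concatenation of words of [f]. *)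
Lemma parse (b : bool) s u : @chain B u s -> (b -> u = tgt e) ->
  exists w : seq (edge C), flatten (map (word f) w) ++ pend (pend_after b s) = pend b ++ s.
Proof.
elim: s b u => [|x s IH] b u /=; first by move=> _ _; exists [::]; rewrite cats0.
move=> [xu c]; case: b => ub.
  have xe : (x == e :> fedge B) = false.
    by apply/eqP => xe; apply: (split_loop fP); apply: etrans (ub isT); rewrite -xu xe.
  have [|a wa] := split_pair fP (e' := x); first exact: etrans (esym (ub isT)) (esym xu).
  have [|w ww] := IH false _ c; first by [].
  have e1 : pend_after true (x :: s) = pend_after false s by rewrite /pend_after /= xe.
  by exists (a :: w); rewrite e1 /= wa -catA ww.
case: (eqVneq (x : fedge B) e) => xe.
  have [|w ww] := IH true _ c; first by rewrite xe.
  have e1 : pend_after false (x :: s) = pend_after true s by rewrite /pend_after /= xe eqxx.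
  by exists w; rewrite e1 ww /= xe.
have [|a wa] := split_single fP (e' := x); first exact/eqP.
have [|w ww] := IH false _ c; first by [].
have e1 : pend_after false (x :: s) = pend_after false s by rewrite /pend_after /= (negbTE xe).
by exists (a :: w); rewrite e1 /= wa -catA ww.
Qed.

Lemma reads_pend_after (y : int -> edge B) a s : reads y a s ->
  pend_after (y (a - 1) == e :> fedge B) s = (y (a + (size s)%:Z - 1) == e :> fedge B).
Proof.
elim: s a => [|x s IH] a; first by rewrite /pend_after /= addr0.
move=> /reads_cons[yx /IH]; rewrite /pend_after /= (_ : a + 1 - 1 = a) ?yx => [->|]; last lia.
by congr (y _ == _ :> fedge B); lia.
Qed.

(** An [e] can only be waiting at a vertex over the target of [e]. *)
Definition pend_ok (a : fedge T * bool) : bool :=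
  a.2 ==> (homV h (src (a.1 : edge T)) == tgt e :> fvert B).

Definition pending : finDigraph := @FinDigraph (fvert T * bool)%type {a | pend_ok a}
  (fun a => (fsrc (sval a).1, (sval a).2))
  (fun a => (ftgt (sval a).1, pend_after (sval a).2 (word h (sval a).1))).

Definition pend_edge (a : fedge T * bool) (P : pend_ok a) : edge pending :=
  exist (fun a => pend_ok a) a P.

Definition pending_hom : hom pending T :=
  @Hom pending T fst (fun a => (sval a).1) (fun=> erefl) (fun=> erefl).

Lemma pending_next (x : line pending) k :
  (sval (x (k + 1))).2 = pend_after (sval (x k)).2 (word h (sval (x k)).1).
Proof. by have := lineP x k => -[]. Qed.

Let x0 (x : line pending) := hom_image pending_hom x.

(** The bit is determined by the previous letter of the image line, so a line of [T]
    has exactly one lift. *)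
Lemma pending_bit (x : line pending) (y : line B) i : aligned (word h \o x0 x) y i ->
  forall k, (sval (x k)).2 = (y (i k - 1) == e :> fedge B).
Proof.
move=> al; have next k : pend_after (y (i k - 1) == e :> fedge B) (word h (x0 x k)) =
    (y (i (k + 1) - 1) == e :> fedge B).
  by have [-> /reads_pend_after] := al k.
apply: (recurrent_ind (@fold_nondeg _ _ h (x0 x))) => k; rewrite pending_next -next.
  by move=> ne; exact: pend_after_ne.
by move=> ->.
Qed.

Lemma pending_lift (x : line T) : exists x' : line pending, forall k, (sval (x' k)).1 = x k.
Proof.
have nd := @fold_nondeg _ _ h x; have [y [i [al _]]] := image_line (@fold_nondeg _ _ h) x 0 0.
pose b k := y (i k - 1) == e :> fedge B.
have next k : pend_after (b k) (word h (x k)) = b (k + 1).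
  by rewrite /b; have [-> /reads_pend_after] := al k.
have ok k : pend_ok (x k, b k).
  move: k; apply: (recurrent_ind nd) => k; rewrite /pend_ok /= -next; have [c l] := word_chain h (x k);
    have hx : homV h (src (x (k + 1))) = homV h (tgt (x k)) by rewrite lineP.
    move=> ne; rewrite (pend_after_ne (b k) false ne); apply/implyP => pe; apply/eqP.
    by apply: etrans hx _; rewrite -l; exact: pend_after_last pe.
  move=> /implyP bk; apply/implyP => pe; apply/eqP.
  by apply: etrans hx _; rewrite -l; apply: pend_after_last pe => // /bk/eqP.
have xL k : @tgt pending (pend_edge (ok k)) = @src pending (pend_edge (ok (k + 1))).
  by rewrite /= next; congr pair; exact: (lineP x k).
by exists (@Line pending (fun k => pend_edge (ok k)) xL).
Qed.

Lemma pending_inj (x x' : line pending) :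
  (forall k, (sval (x k)).1 = (sval (x' k)).1) -> x = x'.
Proof.
move=> xx; have [y [i [al _]]] := image_line (@fold_nondeg _ _ h) (x0 x) 0 0.
have al' : aligned (word h \o x0 x') y i by move=> k; have := al k; rewrite /= xx.
apply: line_ext => k; apply/val_inj.
rewrite [LHS]surjective_pairing [RHS]surjective_pairing.
by rewrite (pending_bit al) (pending_bit al') /= xx.
Qed.

Lemma pending_folding : exists p : folding pending T, fold_hom p = letters pending_hom.
Proof.
apply: letters_folding => [x|x x' e']; last exact: pending_inj.
by have [x' xE] := pending_lift x; exists x'.
Qed.

Lemma pending_udaf : is_udaf T -> is_udaf pending.
Proof.
move=> /is_udafP br; apply/is_udafP => d x.
have [t [[K tK] [k ne]]] := br d (x0 x); have [x' xE] := pending_lift t.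
have nd := @fold_nondeg _ _ h (x0 x).
exists x'; split; last by exists k => xk; apply: ne; rewrite -xE xk.
have agree j : beyond d K j -> (sval (x' j)).1 = (sval (x j)).1 by move=> /tK; rewrite -xE.
case: d tK agree => tK agree.
  exists K => j; rewrite /beyond => jK; apply/val_inj; rewrite [LHS]surjective_pairing [RHS]surjective_pairing.
  rewrite agree //; congr pair; move: j jK; apply: (recurrent_ind nd) => j.
    move=> wj jK; rewrite !pending_next agree; last by rewrite /beyond; lia.
    exact: pend_after_ne.
  by move=> IH jK; rewrite !pending_next agree ?IH //; rewrite ?/beyond; lia.
have [z zK wz] := nd.1 K.
exists (z + 1) => j; rewrite /beyond => jz; apply/val_inj; rewrite [LHS]surjective_pairing [RHS]surjective_pairing.
rewrite agree; last by rewrite /beyond; lia.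
congr pair; move: j jz; apply: int_up => [|j jz IH].
  by rewrite !pending_next agree //; apply: pend_after_ne => w0; apply: wz; rewrite /= w0.
by rewrite !pending_next agree ?IH //; rewrite /beyond; lia.
Qed.

Lemma pending_words : exists q : hom pending (Walks C), forall a,
  flatten (map (word f) (word q a)) ++ pend (pend_after (sval a).2 (word h (sval a).1)) =
  pend (sval a).2 ++ word h (sval a).1.
Proof.
have [vi viK vK] := split_homV fP.
have bo (a : edge pending) : (sval a).2 -> homV h (src ((sval a).1 : edge T)) = tgt e.
  by move=> a2; have /implyP/(_ a2)/eqP := svalP a.
have /choice[w wP] : forall a : edge pending, exists w : seq (edge C),
    flatten (map (word f) w) ++ pend (pend_after (sval a).2 (word h (sval a).1)) =
    pend (sval a).2 ++ word h (sval a).1.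
  by move=> a; apply: parse (word_chain h _).1 _; exact: bo.
pose v (t : vert pending) : vert C := vi (if t.2 then src e else homV h t.1).
have wne a : word f a <> [::] by case: (split_cover fP a) => [[e' _ ->]|[e' ->]].
have wc a : chain (v (src a)) (w a) /\ last (v (src a)) [seq tgt b | b <- w a] = v (tgt a).
  have [c l] := word_chain h (sval a).1.
  have c1 : @chain B (if (sval a).2 then src e else homV h (src ((sval a).1 : edge T)))
      (pend (sval a).2 ++ word h (sval a).1).
    by have := bo a; rewrite /pend; case: ((sval a).2) => //= /(_ isT) <-.
  have l1 : last (if (sval a).2 then src e else homV h (src ((sval a).1 : edge T)) : vert B)
      [seq tgt b | b <- pend (sval a).2 ++ word h (sval a).1] = homV h (tgt ((sval a).1 : edge T)).
    by have := bo a; rewrite /pend; case: ((sval a).2) => //= /(_ isT) <-.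
  rewrite -wP in c1 l1; have [c2 c3] := chain_catP c1.
  have := @chain_reflect C B f (v (src a)) (w a) (can_inj viK) wne.
  rewrite {1 3}/v /= vK => /(_ c2)[c4 l4]; split=> //.
  apply: (can_inj viK); rewrite l4 /v /= vK.
  move: c3 l1; rewrite map_cat last_cat /pend.
  by case: pend_after => /= [[<- _]|_].
exists (@mkhom pending C v w wc) => a; rewrite word_mkhom; exact: wP.
Qed.

(** The words of [f] read along [q] are the words of [h] moved back by one step
    wherever an [e] is waiting, so both composites have the same image lines. *)
Lemma pending_pulls : is_udaf T -> pulls_back h f.
Proof.
move=> PT; have [p pE] := pending_folding; have [q qP] := pending_words.
pose W (x : line pending) k := flatten (map (word f) (word q (x k))).
have WA x (y : line B) i : aligned (word h \o x0 x) y i ->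
    aligned (W x) y (fun k => i k - (sval (x k)).2%:Z).
  move=> al k; have [iS r] := al k; have qk := qP (x k).
  have r1 : reads y (i k - (sval (x k)).2%:Z) (pend (sval (x k)).2 ++ word h (sval (x k)).1).
    have := pending_bit al k; case: ((sval (x k)).2) => /= bk; last by rewrite subr0.
    by apply/reads_cons; split; [exact/eqP|rewrite subrK].
  split; last by move: r1; rewrite -qk => /reads_cat[].
  rewrite pending_next iS /=; have /(congr1 size) := qk; rewrite !size_cat -/(W x k).
  have sp b : size (pend b) = b by case: b.
  rewrite !sp; move: (size (W x k)) (size (word h (sval (x k)).1)) (sval (x k)).2
    (pend_after (sval (x k)).2 (word h (sval (x k)).1)) => u v b1 b2.
  by case: b1; case: b2 => /=; lia.
have WR x : recurrent (W x).
  have [y [i [al _]]] := image_line (@fold_nondeg _ _ h) (x0 x) 0 0.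
  have [hi lo] := aligned_unbounded (@fold_nondeg _ _ h (x0 x)) al.
  apply: (unbounded_recurrent (WA x y i al)) => N.
    by have [z zP] := hi (N + 1); exists z; have := zP z (lexx z); case: (sval _).2; lia.
  by have [z zP] := lo N; exists z; have := zP z (lexx z); case: (sval _).2; lia.
have nd : nondeg q.
  move=> x; have [hi lo] := WR x.
  have key z : size (W x z) <> 0%N -> size ((word q \o x) z) <> 0%N.
    by rewrite /W /=; case: (word q (x z)).
  by split=> N; [have [z ? /key] := hi N|have [z ? /key] := lo N]; exists z.
have sp x : star p (line_route x) = line_route (x0 x).
  by apply/star_line_route; rewrite pE; apply/flattens_letters; exists 0 => k; rewrite addr0.
have comm (x : line pending) (z : line C) :
    flattens (word q \o x) z -> star f (line_route z) = star h (star p (line_route x)).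
  move=> [j aj]; rewrite sp.
  have [y [i [al _]]] := image_line (@fold_nondeg _ _ h) (x0 x) 0 0.
  have [y' [i' [al' _]]] := image_line (@fold_nondeg _ _ f) z 0 0.
  have -> : star h (line_route (x0 x)) = line_route y by apply/star_line_route; exists i.
  have -> : star f (line_route z) = line_route y' by apply/star_line_route; exists i'.
  apply: (flattens_line_route (WR x)); last by exists (fun k => i k - (sval (x k)).2%:Z); exact: WA.
  by exists (i' \o j); exact: aligned_comp aj al'.
have [||Q QE] := mkfold nd.
- move=> z; have [y fz] := line_route_surj (star f (line_route z)).
  have [t ht] := fold_surj h y; have [x xE] := pending_lift t.
  exists x; have [z' [j [aj _]]] := image_line nd x 0 0.
  have fl : flattens (word q \o x) z' by exists j.
  apply: line_route_flattens (fl); apply/(bij_inj (fold_bij f)); rewrite -/(star f _) -/(star f _).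
  rewrite (comm _ _ fl) fz sp (_ : x0 x = t); first exact/star_line_route.
  by apply: line_ext => k; rewrite -xE.
- move=> x x' z /comm e1 /comm e2.
  apply/(bij_inj (fold_bij p))/(bij_inj (fold_bij h)).
  by rewrite -/(star p _) -/(star p _) -/(star h _) -/(star h _) -e1 -e2.
exists pending, p, Q; split; first exact: pending_udaf.
apply/funext => R; have [x ->] := line_route_surj R.
have [z [j [aj _]]] := image_line nd x 0 0.
have fl : flattens (word q \o x) z by exists j.
by rewrite /= -(comm _ _ fl); congr (star f _); apply/star_line_route; rewrite QE.
Qed.
End Pending.

(** An isolated vertex is not on any line, so a transducer into [B] can be restricted
    to the vertices that do not lie over it. *)
Section Avoiding.
Variables (T B C : finDigraph) (h : folding T B) (f : folding C B) (g : hom C B) (v : vert B).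
Hypothesis fg : fold_hom f = letters g.
Hypothesis gV : injective (homV g).
Hypothesis gVr : forall u, u <> v -> exists w, homV g w = u.
Hypothesis gE : forall b, exists c, homE g c = b.
Hypothesis iso : forall b : edge B, src b <> v /\ tgt b <> v.

Definition avoids (t : fvert T) : bool := homV h t != v :> fvert B.

Lemma avoid_tgt (a : edge T) : avoids (fsrc a) -> avoids (ftgt a).
Proof.
move=> /eqP sa; apply/eqP; have [c l] := word_chain h a; rewrite -[homV h _]l.
elim/last_ind: (word h a) => [|w b _] //=.
by rewrite map_rcons last_rcons; case: (iso b).
Qed.

Definition avoiding : finDigraph :=
  @FinDigraph {t | avoids t} {a | avoids (fsrc a)}
    (fun a => exist (fun t => avoids t) _ (svalP a))
    (fun a => exist (fun t => avoids t) _ (avoid_tgt (svalP a))).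

Definition avoiding_hom : hom avoiding T :=
  @Hom avoiding T sval sval (fun=> erefl) (fun=> erefl).

Lemma avoiding_emb : embedding avoiding_hom.
Proof.
split=> [t u e|a b e|x k]; [exact/val_inj|exact/val_inj|].
have P : avoids (fsrc (x k)).
  rewrite /avoids; apply/eqP => xv.
  have dead (a : edge T) : homV h (src a) = v -> word h a = [::] /\ homV h (tgt a) = v.
    move=> sa; have [c l] := word_chain h a; move: c l; rewrite sa.
    by case: (word h a) => [|b w] //= [bv]; have [] := iso b; case.
  have stay : forall j, k <= j -> homV h (src (x j)) = v.
    by apply: int_up => // j _ /dead[_]; rewrite lineP.
  have [hi _] := @fold_nondeg _ _ h x; have [z zk] := hi k.
  by rewrite /= (dead _ (stay z zk)).1.
by exists (exist (fun a => avoids (fsrc a)) _ P).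
Qed.

Lemma avoiding_pulls : is_udaf T -> pulls_back h f.
Proof.
move=> PT; have [p pE] := embedding_folding avoiding_emb.
have wf : word f = fun c => [:: homE g c] by apply/funext => c; rewrite fg word_letters.
have /choice[w wP] : forall a : edge avoiding, exists w, flatten (map (word f) w) = word h (sval a).
  move=> a; elim: (word h (sval a)) => [|b s [w ws]]; first by exists [::].
  by have [c cb] := gE b; exists (c :: w); rewrite /= ws wf cb.
have /choice[vv vP] : forall t : vert avoiding, exists u, homV f u = homV h (sval t).
  move=> t; have [|u uE] := gVr (u := homV h (sval t)); first exact/eqP/(svalP t).
  by exists u; rewrite fg.
have fI : injective (homV f) by rewrite fg.
have wc a : chain (vv (src a)) (w a) /\ last (vv (src a)) [seq tgt b | b <- w a] = vv (tgt a).
  have [c l] := word_chain h (sval a).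
  have := @chain_reflect C B f (vv (src a)) (w a) fI; rewrite wP vP.
  move=> [|//|c' l']; first by move=> b; rewrite wf.
  by split=> //; apply: fI; rewrite l' vP.
pose q : hom avoiding (Walks C) := @mkhom avoiding C vv w wc.
have [H [_ wH sH]] := fold_comp p h.
have [Q [_ sQ]] : exists Q : folding avoiding C, fold_hom Q = q /\ star H = star f \o star Q.
  by apply: fold_cancel_l => a; rewrite wH pE word_letters /= cats0 word_mkhom wP.
exists avoiding, p, Q; split; last by rewrite -sQ sH.
exact/(embedding_udaf avoiding_emb).
Qed.
End Avoiding.

Lemma pulls_back_op (T B C : finDigraph) (h : folding T B) (f : folding C B)
    (h' : folding (op T) (op B)) (f' : folding (op C) (op B)) :
  fold_hom h' = op_hom h -> fold_hom f' = op_hom f -> pulls_back h' f' -> pulls_back h f.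
Proof.
case: T h h' => [TV TE Ts Tt] h h'; case: C f f' => [CV CE Cs Ct] f f' hE fE.
move=> [T' [p [q [PT' e]]]].
have [P PE] := op_folding p; have [Q QE] := op_folding q.
exists (op T'), P, Q; split; first exact: op_udaf.
apply/funext => R; have [x ->] := line_route_surj R; rewrite -(unop_lineK x).
have [t te] := line_route_surj (star p (line_route (unop_line x))).
have [z ze] := line_route_surj (star q (line_route (unop_line x))).
have [y ye] := line_route_surj (star h' (line_route t)).
have fz : star f' (line_route z) = line_route y.
  by have := congr1 (@^~ (line_route (unop_line x))) e; rewrite /= te ze ye.
rewrite /=; have -> := star_op PE te; have -> := star_op QE ze.
have oo (V E : finType) (s r : E -> V) (u : line (op (FinDigraph s r))) : op_line u = unop_line u.
  exact: line_ext.
transitivity (line_route (unop_line y)); [rewrite oo|rewrite oo; apply/esym].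
  by apply/star_line_route; apply: flattens_unop; rewrite -fE; apply/star_line_route.
by apply/star_line_route; apply: flattens_unop; rewrite -hE; apply/star_line_route.
Qed.

Lemma elementary_pulls_back (T B C : finDigraph) (h : folding T B) (f : folding C B) :
  elementary f -> is_udaf T -> pulls_back h f.
Proof.
move=> [[g [v [fg [gV gE] rV rE iso]]]|/split_edgeP[e fP]|/split_edgeP[e fP]] PT.
- apply: (avoiding_pulls h (v := v) fg gV) => // [u uv|b].
    by have : [set w : vert B | w <> v]%classic u by []; rewrite -rV => -[w _ <-]; exists w.
  by have : [set: edge B]%classic b by []; rewrite -rE => -[c _ <-]; exists c.
- exact: (pending_pulls h fP PT).
have [h' hE] := op_folding h; have [f' fE] := op_folding f.
have fP' : split_words false f' e by rewrite fE; exact: (split_words_op fP).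
exact: pulls_back_op hE fE (pending_pulls h' fP' (op_udaf PT)).
Qed.

(** * The three classes of maps *)

(** Composing with an elementary folding extends the right leg of a transducer;
    composing with the inverse of one pulls the transducer back. *)
Lemma transducerable_post (Z A B : UDAF) (P : Route Z -> Route A) (F : Route A -> Route B) :
  UDAFG' F -> transducerable P -> transducerable (F \o P).
Proof.
move=> uF; elim: uF Z P => {A B F} [A|A B f ef|A B f G ef fG Gf|A B C F G _ IHF _ IHG] Z P tP.
- exact: tP.
- have [T [g [h [g' [gK Kg <-]]]]] := tP; have [H [_ _ sH]] := fold_comp h f.
  by exists T, g, H, g'; split=> //; rewrite sH.
- have [T [g [h [g' [gK Kg <-]]]]] := tP.
  have [T' [p [q [PT' e]]]] := elementary_pulls_back h ef (@udafP T).
  have [H [_ _ sH]] := fold_comp p g; have [H' HK KH] := fold_bij H.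
  exists (MkUDAF PT'), H, q, H'; split=> //.
  apply/funext => R /=.
  (* [H'] is the inverse of the left leg [star g o star p] *)
  have R' : R = star g (star p (H' R)) by rewrite -[LHS]KH -/(star H _) sH.
  rewrite {2}R' gK; have /= <- := congr1 (@^~ (H' R)) e.
  by rewrite fG.
- exact: IHG (IHF _ _ tP).
Qed.

Lemma folding_id (A : finDigraph) : exists f : folding A A, star f = id.
Proof.
pose i : hom A A := @Hom A A id id (fun=> erefl) (fun=> erefl).
have iE : embedding i by split=> // y k; exists (y k).
have [f fE] := embedding_folding iE; exists f; apply/funext => R; have [x ->] := line_route_surj R.
by apply/star_line_route; rewrite fE; apply/flattens_letters; exists 0 => k; rewrite addr0.
Qed.

Lemma UDAFG'_transducerable (A B : UDAF) (F : Route A -> Route B) :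
  UDAFG' F -> transducerable F.
Proof.
move=> uF; apply: (transducerable_post (P := id) uF).
by have [f fE] := folding_id A; exists A, f, f, id; split=> [R|R|] //; rewrite fE.
Qed.

Lemma UDAFG'_star_folding (A B : UDAF) (f : folding A B) : UDAFG' (star f).
Proof.
case: A B f => A PA [B PB] f; exact: (folding_generated f PA PB).
Qed.

Lemma UDAFG'_of_inverse (A B : UDAF) (F : Route A -> Route B) (G : Route B -> Route A) :
  UDAFG' F -> cancel F G -> cancel G F -> UDAFG' G.
Proof.
move=> uF FG GF; have [G' [FG' _ uG']] := UDAFG'_inverse uF.
suff -> : G = G' by [].
by apply/funext => R; rewrite -[in RHS](GF R) FG'.
Qed.

Lemma UDAFG_UDAFG' (A B : UDAF) (F : Route A -> Route B) : UDAFG F <-> UDAFG' F.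
Proof.
split.
  elim=> {A B F} [A|A B f|A B C F G _ uF _ uG|A B F G _ uF FG GF].
  - exact: UDAFG'_id.
  - exact: UDAFG'_star_folding.
  - exact: UDAFG'_comp uF uG.
  - exact: UDAFG'_of_inverse uF FG GF.
elim=> {A B F} [A|A B f _|A B f G _ fG Gf|A B C F G _ uF _ uG].
- exact: UDAFG_id.
- exact: UDAFG_star.
- exact: UDAFG_inv (UDAFG_star f) fG Gf.
- exact: UDAFG_comp uF uG.
Qed.

Lemma transducerable_UDAFG' (A B : UDAF) (F : Route A -> Route B) :
  transducerable F -> UDAFG' F.
Proof.
move=> [T [g [h [g' [gK Kg <-]]]]].
apply: UDAFG'_comp; last exact: UDAFG'_star_folding.
exact: UDAFG'_of_inverse (UDAFG'_star_folding g) gK Kg.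
Qed.

Lemma is_iso_UDAFG' (A B : UDAF) (F : Route A -> Route B) : is_iso UDAFG' F <-> UDAFG' F.
Proof.
split=> [[]//|uF]; split=> //; have [G [FG GF uG]] := UDAFG'_inverse uF.
by exists G.
Qed.

Theorem theorem4p3 (A B : UDAF) (phi : Route A -> Route B)
    (hphi : bijective phi) :
  (is_iso UDAFG phi <-> is_iso UDAFG' phi) /\
  (is_iso UDAFG' phi <-> transducerable phi).
Proof.
split.
  by split=> -[uF [G [uG FG GF]]]; (split; first exact/UDAFG_UDAFG');
    exists G; split=> //; exact/UDAFG_UDAFG'.
rewrite is_iso_UDAFG'; split; [exact: UDAFG'_transducerable|exact: transducerable_UDAFG'].
Qed.
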